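(* Let $G$ be the simply connected simple complex algebraic group of type $E_6$ and let $H\subset G$ be the maximal reductive subgroup of type $F_4$. Then for all $k\in\mathbb{N}$: \begin{align*} \text{i)}\quad & \mathrm{res}^G_H(V_{k\omega_1})=\bigoplus_{a_1\le k}V_{a_1\lambda_4},\\ \text{ii)}\quad & \mathrm{res}^G_H(V_{k\omega_2})=\bigoplus_{a_1+a_2=k}V_{a_1\lambda_1+a_2\lambda_4},\\ \text{iii)}\quad & \mathrm{res}^G_H(V_{k\omega_3})=\bigoplus_{a_1+a_2+a_3=k}V_{a_1\lambda_1+a_2\lambda_3+a_3\lambda_4},\\ \text{iv)}\quad & \mathrm{res}^G_H(V_{k\omega_5})=\bigoplus_{a_1+a_2+a_3=k}V_{a_1\lambda_1+a_2\lambda_3+a_3\lambda_4},\\ \text{v)}\quad & \mathrm{res}^G_H(V_{k\omega_6})=\bigoplus_{a_1\le k}V_{a_1\lambda_4}, \end{align*} where the $a_i$ run over non-negative integers.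
   Context: The ground field is $\mathbb{C}$. $\alpha_1,\dots,\alpha_6$ are the simple roots and $\omega_1,\ldots,\omega_6$ the fundamental weights of $G$ in Bourbaki numbering. The subgroup $H$ is the connected subgroup whose Lie algebra is the simple subalgebra of type $F_4$ having simple root vectors $X_{\alpha_2}$, $X_{\alpha_4}$, $\frac{1}{\sqrt2}(X_{\alpha_3}+X_{\alpha_5})$, $\frac{1}{\sqrt2}(X_{\alpha_1}+X_{\alpha_6})$ (in this order, in Bourbaki numbering of $F_4$, the first two being long), where $X_\alpha$ is a suitably chosen nonzero root vector for $\alpha$; it is unique up to conjugacy in $\mathrm{Aut}(G)$. $\lambda_1,\ldots,\lambda_4$ are the fundamental weights of $H$ in Bourbaki numbering. $V_\mu$ denotes the irreducible module (of $G$ or of $H$ respectively) of highest weight $\mu$, and $\mathrm{res}^G_H$ denotes restriction of a $G$-module to $H$; equality means isomorphism of $H$-modules. *)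

(* Defs.v *)
From HB Require Import structures.
From mathcomp Require Import all_boot all_order all_algebra.
From mathcomp Require Import mpoly.
Set Implicit Arguments.
Unset Strict Implicit.
Unset Printing Implicit Defensive.
Import Order.TTheory GRing.Theory Num.Theory.
Local Open Scope ring_scope.

Section LinearAlgebraicGroups.
Context {F : closedFieldType}.

(* Polynomial functions on n x n matrices: the variables are the n * n matrix
   entries, enumerated as in mxvec. *)
Definition entry n (A : 'M[F]_n) (k : 'I_(n * n)) : F := mxvec A 0 k.

Definition zariski_closed n (Z : 'M[F]_n -> Prop) : Prop :=
  exists S : {mpoly F[n * n]} -> Prop,
    forall g, Z g <-> (forall p, S p -> p.@[entry g] = 0).

(* Linear algebraic groups are identified with their F-points: they are the
   Zariski-closed subgroups of GL_n(F). *)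
Record linAlgGroup n := LinAlgGroup {
  points :> 'M[F]_n -> Prop;
  points_closed : exists2 Z, zariski_closed Z &
                    forall g, points g <-> g \in unitmx /\ Z g;
  points1 : points 1%:M;
  pointsM : forall g h, points g -> points h -> points (g *m h);
  pointsV : forall g, points g -> points (invmx g)
}.

Definition zariski_connected n (G : linAlgGroup n) : Prop :=
  forall A B : 'M[F]_n -> Prop, zariski_closed A -> zariski_closed B ->
    (forall g, G g -> A g \/ B g) ->
    (forall g, G g -> A g -> B g -> False) ->
    (forall g, G g -> A g) \/ (forall g, G g -> B g).

(* The coordinate ring of GL_n is F[x_ij][1/det]. *)
Definition represents n (G : linAlgGroup n) (p : {mpoly F[n * n]}) (r : nat)
    (f : 'M[F]_n -> F) : Prop :=
  forall g, G g -> f g = p.@[entry g] / \det g ^+ r.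

Definition regular_on n (G : linAlgGroup n) (f : 'M[F]_n -> F) : Prop :=
  exists p r, represents G p r f.

Definition alg_morphism n m (G : linAlgGroup n) (K : linAlgGroup m)
    (phi : 'M[F]_n -> 'M[F]_m) : Prop :=
  [/\ forall g, G g -> K (phi g),
      forall g h, G g -> G h -> phi (g *m h) = phi g *m phi h &
      forall i j, regular_on G (fun g => phi g i j)].

Definition alg_isomorphism n m (G : linAlgGroup n) (K : linAlgGroup m)
    (phi : 'M[F]_n -> 'M[F]_m) : Prop :=
  alg_morphism G K phi /\
  exists psi, [/\ alg_morphism K G psi,
                  forall g, G g -> psi (phi g) = g &
                  forall h, K h -> phi (psi h) = h].

Definition isogeny n m (G : linAlgGroup n) (K : linAlgGroup m)
    (phi : 'M[F]_n -> 'M[F]_m) : Prop :=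
  [/\ alg_morphism G K phi,
      forall h, K h -> exists2 g, G g & phi g = h &
      exists s : seq 'M[F]_n, forall g, G g -> phi g = 1%:M -> g \in s].

Definition simply_connected n (G : linAlgGroup n) : Prop :=
  forall m (K : linAlgGroup m) (phi : 'M[F]_m -> 'M[F]_n),
    zariski_connected K -> isogeny K G phi -> alg_isomorphism K G phi.

Definition dpoly1 n (p : {mpoly F[n * n]}) (X : 'M[F]_n) : F :=
  \sum_(k < n * n) entry X k * (p^`M(k)).@[entry 1%:M].

(* Tangent space at the identity. *)
Definition lie_alg n (G : linAlgGroup n) (X : 'M[F]_n) : Prop :=
  forall p : {mpoly F[n * n]},
    (forall g, G g -> p.@[entry g] = 0) -> dpoly1 p X = 0.

(* The regular function f has derivative c at the identity along X; the second
   term comes from d(det^-r)_1(X) = - r tr X.  For X in lie_alg G, c does not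
   depend on the choice of (p, r). *)
Definition has_deriv1 n (G : linAlgGroup n) (f : 'M[F]_n -> F) (X : 'M[F]_n)
    (c : F) : Prop :=
  exists p r, represents G p r f /\
    c = dpoly1 p X - p.@[entry 1%:M] * (\tr X *+ r).

Record gmodule n (G : linAlgGroup n) := GModule {
  gspace :> vectType F;
  gact : 'M[F]_n -> 'End(gspace);
  gact1 : gact 1%:M = \1%VF;
  gactM : forall g h, G g -> G h -> gact (g *m h) = (gact g \o gact h)%VF;
  gact_regular : forall (phi : 'Hom(gspace, F^o)) (v : gspace),
    regular_on G (fun g => phi (gact g v))
}.

Section Restriction.
Context (n : nat) (G H : linAlgGroup n).
Context (sHG : forall g, H g -> G g) (V : gmodule G).

Fact resM g h : H g -> H h -> gact V (g *m h) = (gact V g \o gact V h)%VF.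
Proof. by move=> Hg Hh; apply: gactM; apply: sHG. Qed.

Fact res_regular (phi : 'Hom(V, F^o)) (v : V) :
  regular_on H (fun g => phi (gact V g v)).
Proof.
have [p [r pP]] := gact_regular phi v.
by exists p, r => g /sHG; apply: pP.
Qed.

Definition res : gmodule H := GModule (gact1 V) resM res_regular.
End Restriction.

Definition irreducible n (G : linAlgGroup n) (V : gmodule G) : Prop :=
  {: V}%VS <> 0%VS /\
  forall U : {vspace V}, (forall g, G g -> (gact V g @: U <= U)%VS) ->
    U = 0%VS \/ U = {: V}%VS.

(* X . v = w for the differentiated action of the Lie algebra of G on V. *)
Definition lie_acts n (G : linAlgGroup n) (V : gmodule G) (X : 'M[F]_n)
    (v w : V) : Prop :=
  forall phi : 'Hom(V, F^o),
    has_deriv1 G (fun g => phi (gact V g v)) X (phi w).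

(* V is isomorphic, as a G-module, to the external direct sum of the W i. *)
Definition is_direct_sum n (G : linAlgGroup n) (V : gmodule G) (I : finType)
    (W : I -> gmodule G) : Prop :=
  exists iota : forall i, 'Hom(W i, V),
    (forall i g (w : W i), G g ->
       iota i (gact (W i) g w) = gact V g (iota i w)) /\
    bijective (fun w : {dffun forall i, W i} => \sum_i iota i (w i)).

Definition lie_bracket n (X Y : 'M[F]_n) : 'M[F]_n := X *m Y - Y *m X.

Definition lie_subalgebra n (L : 'M[F]_n -> Prop) : Prop :=
  [/\ L 0, forall a X Y, L X -> L Y -> L (a *: X + Y) &
      forall X Y, L X -> L Y -> L (lie_bracket X Y)].

(* L is the simple Lie algebra with Cartan matrix A, with Cartan subalgebra
   spanned by the h_i = [e_i, f_i], simple root vectors e_i and negative simple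
   root vectors f_i (Serre's presentation; e_i != 0 excludes L = 0).
   Convention: A i j = <alpha_j, alpha_i^vee> = alpha_j(h_i). *)
Definition chevalley_generators n r (A : 'M[int]_r) (L : 'M[F]_n -> Prop)
    (e f : 'I_r -> 'M[F]_n) : Prop :=
  let h i := lie_bracket (e i) (f i) in
  [/\ forall i, e i != 0,
      forall X, L X <-> (forall M, lie_subalgebra M ->
                           (forall i, M (e i) /\ M (f i)) -> M X),
      forall i j, lie_bracket (h i) (h j) = 0 /\
                  (i != j -> lie_bracket (e i) (f j) = 0),
      forall i j, lie_bracket (h i) (e j) = (A i j)%:~R *: e j /\
                  lie_bracket (h i) (f j) = - (A i j)%:~R *: f j &
      forall i j, i != j ->
        iter `|1 - A i j|%N (lie_bracket (e i)) (e j) = 0 /\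
        iter `|1 - A i j|%N (lie_bracket (f i)) (f j) = 0].

(* Weights are given by their coordinates in the basis of fundamental weights:
   mu 0 i = <mu, alpha_i^vee>. *)
Definition irreducible_of_highest_weight n (G : linAlgGroup n) r
    (e f : 'I_r -> 'M[F]_n) (mu : 'rV[int]_r) (V : gmodule G) : Prop :=
  irreducible V /\
  exists2 v : V, v != 0 & forall i : 'I_r,
    lie_acts (e i) v 0 /\
    lie_acts (lie_bracket (e i) (f i)) v ((mu 0 i)%:~R *: v).

(* V is isomorphic to the direct sum over i : I of the modules V_(nu i). *)
Definition decomposes_as n (G : linAlgGroup n) r (e f : 'I_r -> 'M[F]_n)
    (V : gmodule G) (I : finType) (nu : I -> 'rV[int]_r) : Prop :=
  exists W : I -> gmodule G,
    (forall i, irreducible_of_highest_weight e f (nu i) (W i)) /\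
    is_direct_sum V W.

End LinearAlgebraicGroups.

Definition mx_of_rows r (s : seq (seq int)) : 'M[int]_r :=
  \matrix_(i < r, j < r) nth 0 (nth [::] s i) j.

(* Bourbaki numbering; 'I_r is 0-based, so i : 'I_r stands for alpha_(i+1). *)
Definition cartan_E6 : 'M[int]_6 := mx_of_rows 6
  [:: [::  2;  0; -1;  0;  0;  0];
      [::  0;  2;  0; -1;  0;  0];
      [:: -1;  0;  2; -1;  0;  0];
      [::  0; -1; -1;  2; -1;  0];
      [::  0;  0;  0; -1;  2; -1];
      [::  0;  0;  0;  0; -1;  2]].

(* alpha_1, alpha_2 are the long simple roots; with the convention of
   chevalley_generators, this is the transpose of Bourbaki's matrix. *)
Definition cartan_F4 : 'M[int]_4 := mx_of_rows 4
  [:: [::  2; -1;  0;  0];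
      [:: -1;  2; -1;  0];
      [::  0; -2;  2; -1];
      [::  0;  0; -1;  2]].

(* The i-th fundamental weight, with i numbered from 1 as in Bourbaki. *)
Definition fundw r (i : nat) : 'rV[int]_r := \row_(j < r) (j.+1 == i)%:R.

Notation "''omega_' i" := (fundw 6 i) (at level 8, i at level 2).
Notation "''lambda_' i" := (fundw 4 i) (at level 8, i at level 2).

(* Simple root vectors of F4 in E6, and the negative ones: the latter are
   rescaled by sqrt 2 so that their brackets are the simple coroots
   h_2, h_4, h_3 + h_5, h_1 + h_6. *)
Section Folding.
Context {F : numClosedFieldType} {n : nat}.

Definition fold_gen (c : F) (x : 'I_6 -> 'M[F]_n) (i : 'I_4) : 'M[F]_n :=
  let X j := x (inord j.-1) in
  nth 0 [:: X 2; X 4; c *: (X 3 + X 5); c *: (X 1 + X 6)]%N i.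

Definition fold_e := fold_gen (sqrtC 2)^-1.
Definition fold_f := fold_gen (sqrtC 2).
End Folding.

Definition sum2 (k : nat) : finType :=
  {a : 'I_k.+1 * 'I_k.+1 | a.1 + a.2 == k}%N.
Definition sum3 (k : nat) : finType :=
  {a : 'I_k.+1 * 'I_k.+1 * 'I_k.+1 | a.1.1 + a.1.2 + a.2 == k}%N.

(* Main.v *)
Require Import Defs.
From HB Require Import structures.
From mathcomp Require Import all_boot all_order all_algebra.
From mathcomp Require Import reals complex.
From mathcomp Require Import mpoly ssrAC zify ring.
From Stdlib Require Import Classical IndefiniteDescription.
Set Implicit Arguments.
Unset Strict Implicit.
Unset Printing Implicit Defensive.
Import Order.TTheory GRing.Theory Num.Theory.
Local Open Scope ring_scope.

(* The diagram automorphism reduces to the highest weights k omega_i, i = 1, 2, 3.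
   The fundamental module is realised on 27 x 27 matrices, unitarily, so that V is
   the cyclic submodule M of the k-th tensor power generated by u^(x)k, with u the
   highest weight vector.  Exponentials of lowering operators move u to a vector
   w = y_1 + ... + y_r, a sum of F4-weight vectors, whose line is in the open orbit
   of the Borel subgroup B of H on the flag variety G [u] (the latter is spherical):
   g w is contained in b w + C w, b spanned by the lowering operators and coroots of
   F4.  Hence b generates M from w^(x)k, so that by unitarity no singular vector of
   M for F4 is orthogonal to w^(x)k.  Therefore M is multiplicity free as an
   F4-module, and its highest weights are sums of k weights of the y_i.  All of
   these occur: for singular vectors x_i not orthogonal to y_i, project the
   tensor products of the x_i to M.
   The passage from the groups to their Lie algebras uses that the groups are
   connected: a regular function whose invariant derivatives at 1 all vanish is
   zero near 1, by Krull's intersection theorem. *)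

(** * Stable subspaces and singular vectors *)

(** All k are treated at once because the verifications concern w alone: the inclusion of g w in b w
    + C w and the pairings of w with the x_i are statements about 27 x 27 integer matrices, decided
    by computation, and tensor powers carry them over to w^(x)k. Multiplicity one holds because two
    singular vectors of the same weight have a nontrivial combination orthogonal to w^(x)k.
    Unitarity replaces complete reducibility twice: in splitting M under F4, and in identifying the
    abstractly given V with the cyclic module of u^(x)k. For k = 1 the y_i correspond to the
    constituents of 27 = 26 + 1, 78 = 52 + 26 and 351 = 52 + 273 + 26. On the group side the
    exponential map is not algebraic, so stability under the Lie algebra is transferred to the group
    through Taylor coefficients of matrix coefficients at 1. *)

Section Subspaces.
Context {F : fieldType} {V : vectType F}.

(** Gives access to subspaces described by a property, with no basis at hand: as long as the
    subspace found so far does not exhaust P, a further vector satisfying P enlarges it, and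
    dimensions are bounded. *)
Lemma vspace_of_pred (P : V -> Prop) :
  P 0 -> (forall a x y, P x -> P y -> P (a *: x + y)) ->
  exists U : {vspace V}, forall x, (x \in U) <-> P x.
Proof.
move=> P0 Plin.
have grow d : (exists U : {vspace V}, forall x, (x \in U) <-> P x) \/
   exists U : {vspace V}, (forall x, x \in U -> P x) /\ (d <= \dim U)%N.
  elim: d => [|d [|[U [UP dU]]]]; [|by left|].
    by right; exists 0%VS; split=> // x; rewrite memv0 => /eqP ->.
  case: (classic (exists x, P x /\ x \notin U)) => [[x [Px xU]]|nx]; last first.
    left; exists U => x; split; first exact: UP.
    by move=> Px; apply: contraT => xU; case: nx; exists x.
  right; exists (U + <[x]>)%VS; split.
    move=> _ /memv_addP[u /UP Pu [_ /vlineP[a ->] ->]].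
    by rewrite addrC; apply: Plin.
  have xn0: x != 0 by apply: contraNneq xU => ->; rewrite mem0v.
  rewrite dimv_disjoint_sum ?dim_vline ?xn0 ?addn1 //.
  apply/eqP; rewrite -subv0; apply/subvP => y.
  case/memv_capP=> yU /vlineP[a y_ax]; rewrite memv0; move: yU; rewrite y_ax.
  have [->|an0 axU] := eqVneq a 0; first by rewrite scale0r.
  by rewrite -[x](scalerK an0) memvZ in xU.
case: (grow (\dim {: V}).+1) => // -[U [_ dU]].
by have := leq_trans dU (dimvS (subvf U)); rewrite ltnn.
Qed.

(** Minimality serves as an induction principle: to prove a property on the cyclic submodule, it
    suffices that the vectors with this property form a subspace that contains x and is stable under
    g. *)
Lemma smallest_stable (I : Type) (g : I -> 'End(V)) (x : V) :
  exists U : {vspace V}, [/\ x \in U, forall i y, y \in U -> g i y \in U &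
    forall Q : {vspace V}, x \in Q ->
      (forall i y, y \in Q -> g i y \in Q) -> (U <= Q)%VS].
Proof.
pose st (Q : {vspace V}) := x \in Q /\ forall i y, y \in Q -> g i y \in Q.
have [| |U UP] := @vspace_of_pred (fun y => forall Q, st Q -> y \in Q).
- by move=> Q _; apply: mem0v.
- by move=> a y z Py Pz Q sQ; rewrite memvD ?memvZ ?Py ?Pz.
exists U; split.
- by apply/UP => Q [].
- by move=> i y /UP Uy; apply/UP => Q sQ; apply: (proj2 sQ); apply: Uy.
- by move=> Q Qx Qg; apply/subvP=> y /UP; apply.
Qed.

End Subspaces.

Section JointEigenvector.
Context {F : closedFieldType} {V : vectType F}.

Lemma stable_eigenvector (h : 'End(V)) (U : {vspace V}) : U != 0%VS ->
  (forall x, x \in U -> h x \in U) ->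
  exists x, [/\ x \in U, x != 0 & exists c, h x = c *: x].
Proof.
move=> U0 hU; set b := vbasis U.
have d0 : (\dim U != 0)%N by rewrite dimv_eq0.
pose M := \matrix_(i < \dim U, j < \dim U) coord b j (h b`_i).
have [c /eigenvalueP[v vM v0]] : exists c, eigenvalue M c.
  have /closed_rootP[c rc] : size (char_poly M) != 1.
    by apply: contra_neq d0; rewrite size_char_poly => -[].
  by exists c; rewrite eigenvalue_root_char.
have fb : free b by exact: basis_free (vbasisP U).
have bU i : b`_i \in U.
  have [ib|ib] := ltnP i (size b); last by rewrite nth_default ?mem0v.
  by apply: vbasis_mem; apply: mem_nth.
exists (\sum_i v 0 i *: b`_i); split.
- by apply: memv_suml => i _; rewrite memvZ.
- apply: contra_neq v0 => s0; apply/rowP=> i; rewrite mxE.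
  by have := coord_sum_free (v 0) i fb; rewrite s0 linear0.
- exists c; rewrite linear_sum scaler_sumr /=.
  have hb (i : 'I_(\dim U)) : h b`_i = \sum_j M i j *: b`_j.
    rewrite (coord_vbasis (hU _ (bU i))); apply: eq_bigr => j _.
    by rewrite mxE.
  rewrite (eq_bigr (fun i => \sum_j (v 0 i * M i j) *: b`_j)); last first.
    move=> i _; rewrite linearZ /= hb scaler_sumr.
    by apply: eq_bigr => j _; rewrite scalerA.
  rewrite exchange_big; apply: eq_bigr => j _; rewrite scalerA -scaler_suml.
  by have /rowP/(_ j) := vM; rewrite !mxE => ->.
Qed.

Lemma stable_joint_eigenvector r (h : 'I_r -> 'End(V)) (U : {vspace V}) :
  U != 0%VS -> (forall i x, x \in U -> h i x \in U) ->
  (forall i j x, h i (h j x) = h j (h i x)) ->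
  exists x, [/\ x \in U, x != 0 & exists mu : 'I_r -> F,
    forall i, h i x = mu i *: x].
Proof.
move=> U0 hU hh.
suff /(_ (enum 'I_r)) : forall s : seq 'I_r, exists U' : {vspace V},
    [/\ U' != 0%VS, (U' <= U)%VS, forall i x, x \in U' -> h i x \in U' &
        exists mu : 'I_r -> F, forall i x, i \in s -> x \in U' ->
          h i x = mu i *: x].
  case=> U' [U'0 U'U _ [mu hmu]]; exists (vpick U'); split.
  - by apply: (subvP U'U); apply: memv_pick.
  - by rewrite vpick0.
  - by exists mu => i; apply: hmu; rewrite ?mem_enum ?memv_pick.
elim=> [|i s [U' [U'0 U'U hU' [mu hmu]]]].
  by exists U; split=> //; exists (fun=> 0).
have [x [xU' x0 [c hx]]] := stable_eigenvector U'0 (hU' i).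
have [| |W WP] := @vspace_of_pred _ V (fun y => y \in U' /\ h i y = c *: y).
- by rewrite mem0v linear0 scaler0.
- move=> a y z [yU hy] [zU hz]; rewrite memvD ?memvZ //; split=> //.
  by rewrite linearP /= hy hz scalerDr !scalerA mulrC.
exists W; split.
- by apply: contraNneq x0 => W0; rewrite -memv0 -W0; apply/WP.
- by apply/subvP=> y /WP[yU' _]; apply: (subvP U'U).
- by move=> j y /WP[yU hy]; apply/WP; split; rewrite ?hU' // hh hy linearZ.
- exists (fun j => if j == i then c else mu j) => j y.
  rewrite inE => /orP js /WP[yU hy]; case: eqVneq js => [->//|ji [//|js]].
  exact: hmu.
Qed.

End JointEigenvector.

Record chevalley_action (F : fieldType) (V : vectType F) r (A : 'M[int]_r)
    (e f h : 'I_r -> 'End(V)) : Prop := ChevalleyAction {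
  chev_ef : forall i j x, e i (f j x) = f j (e i x) + (if i == j then h i x else 0);
  chev_hh : forall i j x, h i (h j x) = h j (h i x);
  chev_he : forall i j x, h i (e j x) = e j (h i x) + (A i j)%:~R *: e j x;
  chev_hf : forall i j x, h i (f j x) = f j (h i x) - (A i j)%:~R *: f j x
}.

Section HighestWeight.
Context {F : numClosedFieldType} {V : vectType F}.
Context {r : nat} {A : 'M[int]_r} {e f h : 'I_r -> 'End(V)}.
Hypothesis rel : chevalley_action A e f h.

Lemma chev_h_stable (U : {vspace V}) :
  (forall i y, y \in U -> e i y \in U) -> (forall i y, y \in U -> f i y \in U) ->
  forall i y, y \in U -> h i y \in U.
Proof.
move=> eU fU i y yU; have -> : h i y = e i (f i y) - f i (e i y).
  by rewrite (chev_ef rel) eqxx addrC addKr.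
by rewrite memvB ?eU ?fU ?eU.
Qed.

(** Replaces the PBW argument that lowering operators alone generate a highest weight module: the
    vectors of U that all e_i and h_i keep in U include x, and the commutation relations make them
    stable under the f_j. *)
Lemma lowering_span_stable (x : V) (mu : 'I_r -> F) (U : {vspace V}) :
  (forall i, e i x = 0) -> (forall i, h i x = mu i *: x) ->
  x \in U -> (forall i y, y \in U -> f i y \in U) ->
  (forall Q : {vspace V}, x \in Q ->
      (forall i y, y \in Q -> f i y \in Q) -> (U <= Q)%VS) ->
  forall i y, y \in U -> e i y \in U.
Proof.
move=> ex hx xU fU minU.
have [| |Q QP] := @vspace_of_pred F V (fun y : V =>
    [/\ y \in U, forall i, e i y \in U & forall i, h i y \in U]).
- by split=> [|i|i]; rewrite ?linear0 mem0v.
- move=> a y z [yU ey hy] [zU ez hz].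
  by split=> [|i|i]; rewrite ?linearP /= memvD ?memvZ ?ey ?ez ?hy ?hz.
suff /subvP UQ : (U <= Q)%VS by move=> i y /UQ/QP[].
apply: minU; first by apply/QP; split=> // i; rewrite ?ex ?hx ?mem0v ?memvZ.
move=> j y /QP[yU ey hy]; apply/QP; split=> [|i|i].
- exact: fU.
- by rewrite (chev_ef rel) memvD ?fU //; case: eqP; rewrite ?hy ?mem0v.
- by rewrite (chev_hf rel) memvB ?memvZ ?fU.
Qed.

Section Grading.
(* The grading element sum_i c_i h_i, on which all simple roots take the
   value 1; e i raises its eigenvalues by 1 and f i lowers them by 1. *)
Context {c : 'I_r -> F}.
Hypothesis cA : forall j, \sum_i c i * (A i j)%:~R = 1.

Let D : 'End(V) := \sum_i c i *: h i.

Let De j x : D (e j x) = e j (D x) + e j x.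
Proof.
rewrite !sum_lfunE linear_sum -[X in _ + X]scale1r -(cA j) scaler_suml -big_split.
apply: eq_bigr => i _ /=; rewrite !scale_lfunE (chev_he rel) scalerDr scalerA.
by rewrite linearZ.
Qed.

(** If no joint eigenvector of the h_i in U were singular, raising could go on for ever and give
    eigenvectors of D for infinitely many eigenvalues. *)
Lemma singular_vector_exists (U : {vspace V}) : U != 0%VS ->
  (forall i y, y \in U -> e i y \in U) -> (forall i y, y \in U -> h i y \in U) ->
  exists x, [/\ x \in U, x != 0, forall i, e i x = 0 & exists mu : 'I_r -> F,
    forall i, h i x = mu i *: x].
Proof.
move=> U0 eU hU.
have [x0 [x0U x00 [mu0 hx0]]] := stable_joint_eigenvector U0 hU (chev_hh rel).
apply: NNPP => nsing.
have step m : exists x, [/\ x \in U, x != 0,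
    D x = (\sum_i c i * mu0 i + m%:R) *: x &
    exists mu : 'I_r -> F, forall i, h i x = mu i *: x].
  elim: m => [|m [x [xU xn0 Dx [mu hx]]]].
    exists x0; split=> //; last by exists mu0.
    rewrite addr0 sum_lfunE scaler_suml; apply: eq_bigr => i _.
    by rewrite scale_lfunE hx0 scalerA.
  have [j ejx] : exists j, e j x != 0.
    apply: NNPP => nj; apply: nsing; exists x; split=> //; last by exists mu.
    by move=> i; apply/eqP; apply: contraT => eix; case: nj; exists i.
  exists (e j x); split=> //.
  - exact: eU.
  - by rewrite De Dx linearZ /= -[X in _ + X]scale1r -scalerDl -addrA natr1.
  - exists (fun i => mu i + (A i j)%:~R) => i.
    by rewrite (chev_he rel) hx linearZ /= -scalerDl.
pose b := vbasis {: V}; pose M := passmx.mxof b b D.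
set s := [seq \sum_i c i * mu0 i + m%:R | m <- iota 0 (\dim {: V}).+1].
have cn0 : char_poly M != 0 by rewrite monic_neq0 ?char_poly_monic.
have := @max_poly_roots _ _ s cn0; rewrite size_char_poly /s size_map size_iota ltnn => mr.
suff: false by []; apply: mr.
  apply/allP => _ /mapP[m _ ->]; rewrite -eigenvalue_root_char.
  have [x [_ xn0 Dx _]] := step m.
  apply/eigenvalueP; exists (passmx.rVof b x).
    rewrite -passmx.rVof_app ?vbasisP // Dx.
    by apply/rowP=> j; rewrite !mxE linearZ.
  by rewrite passmx.rVof_eq0 // vbasisP.
rewrite map_inj_uniq ?iota_uniq // => m1 m2 /addrI /eqP.
by rewrite eqr_nat => /eqP.
Qed.

(** By generation V is spanned by eigenvectors of D with eigenvalues d - m, where m is natural and D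
    x = d x. Lowered vectors involve only m > 0 and lie in the image of D - d. If x were lowered,
    this image would be everything, although x is in the kernel. *)
Lemma highest_vector_not_lowered (x : V) (mu : 'I_r -> F) (y : 'I_r -> V) :
  x != 0 -> (forall i, h i x = mu i *: x) ->
  (forall U : {vspace V}, x \in U -> (forall i z, z \in U -> f i z \in U) ->
     forall z, z \in U) ->
  x <> \sum_i f i (y i).
Proof.
move=> x0 hx full xE; pose d := \sum_i c i * mu i.
have Df j z : D (f j z) = f j (D z) - f j z.
  rewrite !sum_lfunE linear_sum -[X in _ - X]scale1r -(cA j) scaler_suml -sumrB.
  apply: eq_bigr => i _ /=; rewrite !scale_lfunE (chev_hf rel) scalerBr scalerA.
  by rewrite [f j (_ *: _)]linearZ.
have Dx : D x = d *: x.
  rewrite sum_lfunE scaler_suml; apply: eq_bigr => i _.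
  by rewrite scale_lfunE hx scalerA.
(* A pair (m, y) of the list is an eigenvector y at depth m below x. *)
pose graded z := exists2 s : seq (nat * V),
  forall p, p \in s -> D p.2 = (d - p.1%:R) *: p.2 & z = \sum_(p <- s) p.2.
have gradedV z : graded z.
  have [| |U UP] := @vspace_of_pred _ V graded.
  - by exists [::]; rewrite ?big_nil.
  - move=> a _ _ [s sP ->] [t tP ->].
    exists ([seq (p.1, a *: p.2) | p <- s] ++ t).
      move=> p; rewrite mem_cat => /orP[/mapP[q /sP qs ->]|/tP//].
      by rewrite linearZ /= qs !scalerA mulrC.
    by rewrite big_cat big_map scaler_sumr.
  apply/UP; apply: full => [|i u /UP[s sP ->]]; apply/UP.
    exists [:: (0%N, x)]; rewrite ?big_seq1 //.
    by move=> p; rewrite inE => /eqP -> /=; rewrite subr0.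
  exists [seq (p.1.+1, f i p.2) | p <- s]; last by rewrite big_map linear_sum.
  move=> _ /mapP[p ps ->] /=; rewrite Df (sP _ ps) linearZ /=.
  by rewrite -[X in _ - X]scale1r -scalerBl -natr1 opprD addrA.
(* All lowered vectors lie in the image of D - d, which is not surjective. *)
pose T := D - d *: \1%VF.
have TE z : T z = D z - d *: z by rewrite add_lfunE opp_lfunE scale_lfunE id_lfunE.
have fT i z : f i z \in limg T.
  have [s sP ->] := gradedV z; rewrite linear_sum big_seq; apply: memv_suml => p ps /=.
  have -> : f i p.2 = T (- (p.1.+1%:R)^-1 *: f i p.2).
    have -> : T (- (p.1.+1%:R)^-1 *: f i p.2) = - (p.1.+1%:R)^-1 *: T (f i p.2).
      by rewrite linearZ.
    have -> : T (f i p.2) = - p.1.+1%:R *: f i p.2.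
      rewrite TE Df (sP _ ps) [f i (_ *: _)]linearZ /= -addrA -opprD.
      rewrite -[X in _ - (X + _)]scale1r -scalerDl -scalerBl -natr1.
      by congr (_ *: _); ring.
    by rewrite scalerA mulrNN mulVf ?scale1r // pnatr_eq0.
  by apply: memv_img; apply: memvf.
have imT z : z \in limg T.
  apply: full => [|i u _]; last exact: fT.
  by rewrite xE; apply: memv_suml => i _; apply: fT.
have : (\dim (lker T) + \dim (limg T))%N = \dim {: V} by rewrite -(limg_ker_dim T fullv) capfv.
have -> : limg T = fullv by apply/eqP; rewrite eqEsubv subvf; apply/subvP => z _.
move/eqP; rewrite -{2}[\dim {: V}]add0n eqn_add2r dimv_eq0 => /eqP kT.
have : x \in lker T by rewrite memv_ker TE Dx subrr.
by rewrite kT memv0 (negPf x0).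
Qed.
End Grading.
End HighestWeight.

(** * Unitary representations *)

(** Conjugate linear in the first argument. Positivity is recorded as anisotropy: [b x x] is used as
    a divisor in the Gram-Schmidt process and as a test for zero. *)
Record inner_product (F : numClosedFieldType) (V : vectType F)
    (b : V -> V -> F) : Prop := InnerProduct {
  ip_linear : forall x a y z, b x (a *: y + z) = a * b x y + b x z;
  ip_conj : forall x y, b y x = (b x y)^*;
  ip_definite : forall x, b x x = 0 -> x = 0
}.

Section InnerProduct.
Context {F : numClosedFieldType} {V : vectType F} {b : V -> V -> F}.
Hypothesis ipb : inner_product b.

Lemma ip0r x : b x 0 = 0.
Proof. by have := ip_linear ipb x (-1) 0 0; rewrite scaler0 addr0 mulN1r addNr. Qed.

Lemma ipDr x y z : b x (y + z) = b x y + b x z.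
Proof. by have := ip_linear ipb x 1 y z; rewrite scale1r mul1r. Qed.

Lemma ipZr x a y : b x (a *: y) = a * b x y.
Proof. by have := ip_linear ipb x a y 0; rewrite ip0r !addr0. Qed.

Lemma ipBr x y z : b x (y - z) = b x y - b x z.
Proof. by rewrite ipDr -scaleN1r ipZr mulN1r. Qed.

Lemma ip0l x : b 0 x = 0.
Proof. by rewrite (ip_conj ipb) ip0r conjC0. Qed.

Lemma ipDl x y z : b (y + z) x = b y x + b z x.
Proof. by rewrite !(ip_conj ipb x) ipDr rmorphD. Qed.

Lemma ipZl x a y : b (a *: y) x = a^* * b y x.
Proof. by rewrite !(ip_conj ipb x) ipZr rmorphM. Qed.

Lemma ipBl x y z : b (y - z) x = b y x - b z x.
Proof. by rewrite !(ip_conj ipb x) ipBr rmorphB. Qed.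

Lemma ip_sumr I (s : seq I) P (y : I -> V) x :
  b x (\sum_(i <- s | P i) y i) = \sum_(i <- s | P i) b x (y i).
Proof. exact: (big_morph (b x) (ipDr x) (ip0r x)). Qed.

Lemma ip_suml I (s : seq I) P (y : I -> V) x :
  b (\sum_(i <- s | P i) y i) x = \sum_(i <- s | P i) b (y i) x.
Proof. by apply: (big_morph (b^~ x)) => [y1 y2|]; rewrite ?ipDl ?ip0l. Qed.

Lemma ip_eq0C x y : b x y = 0 -> b y x = 0.
Proof. by rewrite (ip_conj ipb x y) => ->; rewrite conjC0. Qed.

(** Gram-Schmidt along a spanning list: q is the projection of the new vector u, and u - q either
    vanishes or contributes the component of x along it. *)
Lemma orthogonal_projection (U : {vspace V}) x :
  exists2 m, m \in U & forall y, y \in U -> b y (x - m) = 0.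
Proof.
rewrite -(span_basis (vbasisP U)).
move: x; elim: (val (vbasis U)) => {U} [|u s IH] x.
  by exists 0; rewrite ?mem0v // => y; rewrite span_nil memv0 => /eqP ->; apply: ip0l.
have [p ps xp] := IH x; have [q qs uq] := IH u.
have ort y z c : y \in <<u :: s>>%VS -> (forall w, w \in <<s>>%VS -> b w z = 0) ->
    b (u - q) z = 0 -> b y (c *: z) = 0.
  rewrite span_cons => /memv_addP[_ /vlineP[a ->] [w ws ->]] sz uz.
  by rewrite ipZr ipDl ipZl (sz w) // -(subrK q u) ipDl uz sz // !addr0 !mulr0.
have sub w : w \in <<s>>%VS -> w \in <<u :: s>>%VS.
  by move=> ws; rewrite span_cons -[w]add0r memv_add ?mem0v.
have uin : u - q \in <<u :: s>>%VS.
  by apply: memvB; [apply: memv_span; apply: mem_head | apply: sub].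
have [u0|un0] := eqVneq (b (u - q) (u - q)) 0.
  exists p; first exact: sub.
  move=> y ys; rewrite -[x - p]scale1r; apply: ort => //.
  by rewrite (ip_definite ipb u0) ip0l.
pose c := b (u - q) (x - p) / b (u - q) (u - q).
exists (p + c *: (u - q)); first by apply: memvD; [apply: sub | apply: memvZ].
move=> y ys; rewrite -[x - _]scale1r opprD addrA; apply: ort => //.
  by move=> w ws; rewrite ipBr ipZr xp // uq // mulr0 subr0.
by rewrite ipBr ipZr /c divfK // subrr.
Qed.

Section Orthogonal.
Context {r : nat} {A : 'M[int]_r} {e f h : 'I_r -> 'End(V)}.
Hypothesis rel : chevalley_action A e f h.
Hypothesis adj : forall i x y, b (e i x) y = b x (f i y).
Context {c : 'I_r -> F}.
Hypothesis cA : forall j, \sum_i c i * (A i j)%:~R = 1.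

Lemma adjC i x y : b (f i x) y = b x (e i y).
Proof. by rewrite (ip_conj ipb y) -adj -(ip_conj ipb). Qed.

Lemma adj_h i x y : b (h i x) y = b x (h i y).
Proof.
have hE z : h i z = e i (f i z) - f i (e i z).
  by rewrite (chev_ef rel) eqxx addrC addKr.
by rewrite !hE ipBl ipBr (adj i (f i x)) (adjC i x) (adjC i (e i x)) (adj i x).
Qed.

(** The coroots are self-adjoint, so their eigenvalues are real and eigenvectors for different
    eigenvalues are orthogonal. *)
Lemma weight_eq i x y mu nu : h i x = mu *: x -> h i y = nu *: y ->
  b x y != 0 -> mu = nu.
Proof.
move=> hx hy xy.
have real z t : h i z = t *: z -> b z z != 0 -> t^* = t.
  move=> hz z0; apply: (mulIf z0).
  by rewrite -[LHS]ipZl -[RHS]ipZr -hz adj_h.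
have x0 : b x x != 0.
  by apply: contra_neq xy => /(ip_definite ipb) ->; rewrite ip0l.
rewrite -(real _ _ hx x0); apply: (mulIf xy).
by rewrite -[LHS]ipZl -[RHS]ipZr -hx -hy adj_h.
Qed.

Context {I : finType} {x : I -> V} {nu : I -> 'I_r -> F} {M : {vspace V}}.
Hypothesis eM : forall i y, y \in M -> e i y \in M.
Hypothesis fM : forall i y, y \in M -> f i y \in M.
Hypothesis xM : forall a, x a \in M.
Hypothesis x0 : forall a, x a != 0.
Hypothesis ex : forall a i, e i (x a) = 0.
Hypothesis hx : forall a i, h i (x a) = nu a i *: x a.
Hypothesis nu_inj : forall a a', nu a =1 nu a' -> a = a'.
Hypothesis singular_x : forall y mu, y \in M -> y != 0 ->
  (forall i, e i y = 0) -> (forall i, h i y = mu i *: y) ->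
  exists a t, y = t *: x a.

Let singular_in (U : {vspace V}) : (U <= M)%VS -> U != 0%VS ->
  (forall i y, y \in U -> e i y \in U) -> (forall i y, y \in U -> f i y \in U) ->
  exists a, x a \in U.
Proof.
move=> UM U0 eU fU.
have [y [yU y0 ey [mu hy]]] :=
  singular_vector_exists rel cA U0 eU (chev_h_stable rel eU fU).
have [a [t yE]] := singular_x (subvP UM _ yU) y0 ey hy.
exists a; have t0 : t != 0 by apply: contra_neq y0 => t0; rewrite yE t0 scale0r.
by rewrite -[x a](scalerK t0) -yE memvZ.
Qed.

Let orth_x a a' : b (x a) (x a') != 0 -> a = a'.
Proof. by move=> bx; apply: nu_inj => i; apply: weight_eq (hx a i) (hx a' i) bx. Qed.

(** W a is generated from x_a by lowering operators. As the weights differ, the x_a and then the W a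
    are pairwise orthogonal. Every nonzero submodule of M contains some x_a: inside W a' this can
    only be x_a', whence irreducibility, and in the orthogonal complement of the sum of the W a it
    is impossible. *)
Lemma unitary_decomposition : exists W : I -> {vspace V},
  [/\ forall a, [/\ x a \in W a, forall i y, y \in W a -> e i y \in W a
                  & forall i y, y \in W a -> f i y \in W a],
      forall a (U : {vspace V}), (U <= W a)%VS ->
        (forall i y, y \in U -> e i y \in U) -> (forall i y, y \in U -> f i y \in U) ->
        U = 0%VS \/ U = W a,
      (\sum_a W a)%VS = M &
      forall w : I -> V, (forall a, w a \in W a) -> \sum_a w a = 0 ->
        forall a, w a = 0].
Proof.
have [W WP] : exists W : I -> {vspace V}, forall a, [/\ x a \in W a,
    forall i y, y \in W a -> f i y \in W a &
    forall Q : {vspace V}, x a \in Q -> (forall i y, y \in Q -> f i y \in Q) ->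
      (W a <= Q)%VS].
  suff /(_ (enum I)) [W WP] : forall s : seq I, exists W : I -> {vspace V},
    forall a, a \in s -> [/\ x a \in W a,
    forall i y, y \in W a -> f i y \in W a &
    forall Q : {vspace V}, x a \in Q -> (forall i y, y \in Q -> f i y \in Q) ->
      (W a <= Q)%VS].
    by exists W => a; apply: WP; rewrite mem_enum.
  elim=> [|a s [W WP]]; first by exists (fun=> 0%VS).
  have [U UP] := smallest_stable f (x a).
  exists (fun a' => if a' == a then U else W a') => a'; rewrite inE.
  by case: eqVneq => [-> _|_ /= /WP].
have xW a : x a \in W a by case: (WP a).
have fW a : forall i y, y \in W a -> f i y \in W a by case: (WP a).
have minW a := let: And3 _ _ m := WP a in m.
have eW a : forall i y, y \in W a -> e i y \in W a.
  exact (lowering_span_stable rel (ex a) (hx a) (xW a) (fW a) (minW a)).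
have WM a : (W a <= M)%VS by apply: minW.
have perp (U : {vspace V}) : exists U' : {vspace V},
    forall y, (y \in U') <-> (forall u, u \in U -> b u y = 0).
  apply: vspace_of_pred => [u _|t y z Py Pz u uU]; first exact: ip0r.
  by rewrite ipDr ipZr Py // Pz // mulr0 addr0.
(* x_a is orthogonal to x_a' and, as e_i x_a = 0, to all lowered vectors, hence to W a'. The
   orthogonal complement of W a' is stable under the f_i, so with x_a it contains W a. *)
have ort a a' y z : a != a' -> y \in W a -> z \in W a' -> b y z = 0.
  move=> aa' yW zW.
  have [| |Q QP] := @vspace_of_pred _ V (fun z => b (x a) z = 0).
  - exact: ip0r.
  - by move=> t u v u0 v0; rewrite ipDr ipZr u0 v0 mulr0 addr0.
  have xaz w : w \in W a' -> b (x a) w = 0.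
    have /subvP s : (W a' <= Q)%VS; last by move=> ?; apply/QP/s.
    apply: minW => [|i u _]; apply/QP.
      by apply: contra_neq_eq aa' => /orth_x ->.
    by rewrite -adj ex ip0l.
  have [U' U'P] := perp (W a').
  have /subvP s : (W a <= U')%VS.
    apply: minW => [|i u /U'P u0]; apply/U'P=> w wW.
      by apply/ip_eq0C/xaz.
    by rewrite -adj; apply/u0/eW.
  by apply: ip_eq0C; apply: (iffLR (U'P y)) => //; apply: s.
have irr a (U : {vspace V}) : (U <= W a)%VS ->
    (forall i y, y \in U -> e i y \in U) -> (forall i y, y \in U -> f i y \in U) ->
    U = 0%VS \/ U = W a.
  move=> UW eU fU; case: (eqVneq U 0%VS) => [->|U0]; [by left|right].
  have [a' xa'U] := singular_in (subv_trans UW (WM a)) U0 eU fU.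
  have aa' : a = a'.
    apply/eqP; apply: contraT => aa'; have := x0 a'.
    by rewrite (ip_definite ipb (ort _ _ _ _ aa' (subvP UW _ xa'U) (xW a'))) eqxx.
  by apply/eqP; rewrite eqEsubv UW minW // aa'.
exists W; split; [by move=> a; split; [|exact: eW|exact: fW] | exact: irr | | ].
- apply/eqP; rewrite eqEsubv; apply/andP; split.
    by apply/subv_sumP => a _.
  apply/subvP => y yM; have [p pS yp] := orthogonal_projection (\sum_a W a) y.
  have [N NP] := perp (\sum_a W a)%VS.
  have st (g : 'End(V)) : (forall a z, z \in W a -> g z \in W a) ->
      forall z, z \in (\sum_a W a)%VS -> g z \in (\sum_a W a)%VS.
    move=> gW z /memv_sumP[v vW ->]; rewrite linear_sum memv_suml // => a _.
    by apply: (subvP (sumv_sup a _ (subvv _))) => //; apply: gW; apply: vW.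
  have pM : p \in M by apply: subvP pS; apply/subv_sumP => a _.
  suff N0 : (M :&: N)%VS = 0%VS.
    have : y - p \in (M :&: N)%VS by rewrite memv_cap memvB //=; apply/NP.
    by rewrite N0 memv0 subr_eq0 => /eqP ->.
  apply/eqP; apply: contraT => N0.
  have [i z|i z|a] := singular_in (capvSl _ _) N0.
  - rewrite !memv_cap => /andP[zM /NP zN]; rewrite eM //=; apply/NP => u uS.
    by rewrite -adjC zN // st // => a; apply: fW.
  - rewrite !memv_cap => /andP[zM /NP zN]; rewrite fM //=; apply/NP => u uS.
    by rewrite -adj zN // st // => a; apply: eW.
  rewrite memv_cap => /andP[_ /NP/(_ (x a)) xx].
  have := x0 a; rewrite (ip_definite ipb (xx _)) ?eqxx //.
  exact: (subvP (sumv_sup a _ (subvv _))).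
- move=> w wW s0 a; apply: (ip_definite ipb).
  have := ip0r (w a); rewrite -s0 ip_sumr (bigD1 a) //= big1 ?addr0 // => a' a'a.
  by apply: ort (wW _) (wW _); rewrite eq_sym.
Qed.

End Orthogonal.
End InnerProduct.

Lemma lfun_of_linear (F : fieldType) (V W : vectType F) (g : V -> W) :
  linear g -> exists phi : 'Hom(V, W), phi =1 g.
Proof.
move=> gP; pose gL := GRing.isLinear.Build F V W _ g gP.
pose gl : {linear V -> W} := HB.pack g gL.
by exists (linfun gl) => x; rewrite lfunE.
Qed.

Section Embedding.
Context {F : numClosedFieldType} {V T : vectType F} {r : nat} {A : 'M[int]_r}.
Context {e f h : 'I_r -> 'End(V)} {e' f' h' : 'I_r -> 'End(T)}.
Hypothesis rel : chevalley_action A e f h.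
Hypothesis rel' : chevalley_action A e' f' h'.
Context {b : T -> T -> F}.
Hypothesis ipb : inner_product b.
Hypothesis adj : forall i x y, b (e' i x) y = b x (f' i y).
Context {c : 'I_r -> F}.
Hypothesis cA : forall j, \sum_i c i * (A i j)%:~R = 1.
Hypothesis irrV : forall U : {vspace V}, (forall i y, y \in U -> e i y \in U) ->
  (forall i y, y \in U -> f i y \in U) -> U = 0%VS \/ U = fullv.
Context {v : V} {t0 : T} {mu : 'I_r -> F}.
Hypothesis v0 : v != 0.
Hypothesis ev : forall i, e i v = 0.
Hypothesis hv : forall i, h i v = mu i *: v.
Hypothesis t00 : t0 != 0.
Hypothesis et : forall i, e' i t0 = 0.
Hypothesis ht : forall i, h' i t0 = mu i *: t0.

Let full_of_e (U : {vspace V}) : v \in U -> (forall i y, y \in U -> e i y \in U) ->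
  (forall i y, y \in U -> f i y \in U) -> forall z, z \in U.
Proof.
move=> vU eU fU z; case: (irrV eU fU) => UE; last by rewrite UE memvf.
by move: vU; rewrite UE [v \in _]memv0 (negPf v0).
Qed.

Lemma highest_vector_generates (U : {vspace V}) :
  v \in U -> (forall i y, y \in U -> f i y \in U) -> forall z, z \in U.
Proof.
move=> vU fU z; have [W [vW fW minW]] := smallest_stable f v.
have eW := lowering_span_stable rel ev hv vW fW minW.
exact: (subvP (minW _ vU fU)) (full_of_e vW eW fW z).
Qed.

Let pair_lfun (g : 'I_r -> 'End(V)) (g' : 'I_r -> 'End(T)) :
  exists G : 'I_r -> 'End((V * T)%type), forall i p, G i p = (g i p.1, g' i p.2).
Proof.
suff /fin_all_exists [G GP] : forall i, exists Gi : 'End((V * T)%type),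
  forall p, Gi p = (g i p.1, g' i p.2) by exists G.
by move=> i; apply: lfun_of_linear => a x y /=; rewrite !linearP.
Qed.

(* The cyclic submodule of V * T generated by (v, t0) is the graph of the
   embedding: it meets 0 * T trivially because, by unitarity, the complement of
   this intersection contains t0. *)
Lemma unitary_embedding : exists Phi : 'Hom(V, T),
  [/\ injective Phi, Phi v = t0, forall i x, Phi (e i x) = e' i (Phi x) &
      forall i x, Phi (f i x) = f' i (Phi x)].
Proof.
have [E EP] := pair_lfun e e'; have [G GP] := pair_lfun f f'.
have [H HP] := pair_lfun h h'.
have relD : chevalley_action A E G H.
  split=> i j [x y]; rewrite !(EP, GP, HP) /=.
  - by rewrite (chev_ef rel) (chev_ef rel'); case: eqP.
  - by rewrite (chev_hh rel) (chev_hh rel').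
  - by rewrite (chev_he rel) (chev_he rel').
  - by rewrite (chev_hf rel) (chev_hf rel').
have [D [vD GD minD]] := smallest_stable G (v, t0).
have ED : forall i y, y \in D -> E i y \in D.
  apply: (lowering_span_stable relD (mu := mu) _ _ vD GD minD) => i.
    by rewrite EP /= ev et.
  by rewrite HP /= hv ht.
(* Up to the line of its generator, D consists of lowered vectors. *)
have split_D p : p \in D -> exists a (q : 'I_r -> V * T),
    (forall i, q i \in D) /\ p = a *: (v, t0) + \sum_i G i (q i).
  have [| |U UP] := @vspace_of_pred _ _ (fun p : V * T =>
     exists a (q : 'I_r -> V * T),
       (forall i, q i \in D) /\ p = a *: (v, t0) + \sum_i G i (q i)).
  - exists 0, (fun=> 0); split; first by move=> i; apply: mem0v.
    by rewrite scale0r add0r big1 // => i _; rewrite linear0.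
  - move=> t _ _ [a [q [qD ->]]] [a' [q' [qD' ->]]].
    exists (t * a + a'), (fun i => t *: q i + q' i); split.
      by move=> i; apply: memvD => //; apply: memvZ.
    rewrite scalerDr scalerA addrACA -scalerDl; congr (_ + _).
    rewrite scaler_sumr -big_split; apply: eq_bigr => i _.
    by rewrite linearP.
  suff /subvP s : (D <= U)%VS by move/s/UP.
  apply: minD => [|i y /UP[a [q [qD yE]]]]; apply/UP.
    exists 1, (fun=> 0); split; first by move=> i; apply: mem0v.
    by rewrite scale1r big1 ?addr0 // => i _; rewrite linear0.
  exists 0, (fun j => if j == i then y else 0); split.
    move=> j; case: eqP => _; last exact: mem0v.
    by rewrite yE; apply: memvD; [apply: memvZ | apply: memv_suml => k _; apply: GD].
  rewrite scale0r add0r (bigD1 i) //= eqxx big1 ?addr0 // => j /negPf ->.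
  by rewrite linear0.
have fst_sum (q : 'I_r -> V * T) : (\sum_i q i).1 = \sum_i (q i).1.
  by apply: (big_morph (fun p : V * T => p.1)).
have snd_sum (q : 'I_r -> V * T) : (\sum_i q i).2 = \sum_i (q i).2.
  by apply: (big_morph (fun p : V * T => p.2)).
(* The coefficient a is 0, since otherwise v would be a sum of lowered vectors; then t is lowered,
   and it is orthogonal to t0 because the e'_i kill t0. *)
have t0K t : (0, t) \in D -> b t0 t = 0.
  move=> /split_D[a [q [qD pE]]].
  have a0 : a = 0.
    apply/eqP; apply: contraT => a0.
    have := highest_vector_not_lowered rel cA (y := fun i => - a^-1 *: (q i).1) v0 hv
      highest_vector_generates; case.
    have := congr1 fst pE; rewrite /= fst_sum => /eqP.
    rewrite eq_sym addr_eq0 => /eqP/(canRL (scalerK a0)) ->.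
    rewrite scalerN -scaleNr scaler_sumr; apply: eq_bigr => i _.
    by rewrite GP linearZ.
  have /= -> := congr1 snd pE; rewrite a0 scale0r add0r snd_sum (ip_sumr ipb).
  by rewrite big1 // => i _; rewrite GP /= -adj et (ip0l ipb).
(* The t with (0, t) in D form a space K stable under the e'_i, so the vectors orthogonal to K are
   stable under the f'_i. They include t0, hence all second components of D, and so K itself. *)
have K0 t : (0, t) \in D -> t = 0.
  have [| |K KP] := @vspace_of_pred _ T (fun t => (0, t) \in D).
  - exact: mem0v.
  - move=> a x y xD yD.
    have -> : (0, a *: x + y) = a *: (0, x) + (0, y) :> V * T.
      by rewrite -[RHS]/(a *: 0 + 0, a *: x + y) scaler0 addr0.
    by rewrite memvD ?memvZ.
  have [| |N NP] := @vspace_of_pred _ _ (fun p : V * T => forall t, t \in K -> b t p.2 = 0).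
  - by move=> u _; rewrite (ip0r ipb).
  - by move=> a x y Px Py u uK; rewrite /= (ip_linear ipb) Px // Py // mulr0 addr0.
  have /subvP s : (D <= N)%VS.
    apply: minD => [|i [x y] /NP Ny]; apply/NP => u /KP uD.
      by apply: (ip_eq0C ipb); apply: t0K.
    rewrite GP /= -adj Ny //; apply/KP.
    by have := ED i _ uD; rewrite EP linear0.
  move=> tD; apply: (ip_definite ipb); have /NP := s _ tD; apply.
  exact/KP.
have surj x : exists t, (x, t) \in D.
  have [| |U UP] := @vspace_of_pred _ V (fun x => exists t, (x, t) \in D).
  - by exists 0; apply: mem0v.
  - move=> a x1 x2 [t1 D1] [t2 D2]; exists (a *: t1 + t2).
    exact: (memvD (memvZ a D1) D2).
  apply/UP; apply: highest_vector_generates => [|i y /UP[t tD]]; apply/UP.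
    by exists t0.
  by exists (f' i t); have := GD i _ tD; rewrite GP.
pose phi x := xchoose (surj x).
have phiE x t : (x, t) \in D -> phi x = t.
  move=> xtD; apply/eqP; rewrite -subr_eq0; apply/eqP/K0.
  have := memvB (xchooseP (surj x)) xtD.
  by rewrite -[_ - _]/(x - x, phi x - t) subrr.
have phiD x : (x, phi x) \in D by exact (xchooseP (surj x)).
have [Phi PhiE] : exists Phi : 'Hom(V, T), Phi =1 phi.
  apply: lfun_of_linear => a x y; apply: phiE.
  exact: (memvD (memvZ a (phiD x)) (phiD y)).
exists Phi; split.
- move=> x y; rewrite !PhiE => pxy; apply/eqP; rewrite -subr_eq0.
  have [| |U UP] := @vspace_of_pred _ V (fun x => (x, 0) \in D).
  + exact: mem0v.
  + move=> a x1 x2 D1 D2; have := memvD (memvZ a D1) D2.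
    by rewrite -[X in X \in D]/(a *: x1 + x2, a *: 0 + 0) scaler0 addr0.
  have eU i z : z \in U -> e i z \in U.
    by move/UP => zU; apply/UP; have := ED i _ zU; rewrite EP linear0.
  have fU i z : z \in U -> f i z \in U.
    by move/UP => zU; apply/UP; have := GD i _ zU; rewrite GP linear0.
  case: (irrV eU fU) => [U0|Uf].
  + rewrite -memv0 -U0; apply/UP.
    have := memvB (phiD x) (phiD y).
    by rewrite -[_ - _]/(x - y, phi x - phi y) pxy subrr.
  + have /UP vU : v \in U by rewrite Uf memvf.
    have := memvB vD vU; rewrite -[_ - _]/(v - v, t0 - 0) subrr subr0.
    by move/K0/eqP; rewrite (negPf t00).
- by rewrite PhiE; apply: phiE.
- by move=> i x; rewrite !PhiE; apply: phiE; have := ED i _ (phiD x); rewrite EP.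
- by move=> i x; rewrite !PhiE; apply: phiE; have := GD i _ (phiD x); rewrite GP.
Qed.
End Embedding.

(** * Tensor powers *)

Section TensorPower.
Context {F : numClosedFieldType} {N : nat} (s : 'M[F]_N -> 'M[F]_N).

(* The tensor powers of 'M_N, on which a matrix A acts as a derivation extending
   X |-> A X + X s(A). *)
Fixpoint tpower (k : nat) : vectType F :=
  if k is k'.+1 then {ffun 'I_N * 'I_N -> tpower k'} else F^o.

Definition lract (A X : 'M[F]_N) : 'M[F]_N := A *m X + X *m s A.

Fixpoint tact k (A : 'M[F]_N) : tpower k -> tpower k :=
  match k return tpower k -> tpower k with
  | 0 => fun _ => 0
  | k'.+1 => fun t => [ffun p => \sum_i A p.1 i *: t (i, p.2) +
                                 \sum_j s A j p.2 *: t (p.1, j) + tact A (t p)]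
  end.

Definition tcons k (u : 'M[F]_N) (t : tpower k) : tpower k.+1 :=
  [ffun p => u p.1 p.2 *: t].

Fixpoint tprod (u : nat -> 'M[F]_N) k : tpower k :=
  if k is k'.+1 then tcons (u k') (tprod u k') else (1 : F^o).

Fixpoint tip k : tpower k -> tpower k -> F :=
  match k return tpower k -> tpower k -> F with
  | 0 => fun x y => x^* * y
  | k'.+1 => fun x y => \sum_p tip (x p) (y p)
  end.

Definition mxip (u v : 'M[F]_N) : F := \sum_p (u p.1 p.2)^* * v p.1 p.2.

Lemma tact_linear k A : linear (@tact k A).
Proof.
elim: k => [|k IH] a x y /=; first by rewrite scaler0 addr0.
apply/ffunP => p; rewrite !ffunE IH !scalerDr !scaler_sumr.
rewrite [in RHS]addrACA; congr (_ + _); rewrite [in RHS]addrACA; congr (_ + _).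
  rewrite -big_split; apply: eq_bigr => i _.
  by rewrite !ffunE scalerDr !scalerA mulrC.
rewrite -big_split; apply: eq_bigr => i _.
by rewrite !ffunE scalerDr !scalerA mulrC.
Qed.

HB.instance Definition _ k A := GRing.isLinear.Build F (tpower k) (tpower k) _
  (@tact k A) (@tact_linear k A).

Definition tend k A : 'End(tpower k) := linfun (@tact k A).

Lemma tendE k A t : @tend k A t = tact A t.
Proof. by rewrite lfunE. Qed.

Lemma tactZ k A a (t : tpower k) : tact A (a *: t) = a *: tact A t.
Proof. by rewrite -!tendE linearZ. Qed.

Lemma tactD k A (t t' : tpower k) : tact A (t + t') = tact A t + tact A t'.
Proof. by rewrite -!tendE linearD. Qed.

Lemma tact_sum k A I (r : seq I) P (t : I -> tpower k) :
  tact A (\sum_(i <- r | P i) t i) = \sum_(i <- r | P i) tact A (t i).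
Proof. by rewrite -tendE linear_sum; apply: eq_bigr => i _ /=; rewrite tendE. Qed.

Lemma tactE k A (t : tpower k.+1) p : tact A t p =
  \sum_i A p.1 i *: t (i, p.2) + \sum_j s A j p.2 *: t (p.1, j) + tact A (t p).
Proof. by rewrite ffunE. Qed.

Lemma tconsE k u (t : tpower k) p : tcons u t p = u p.1 p.2 *: t.
Proof. by rewrite ffunE. Qed.

Lemma tact_tcons k A u (t : tpower k) :
  tact A (tcons u t) = tcons (lract A u) t + tcons u (tact A t).
Proof.
apply/ffunP => p; rewrite tactE [RHS]ffunE !tconsE tactZ !mxE scalerDl !scaler_suml.
congr (_ + _ + _); apply: eq_bigr => i _; rewrite tconsE scalerA //.
by rewrite mulrC.
Qed.

Lemma tconsZr k u a (t : tpower k) : tcons u (a *: t) = a *: tcons u t.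
Proof. by apply/ffunP => p; rewrite !(tconsE, ffunE) !scalerA mulrC. Qed.

Lemma tconsZl k a u (t : tpower k) : tcons (a *: u) t = a *: tcons u t.
Proof. by apply/ffunP => p; rewrite !(tconsE, ffunE) !mxE scalerA. Qed.

Lemma tcons0l k (t : tpower k) : tcons 0 t = 0.
Proof. by apply/ffunP => p; rewrite !(tconsE, ffunE) !mxE scale0r. Qed.

Lemma tcons0r k u : tcons u (0 : tpower k) = 0.
Proof. by apply/ffunP => p; rewrite !(tconsE, ffunE) scaler0. Qed.

Lemma tconsDl k u v (t : tpower k) : tcons (u + v) t = tcons u t + tcons v t.
Proof. by apply/ffunP => p; rewrite !(tconsE, ffunE) !mxE scalerDl. Qed.

Lemma tconsDr k u (t t' : tpower k) : tcons u (t + t') = tcons u t + tcons u t'.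
Proof. by apply/ffunP => p; rewrite !(tconsE, ffunE) scalerDr. Qed.

Lemma eq_tprod k (u v : nat -> 'M[F]_N) :
  (forall m, (m < k)%N -> u m = v m) -> tprod u k = tprod v k.
Proof.
elim: k => [//|k IH] uv /=; rewrite uv // IH // => m mk.
by apply: uv; apply: ltnW.
Qed.

Lemma tact_eigen k A (u : nat -> 'M[F]_N) (c : nat -> F) :
  (forall i, lract A (u i) = c i *: u i) ->
  tact A (tprod u k) = (\sum_(i < k) c i) *: tprod u k.
Proof.
move=> uA; elim: k => [|k IH]; first by rewrite big_ord0 scale0r.
rewrite [tprod _ _]/= tact_tcons uA IH tconsZl tconsZr -scalerDl.
by rewrite big_ord_recr addrC.
Qed.

Lemma tipE k (x y : tpower k.+1) : tip x y = \sum_p tip (x p) (y p).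
Proof. by []. Qed.

Lemma tip_inner_product k : inner_product (@tip k).
Proof.
elim: k => [|k [lin cnj def]]; split=> /=.
- by move=> x a y z; rewrite mulrDr mulrCA.
- by move=> x y; rewrite [RHS]rmorphM /= conjCK mulrC.
- move=> x /eqP; rewrite mulf_eq0 conjC_eq0 orbb; exact/eqP.
- move=> x a y z; rewrite mulr_sumr -big_split; apply: eq_bigr => p _.
  by rewrite !ffunE lin.
- by move=> x y; rewrite rmorph_sum; apply: eq_bigr => p _; apply: cnj.
- have pos j (x : tpower j) : 0 <= tip x x.
    elim: j x => [|j IH] x /=; first by rewrite mulrC mul_conjC_ge0.
    by apply: sumr_ge0 => p _.
  move=> x /eqP; rewrite psumr_eq0 // => /allP x0; apply/ffunP=> p.
  by rewrite ffunE; apply: def; apply/eqP; apply: (x0 p); rewrite mem_index_enum.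
Qed.

Lemma tip_tcons k u v (x y : tpower k) :
  tip (tcons u x) (tcons v y) = mxip u v * tip x y.
Proof.
rewrite tipE mulr_suml; apply: eq_bigr => p _; rewrite !tconsE.
by rewrite (ipZl (tip_inner_product k)) (ipZr (tip_inner_product k)) mulrA.
Qed.

Lemma tip_tprod u v k :
  tip (tprod u k) (tprod v k) = \prod_(i < k) mxip (u i) (v i).
Proof.
elim: k => [|k IH]; first by rewrite big_ord0 /= conjC1 mulr1.
by rewrite big_ord_recr [tprod u _]/= [tprod v _]/= tip_tcons IH mulrC.
Qed.

Let sum_pair (g : 'I_N * 'I_N -> F) : \sum_p g p = \sum_i \sum_j g (i, j).
Proof. by rewrite pair_bigA; apply: eq_bigr => -[]. Qed.

Lemma tip_adjoint k (A B : 'M[F]_N) : (forall i j, B i j = (A j i)^*) ->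
  (forall i j, s B i j = (s A j i)^*) ->
  forall x y : tpower k, tip (tact A x) y = tip x (tact B y).
Proof.
move=> AB sAB; elim: k => [|k IH] x y; first by rewrite /= conjC0 mul0r mulr0.
have ip := tip_inner_product k; rewrite !tipE.
under eq_bigr do rewrite tactE !(ipDl ip) IH.
under [in RHS]eq_bigr do rewrite tactE !(ipDr ip).
rewrite !big_split /=; congr (_ + _ + _).
  under eq_bigr do rewrite (ip_suml ip).
  under [in RHS]eq_bigr do rewrite (ip_sumr ip).
  rewrite !sum_pair exchange_big [in RHS]exchange_big; apply: eq_bigr => j _ /=.
  rewrite exchange_big; apply: eq_bigr => i _; apply: eq_bigr => i' _.
  by rewrite (ipZl ip) (ipZr ip) AB.
under eq_bigr do rewrite (ip_suml ip).
under [in RHS]eq_bigr do rewrite (ip_sumr ip).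
rewrite !sum_pair; apply: eq_bigr => j _ /=.
rewrite exchange_big; apply: eq_bigr => i _; apply: eq_bigr => i' _.
by rewrite (ipZl ip) (ipZr ip) sAB.
Qed.

(** Expansion by multilinearity, one factor at a time; [contr u] contracts x with u in the outermost
    factor, which leaves a tensor of lower degree for the induction. *)
Lemma tip_tprod_sum k r (x : tpower k) (y : 'I_r.+1 -> 'M[F]_N) :
  tip x (tprod (fun=> \sum_i y i) k) != 0 ->
  exists a : nat -> 'I_r.+1, tip x (tprod (y \o a) k) != 0.
Proof.
elim: k x => [|k IH] x x0; first by exists (fun=> ord0).
have ip := tip_inner_product k.
pose contr u : tpower k := \sum_p (u p.1 p.2)^* *: x p.
have contrE u t : tip x (tcons u t) = tip (contr u) t.
  rewrite tipE (ip_suml ip); apply: eq_bigr => p _.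
  by rewrite tconsE (ipZr ip) (ipZl ip) conjCK.
have tcons_sum (t : tpower k) : tcons (\sum_i y i) t = \sum_i tcons (y i) t.
  by apply: (big_morph (fun u => tcons u t)) => [u v|]; rewrite ?tconsDl ?tcons0l.
have [i yi] : exists i, tip x (tcons (y i) (tprod (fun=> \sum_i y i) k)) != 0.
  apply: NNPP => ny; move: x0; rewrite [tprod _ _]/= tcons_sum.
  rewrite (ip_sumr (tip_inner_product k.+1)) big1 ?eqxx // => i _.
  by apply/eqP; apply: contraT => yi; case: ny; exists i.
move: yi; rewrite contrE => /IH[a]; rewrite -contrE => xa.
exists (fun m => if m == k then i else a m); rewrite [tprod _ _]/= eqxx.
by rewrite (@eq_tprod _ _ (y \o a)) // => m mk /=; rewrite ltn_eqF.
Qed.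

Section Linear.
Hypothesis s_linear : linear s.
Hypothesis s_bracket : forall A B, s (A *m B - B *m A) = s B *m s A - s A *m s B.

Lemma tact_linearA k a A B (t : tpower k) :
  tact (a *: A + B) t = a *: tact A t + tact B t.
Proof.
elim: k t => [|k IH] t; first by rewrite /= scaler0 addr0.
apply/ffunP => p; rewrite [RHS]ffunE [in RHS]ffunE !tactE IH s_linear !scalerDr !scaler_sumr.
rewrite [in RHS]addrACA; congr (_ + _); rewrite [in RHS]addrACA; congr (_ + _).
  by rewrite -big_split; apply: eq_bigr => i _; rewrite !mxE scalerDl !scalerA.
by rewrite -big_split; apply: eq_bigr => i _; rewrite !mxE scalerDl !scalerA.
Qed.

Let cancel_mixed (Z : zmodType) (u v w u' v' w' p q r m x y : Z) :
  u + p + q + (r + v + m) + (x + y + w) - (u' + r + x + (p + v' + y) + (q + m + w'))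
  = u - u' + (v - v') + (w - w').
Proof.
apply/eqP; rewrite subr_eq; apply/eqP.
rewrite -{1}(subrK u' u) -{1}(subrK v' v) -{1}(subrK w' w).
move: (u - u') (v - v') (w - w') => du dv dw; rewrite !addrA.
by rewrite [LHS](ACl (1*6*11*2*5*9*3*7*10*4*8*12)).
Qed.

(** A acts from the left on the outer factor, from the right on it through s, and on the inner
    tensor. The three actions commute with one another, so the mixed terms cancel and each
    contributes its own bracket. *)
Lemma tact_bracket k A B (t : tpower k) :
  tact (A *m B - B *m A) t = tact A (tact B t) - tact B (tact A t).
Proof.
elim: k t => [|k IH] t; first by rewrite /= subrr.
pose L (X : 'M[F]_N) (t : tpower k.+1) : tpower k.+1 := [ffun p => \sum_i X p.1 i *: t (i, p.2)].
pose R (X : 'M[F]_N) (t : tpower k.+1) : tpower k.+1 := [ffun p => \sum_j X j p.2 *: t (p.1, j)].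
pose D X (t : tpower k.+1) : tpower k.+1 := [ffun p => tact X (t p)].
have actE X u : tact X u = (L X u + R (s X) u) + D X u :> tpower k.+1.
  by apply/ffunP => p; rewrite tactE !ffunE.
have LD X u v : L X (u + v) = L X u + L X v.
  apply/ffunP => p; rewrite !ffunE -big_split; apply: eq_bigr => i _.
  by rewrite ffunE scalerDr.
have RD X u v : R X (u + v) = R X u + R X v.
  apply/ffunP => p; rewrite !ffunE -big_split; apply: eq_bigr => i _.
  by rewrite ffunE scalerDr.
have DD X u v : D X (u + v) = D X u + D X v.
  by apply/ffunP => p; rewrite !ffunE tactD.
have LL X Y u : L X (L Y u) = L (X *m Y) u.
  apply/ffunP => p; rewrite !ffunE.
  under eq_bigr do rewrite ffunE scaler_sumr.
  rewrite exchange_big; apply: eq_bigr => i _ /=; rewrite mxE scaler_suml.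
  by apply: eq_bigr => j _; rewrite scalerA.
have RR X Y u : R X (R Y u) = R (Y *m X) u.
  apply/ffunP => p; rewrite !ffunE.
  under eq_bigr do rewrite ffunE scaler_sumr.
  rewrite exchange_big; apply: eq_bigr => i _ /=; rewrite mxE scaler_suml.
  by apply: eq_bigr => j _; rewrite scalerA mulrC.
have LR X Y u : L X (R Y u) = R Y (L X u).
  apply/ffunP => p; rewrite !ffunE.
  under eq_bigr do rewrite ffunE scaler_sumr.
  under [in RHS]eq_bigr do rewrite ffunE scaler_sumr.
  rewrite exchange_big; apply: eq_bigr => i _ /=.
  by apply: eq_bigr => j _; rewrite !scalerA mulrC.
have LDc X Y u : L X (D Y u) = D Y (L X u).
  apply/ffunP => p; rewrite !ffunE tact_sum; apply: eq_bigr => i _.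
  by rewrite ffunE tactZ.
have RDc X Y u : R X (D Y u) = D Y (R X u).
  apply/ffunP => p; rewrite !ffunE tact_sum; apply: eq_bigr => i _.
  by rewrite ffunE tactZ.
have Lb u : L (A *m B - B *m A) u = L A (L B u) - L B (L A u).
  rewrite !LL; apply/ffunP => p; rewrite !ffunE -sumrB; apply: eq_bigr => i _.
  by rewrite -scalerBl !mxE.
have Rb u : R (s (A *m B - B *m A)) u = R (s A) (R (s B) u) - R (s B) (R (s A) u).
  rewrite !RR s_bracket; apply/ffunP => p; rewrite !ffunE -sumrB.
  by apply: eq_bigr => i _; rewrite -scalerBl !mxE.
have Db u : D (A *m B - B *m A) u = D A (D B u) - D B (D A u).
  by apply/ffunP => p; rewrite !ffunE IH.
rewrite !actE !(LD, RD, DD) Lb Rb Db -!LDc -!RDc -!LR.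
by rewrite cancel_mixed.
Qed.

Lemma lract_linearA a A B X : lract (a *: A + B) X = a *: lract A X + lract B X.
Proof.
rewrite /lract s_linear mulmxDl mulmxDr -scalemxAl -scalemxAr scalerDr.
by rewrite addrACA.
Qed.

(* As Y^2 u = 0, the exponential of Y maps u to u + Y u. *)
Lemma tprod_shear k A u (M : {vspace tpower k}) :
  (forall t, t \in M -> tact A t \in M) -> lract A (lract A u) = 0 ->
  tprod (fun=> u) k \in M -> tprod (fun=> u + lract A u) k \in M.
Proof.
move=> MA Au2; set v := lract A u => uM.
(* S k m is the sum of all products of k factors, m of them v and the others u; this is the divided
   power A^m / m! applied to u^(x)k. *)
pose S := fix S k m : tpower k := match k, m with
  | 0%N, 0%N => 1 : F^o
  | 0%N, _.+1 => 0
  | k'.+1, 0%N => tcons u (S k' 0%N)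
  | k'.+1, m'.+1 => tcons u (S k' m) + tcons v (S k' m')
  end.
have S0 j : S j 0%N = tprod (fun=> u) j by elim: j => //= j ->.
have SA j m : tact A (S j m) = m.+1%:R *: S j m.+1.
  elim: j m => [|j IH] [|m]; rewrite ?scaler0 //.
    rewrite [LHS]tact_tcons IH -/v !scale1r addrC; congr (tcons _ _ + _).
  rewrite [S _ _]/= tactD !tact_tcons !IH Au2 tcons0l add0r -/v !tconsZr.
  rewrite [tcons v _ + _]addrC -addrA -[X in _ + (X + _)]scale1r -scalerDl.
  by rewrite nat1r -scalerDr.
have SM m : S k m \in M.
  elim: m => [|m IH]; first by rewrite S0.
  have m0 : m.+1%:R != 0 :> F by rewrite pnatr_eq0.
  by rewrite -[S k m.+1](scalerK m0) -SA memvZ // MA.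
(* Any n beyond j is allowed, as S j m = 0 for m > j; the induction step uses two different
   ranges. *)
suff sumS j n : (j < n)%N -> \sum_(m < n) S j m = tprod (fun=> u + v) j.
  by rewrite -(sumS _ k.+1) //; apply: memv_suml.
elim: j n => [|j IH] n.
  case: n => // n _; rewrite big_ord_recl big1 ?addr0 // => i _.
case: n => // n jn; rewrite big_ord_recl.
have tcons_sum w I (r : seq I) (t : I -> tpower j) :
    \sum_(i <- r) tcons w (t i) = tcons w (\sum_(i <- r) t i).
  by symmetry; apply: (big_morph (tcons w)) => [x y|]; rewrite ?tconsDr ?tcons0r.
rewrite [X in _ + X]big_split addrA.
rewrite -[tprod _ j.+1]/(tcons (u + v) (tprod (fun=> u + v) j)) tconsDl.
congr (_ + _); last by rewrite tcons_sum IH.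
by rewrite -(IH n.+1) 1?ltnW // big_ord_recl tconsDr -tcons_sum.
Qed.

Inductive lie_generated (P : 'M[F]_N -> Prop) : 'M[F]_N -> Prop :=
  | LieGen A of P A : lie_generated P A
  | LieLin a A B of lie_generated P A & lie_generated P B : lie_generated P (a *: A + B)
  | LieBracket A B of lie_generated P A & lie_generated P B :
      lie_generated P (A *m B - B *m A).

Lemma lie_generated_stable k (P : 'M[F]_N -> Prop) (Q : {vspace tpower k}) :
  (forall A, P A -> forall t, t \in Q -> tact A t \in Q) ->
  forall A, lie_generated P A -> forall t, t \in Q -> tact A t \in Q.
Proof.
move=> PQ A; elim=> {A} [A /PQ//|a A B _ IA _ IB|A B _ IA _ IB] t tQ.
  by rewrite tact_linearA memvD ?memvZ ?IA ?IB.
by rewrite tact_bracket memvB ?IA ?IB // ?IA ?IB.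
Qed.

(* If g w is contained in b w + F w for a space of matrices g normalised by b,
   then the b-submodule generated by w^(x)k is stable under g. *)
Lemma cyclic_stable k (P g : 'M[F]_N -> Prop) w (Q : {vspace tpower k}) :
  (forall A B, P B -> g A -> g (A *m B - B *m A)) ->
  (forall A, g A -> exists B c, lie_generated P B /\ lract A w = lract B w + c *: w) ->
  tprod (fun=> w) k \in Q ->
  (forall B, P B -> forall t, t \in Q -> tact B t \in Q) ->
  (forall Q' : {vspace tpower k}, tprod (fun=> w) k \in Q' ->
     (forall B, P B -> forall t, t \in Q' -> tact B t \in Q') -> (Q <= Q')%VS) ->
  forall A, g A -> forall t, t \in Q -> tact A t \in Q.
Proof.
move=> gP gw wQ PQ minQ.
(* The part of Q that g maps into Q. It contains w^(x)k, since w is an eigenvector of A - B, and P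
   preserves it because P normalises g. *)
have [| |U UP] := @vspace_of_pred _ _ (fun t : tpower k =>
    t \in Q /\ forall A, g A -> tact A t \in Q).
- by split=> [|A _]; rewrite -?tendE ?linear0 mem0v.
- move=> a t t' [tQ gt] [tQ' gt']; split; first by rewrite memvD ?memvZ.
  by move=> A gA; rewrite tact_linear memvD ?memvZ ?gt ?gt'.
suff /subvP QU : (Q <= U)%VS by move=> A gA t /QU/UP[_ ]; apply.
apply: minQ => [|B PB t /UP[tQ gt]]; apply/UP; split=> [|A gA] //.
- have [B [c [PB wE]]] := gw A gA.
  have -> : A = 1 *: B + (A - B) by rewrite scale1r addrC subrK.
  rewrite tact_linearA scale1r memvD ?(lie_generated_stable PQ PB) //.
  rewrite (@tact_eigen k _ (fun=> w) (fun=> c)) ?memvZ // => _.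
  have := lract_linearA (-1) B A w; rewrite !scaleN1r addrC => ->.
  by rewrite wE addKr.
- exact: PQ.
- have -> : tact A (tact B t) = tact (A *m B - B *m A) t + tact B (tact A t).
    by rewrite tact_bracket subrK.
  by apply: memvD; [apply: gt; apply: gP | apply: (PQ B) => //; apply: gt].
Qed.

End Linear.
End TensorPower.

(** * Folding *)

(** [fold_gen] without its scalars, to keep the folded matrices integral. The scalars in [fold_e]
    and [fold_f] are inverse to each other, so the coroots do not change. The general [Z] covers
    endomorphisms of V as well. *)
Definition fold (Z : zmodType) (x : 'I_6 -> Z) (i : 'I_4) : Z :=
  let X j := x (inord j.-1) in
  nth 0 [:: X 2; X 4; (X 3 + X 5)%R; (X 1 + X 6)%R]%N i.

Lemma fold_ind (Z : zmodType) (x : 'I_6 -> Z) (P : Z -> Prop) :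
  (forall i, P (x i)) -> (forall i j, P (x i + x j)) -> forall i, P (fold x i).
Proof. by move=> P1 P2 [[|[|[|[|m]]]] mi] //; rewrite /fold /=; auto. Qed.

Record chevalley_matrices (F : numClosedFieldType) N r (A : 'M[int]_r)
    (E L H : 'I_r -> 'M[F]_N) : Prop := ChevalleyMatrices {
  cm_ef : forall i j, E i *m L j - L j *m E i = if i == j then H i else 0;
  cm_hh : forall i j, H i *m H j = H j *m H i;
  cm_he : forall i j, H i *m E j - E j *m H i = (A i j)%:~R *: E j;
  cm_hf : forall i j, H i *m L j - L j *m H i = - (A i j)%:~R *: L j;
  cm_adj : forall i a b, L i a b = (E i b a)^*
}.

Section Model.
Context {F : numClosedFieldType} {N : nat} (s : 'M[F]_N -> 'M[F]_N).
Hypothesis s_linear : linear s.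
Hypothesis s_bracket : forall A B, s (A *m B - B *m A) = s B *m s A - s A *m s B.
Hypothesis s_adj : forall A B : 'M[F]_N, (forall i j, B i j = (A j i)^*) ->
  forall i j, s B i j = (s A j i)^*.

Lemma tend_chevalley k r (A : 'M[int]_r) (E L H : 'I_r -> 'M[F]_N) :
  chevalley_matrices A E L H ->
  chevalley_action A (fun i => tend s k (E i)) (fun i => tend s k (L i))
    (fun i => tend s k (H i)).
Proof.
move=> cm.
have t0 (t : @tpower F N k) : tact s 0 t = 0.
  by have := tact_linearA s_linear (-1) 0 0 t; rewrite scaler0 addr0 scaleN1r addNr.
have tZ a B (t : @tpower F N k) : tact s (a *: B) t = a *: tact s B t.
  by have := tact_linearA s_linear a B 0 t; rewrite t0 !addr0.
split=> i j t; rewrite !tendE.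
- have := tact_bracket s_bracket (E i) (L j) t; rewrite (cm_ef cm) => /eqP.
  by rewrite eq_sym subr_eq addrC => /eqP ->; case: eqP; rewrite ?tendE ?t0.
- have := tact_bracket s_bracket (H i) (H j) t; rewrite (cm_hh cm) subrr t0.
  by move/eqP; rewrite eq_sym subr_eq0 => /eqP.
- have := tact_bracket s_bracket (H i) (E j) t; rewrite (cm_he cm) tZ => /eqP.
  by rewrite eq_sym subr_eq addrC => /eqP.
- have := tact_bracket s_bracket (H i) (L j) t; rewrite (cm_hf cm) tZ => /eqP.
  by rewrite eq_sym subr_eq addrC scaleNr => /eqP.
Qed.

Context {A6 : 'M[int]_6} {A4 : 'M[int]_4} {c6 : 'I_6 -> F} {c4 : 'I_4 -> F}.
Hypothesis cA6 : forall j, \sum_i c6 i * (A6 i j)%:~R = 1.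
Hypothesis cA4 : forall j, \sum_i c4 i * (A4 i j)%:~R = 1.
Context {E L H : 'I_6 -> 'M[F]_N} {H4 : 'I_4 -> 'M[F]_N}.
Hypothesis cm6 : chevalley_matrices A6 E L H.
Hypothesis cm4 : chevalley_matrices A4 (fold E) (fold L) H4.

(** In the application g is the image of the Lie algebra of E6 in the 27 x 27 matrices. *)
Context {g : 'M[F]_N -> Prop}.
Hypothesis gE : forall i, g (E i).
Hypothesis gL : forall i, g (L i).
Hypothesis g_bracket : forall A i, g A ->
  g (A *m fold L i - fold L i *m A) /\ g (A *m H4 i - H4 i *m A).

Context {m6 : 'I_6 -> int} {u w : 'M[F]_N} {r : nat}.
Context {x y : 'I_r.+1 -> 'M[F]_N} {nu : 'I_r.+1 -> 'I_4 -> int}.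
Hypothesis u0 : u != 0.
Hypothesis Eu : forall i, lract s (E i) u = 0.
Hypothesis Hu : forall i, lract s (H i) u = (m6 i)%:~R *: u.
Hypothesis w_reach : forall k (M : {vspace @tpower F N k}),
  (forall i t, t \in M -> tact s (L i) t \in M) ->
  tprod (fun=> u) k \in M -> tprod (fun=> w) k \in M.
Hypothesis wE : w = \sum_i y i.
Hypothesis Hy : forall i j, lract s (H4 j) (y i) = (nu i j)%:~R *: y i.
Hypothesis Ex : forall i j, lract s (fold E j) (x i) = 0.
Hypothesis Hx : forall i j, lract s (H4 j) (x i) = (nu i j)%:~R *: x i.
Hypothesis xw : forall i, mxip (x i) w != 0.
Hypothesis gw : forall A, g A -> exists B c,
  lie_generated (fun B => exists i, B = fold L i \/ B = H4 i) B /\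
  lract s A w = lract s B w + c *: w.

Context {k : nat} {I : finType} {nuI : I -> 'I_4 -> int}.
(** [nuI] lists without repetition all sums of k weights [nu]; [nuI_lower] serves to produce
    constituents and [nuI_upper] to exclude others. *)
Hypothesis nuI_inj : forall a b, nuI a =1 nuI b -> a = b.
Hypothesis nuI_lower : forall a, exists us : nat -> 'I_r.+1,
  forall j, nuI a j = \sum_(i < k) nu (us i) j.
Hypothesis nuI_upper : forall us : nat -> 'I_r.+1, exists a,
  forall j, nuI a j = \sum_(i < k) nu (us i) j.

Context {V : vectType F} {e f h : 'I_6 -> 'End(V)} {v : V}.
Hypothesis rel : chevalley_action A6 e f h.
Hypothesis irrV : forall U : {vspace V}, (forall i z, z \in U -> e i z \in U) ->
  (forall i z, z \in U -> f i z \in U) -> U = 0%VS \/ U = fullv.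
Hypothesis v0 : v != 0.
Hypothesis ev : forall i, e i v = 0.
Hypothesis hv : forall i, h i v = (m6 i *+ k)%:~R *: v.

Lemma model_decomposition : exists (W : I -> {vspace V}) (z : I -> V),
  [/\ forall a, [/\ z a \in W a, z a != 0, forall i, fold e i (z a) = 0 &
        forall i, fold e i (fold f i (z a)) = (nuI a i)%:~R *: z a],
      forall a i t, t \in W a -> fold e i t \in W a /\ fold f i t \in W a,
      forall a (U : {vspace V}), (U <= W a)%VS ->
        (forall i t, t \in U -> fold e i t \in U) ->
        (forall i t, t \in U -> fold f i t \in U) -> U = 0%VS \/ U = W a,
      (\sum_a W a)%VS = fullv &
      forall t : I -> V, (forall a, t a \in W a) -> \sum_a t a = 0 ->
        forall a, t a = 0].
Proof.
have ip := tip_inner_product (F := F) (N := N) k.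
have adj (B B' : 'M[F]_N) : (forall i j, B' i j = (B j i)^*) ->
    forall a b : @tpower F N k, tip (tend s k B a) b = tip a (tend s k B' b).
  by move=> BB' a b; rewrite !tendE; apply: tip_adjoint BB' (s_adj BB') _ _.
have adj6 i := adj _ _ (cm_adj cm6 i); have adj4 i := adj _ _ (cm_adj cm4 i).
have rel6 := tend_chevalley k cm6; have rel4 := tend_chevalley k cm4.
have tpE us B (c : nat -> F) : (forall i, lract s B (us i) = c i *: us i) ->
    tend s k B (tprod us k) = (\sum_(i < k) c i) *: tprod us k.
  by move=> usB; rewrite tendE; apply: tact_eigen.
have tp0 us B : (forall i, lract s B (us i) = 0) -> tend s k B (tprod us k) = 0.
  move=> usB; rewrite (tpE us B (fun=> 0)) ?big1 ?scale0r // => i.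
  by rewrite usB scale0r.
have uk0 : tprod (fun=> u) k != 0.
  apply: contraNneq u0 => uk0; have := ip0l ip (tprod (fun=> u) k).
  rewrite -[in LHS]uk0 tip_tprod prodr_const card_ord => /eqP.
  rewrite expf_eq0 => /andP[_ /eqP uu]; apply/eqP/matrixP => i j; rewrite mxE.
  move/eqP: uu; rewrite psumr_eq0 => [/allP/(_ (i, j))|p _]; last first.
    by rewrite mulrC mul_conjC_ge0.
  by rewrite mem_index_enum => /(_ isT); rewrite mulf_eq0 conjC_eq0 orbb => /eqP.
have Huk i : tend s k (H i) (tprod (fun=> u) k) = (m6 i *+ k)%:~R *: tprod (fun=> u) k.
  by rewrite (tpE _ _ (fun=> (m6 i)%:~R)) // sumr_const card_ord rmorphMn.
(* From here on the work takes place in the image M of V, where the inner product is available; the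
   result is pulled back along Phi at the end. *)
have [Phi [Phi_inj Phiv PhiE PhiL]] := unitary_embedding rel rel6 ip adj6 cA6 irrV
  v0 ev hv uk0 (fun i => tp0 _ _ (fun=> Eu i)) Huk.
have tendD B B' t : tend s k (B + B') t = tend s k B t + tend s k B' t.
  by have := tact_linearA s_linear 1 B B' t; rewrite !scale1r !tendE.
have PhiE4 i z : Phi (fold e i z) = tend s k (fold E i) (Phi z).
  by case: i => [[|[|[|[|m]]]] mi] //; rewrite /fold /= ?tendD ?add_lfunE ?linearD /= !PhiE.
have PhiL4 i z : Phi (fold f i z) = tend s k (fold L i) (Phi z).
  by case: i => [[|[|[|[|m]]]] mi] //; rewrite /fold /= ?tendD ?add_lfunE ?linearD /= !PhiL.
pose M := limg Phi.
have PhiM z : Phi z \in M by rewrite memv_img ?memvf.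
have E4M i t : t \in M -> tend s k (fold E i) t \in M.
  by case/memv_imgP => z _ ->; rewrite -PhiE4.
have L4M i t : t \in M -> tend s k (fold L i) t \in M.
  by case/memv_imgP => z _ ->; rewrite -PhiL4.
have H4M := chev_h_stable rel4 E4M L4M.
pose wk : @tpower F N k := tprod (fun=> w) k.
have wM : wk \in M.
  apply: w_reach; last by rewrite -Phiv.
  by move=> i t /memv_imgP[z _ ->]; rewrite -tendE -PhiL.
have xwk us : tip (tprod (x \o us) k) wk != 0.
  by rewrite tip_tprod; apply/prodf_neq0 => i _; apply: xw.
have wk0 : wk != 0.
  by apply: contraNneq (xwk (fun=> ord0)) => ->; rewrite (ip0r ip).
(* A lowest-type argument: M is generated from wk by the lowering operators of
   the folded algebra, so that its singular vectors are not orthogonal to wk. *)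
have wk_generates (Q : {vspace @tpower F N k}) : wk \in Q ->
    (forall i t, t \in Q -> tend s k (fold L i) t \in Q) ->
    (forall i t, t \in Q -> tend s k (H4 i) t \in Q) -> (M <= Q)%VS.
  move=> wQ LQ HQ.
  (* Q0 is the b-submodule generated by w^(x)k; the Boolean of an index selects lowering operators
     or coroots. *)
  have [Q0 [wQ0 Q0P minQ0]] := smallest_stable
    (fun p : bool * 'I_4 => tend s k (if p.1 then fold L p.2 else H4 p.2)) wk.
  have gQ0 A : g A -> forall t, t \in Q0 -> tact s A t \in Q0.
    apply: (cyclic_stable s_linear s_bracket _ gw wQ0)
      => [B _ [i [->|->]]|_ [i [->|->]]|Q' wQ' Q'P].
    - by move=> /(g_bracket i)[].
    - by move=> /(g_bracket i)[].
    - by move=> t tQ0; rewrite -tendE; apply: (Q0P (true, i)).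
    - by move=> t tQ0; rewrite -tendE; apply: (Q0P (false, i)).
    - apply: minQ0 => // -[[] i] t tQ'; rewrite tendE; apply: Q'P => //; exists i; by [left|right].
  have Q0Q : (Q0 <= Q)%VS by apply: minQ0 => // -[[] i] t tQ; [apply: LQ | apply: HQ].
  apply: subv_trans Q0Q.
  (* Since Q0 is stable under E6, its preimage in the irreducible V is 0 or V, and it contains the
     nonzero preimage of w^(x)k. *)
  have [| |U UP] := @vspace_of_pred _ V (fun z => Phi z \in Q0).
  - by rewrite linear0 mem0v.
  - by move=> a z z' zQ zQ'; rewrite linearP memvD ?memvZ.
  have EU i z : z \in U -> e i z \in U.
    by move/UP=> zQ; apply/UP; rewrite PhiE tendE; apply: gQ0.
  have LU i z : z \in U -> f i z \in U.
    by move/UP=> zQ; apply/UP; rewrite PhiL tendE; apply: gQ0.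
  apply/subvP=> _ /memv_imgP[z _ ->]; apply/UP.
  case: (irrV EU LU) => UE; last by rewrite UE memvf.
  have [z' _ wkE] := memv_imgP wM.
  have : z' \in U by apply/UP; rewrite -wkE.
  rewrite UE [z' \in _]memv0 => /eqP z'0.
  by move: wk0; rewrite wkE z'0 linear0 eqxx.
(* The orthogonal complement of a singular t is stable under b: a lowering operator passes to the
   other side as a raising one and kills t. If it contains w^(x)k, it contains M and thus t
   itself. *)
have not_orth t mu : t \in M -> (forall i, tend s k (fold E i) t = 0) ->
    (forall i, tend s k (H4 i) t = mu i *: t) -> tip t wk = 0 -> t = 0.
  move=> tM Et Ht t0; apply: (ip_definite ip).
  have [| |Q QP] := @vspace_of_pred _ _ (fun t' : @tpower F N k => tip t t' = 0).
  - exact: (ip0r ip).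
  - by move=> a t1 t2 e1 e2; rewrite (ip_linear ip) e1 e2 mulr0 addr0.
  have /subvP MQ : (M <= Q)%VS; last by apply/QP/MQ.
  apply: wk_generates => [|i t1 /QP e1|i t1 /QP e1]; apply/QP => //.
    by rewrite -adj4 Et (ip0l ip).
  by rewrite -(adj_h ip rel4 adj4) Ht (ipZl ip) e1 mulr0.
(* M is stable under F4 and its adjoints, so the projection to M commutes with F4 and keeps the
   product of the x_i singular of the same weight. As w^(x)k lies in M, the projection still pairs
   with it to the nonzero product of the [mxip (x i) w]. *)
have lower a : exists z, [/\ Phi z != 0, tip (Phi z) wk != 0,
    forall i, tend s k (fold E i) (Phi z) = 0 &
    forall i, tend s k (H4 i) (Phi z) = (nuI a i)%:~R *: Phi z].
  have [us usE] := nuI_lower a; pose p : @tpower F N k := tprod (x \o us) k.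
  have [_ /memv_imgP[z _ ->] pz] := orthogonal_projection ip M p.
  have pz' t : t \in M -> tip t (Phi z) = tip t p.
    by move=> tM; have /eqP := pz t tM; rewrite (ipBr ip) subr_eq0 => /eqP.
  have zero t : t \in M -> (forall t', t' \in M -> tip t' t = 0) -> t = 0.
    by move=> tM t0; apply: (ip_definite ip); apply: t0.
  exists z; suff zw : tip (Phi z) wk != 0.
    split=> // [|i|i].
    - by apply: contraNneq zw => ->; rewrite (ip0l ip).
    - apply: zero => [|t tM]; first exact: E4M.
      rewrite -(adjC ip adj4) pz' ?L4M // (adjC ip adj4).
      by rewrite tp0 ?(ip0r ip) // => j; apply: Ex.
    - apply/eqP; rewrite -subr_eq0; apply/eqP/zero => [|t tM].
        by rewrite memvB ?memvZ ?H4M.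
      rewrite (ipBr ip) (ipZr ip) -(adj_h ip rel4 adj4) !pz' ?H4M //.
      rewrite (adj_h ip rel4 adj4) (tpE _ _ (fun j => (nu (us j) i)%:~R)); last first.
        by move=> j; apply: Hx.
      by rewrite (ipZr ip) usE rmorph_sum subrr.
  rewrite (ip_conj ip wk) conjC_eq0 pz' //.
  by rewrite (ip_conj ip p) conjC_eq0; apply: xwk.
have [z zP] : exists z : I -> V, forall a, [/\ Phi (z a) != 0, tip (Phi (z a)) wk != 0,
    forall i, tend s k (fold E i) (Phi (z a)) = 0 &
    forall i, tend s k (H4 i) (Phi (z a)) = (nuI a i)%:~R *: Phi (z a)].
  exact: fin_all_exists lower.
(* By expansion of w^(x)k, t pairs nontrivially with some product of the y_i, and this fixes its
   weight. Then t - c z_a is singular and orthogonal to w^(x)k; c is a conjugate because [tip] is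
   conjugate linear on the left. *)
have uniq t mu : t \in M -> t != 0 -> (forall i, tend s k (fold E i) t = 0) ->
    (forall i, tend s k (H4 i) t = mu i *: t) -> exists a c, t = c *: Phi (z a).
  move=> tM t0 Et Ht.
  have : tip t wk != 0 by apply: contra_neq t0; apply: not_orth Ht.
  rewrite /wk wE => /tip_tprod_sum[us yt]; have [a aE] := nuI_upper us.
  have Hta i : tend s k (H4 i) t = (nuI a i)%:~R *: t.
    rewrite Ht; congr (_ *: _); apply: (weight_eq ip rel4 adj4 (Ht i) _ yt).
    rewrite (tpE _ _ (fun j => (nu (us j) i)%:~R)); last by move=> j; apply: Hy.
    by rewrite aE rmorph_sum.
  have [_ zw Ez Hz] := zP a; pose c := (tip t wk / tip (Phi (z a)) wk)^*.
  exists a, c; apply/eqP; rewrite -subr_eq0; apply/eqP.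
  apply: (not_orth _ (fun i => (nuI a i)%:~R)) => [|i|i|].
  - by rewrite memvB ?memvZ.
  - by rewrite linearB linearZ /= Et Ez scaler0 subrr.
  - by rewrite linearB linearZ /= Hta Hz scalerBr !scalerA mulrC.
  - by rewrite (ipBl ip) (ipZl ip) conjCK divfK ?subrr.
have [W [W1 W2 W3 W4]] := unitary_decomposition ip rel4 adj4 cA4 (x := Phi \o z)
  (nu := fun a i => (nuI a i)%:~R) E4M L4M (fun a => PhiM (z a))
  (fun a => let: And4 p _ _ _ := zP a in p) (fun a => let: And4 _ _ p _ := zP a in p)
  (fun a => let: And4 _ _ _ p := zP a in p)
  (fun a b ab => nuI_inj (fun i => intr_inj (ab i))) uniq.
pose W' a := (Phi @^-1: W a)%VS.
have W'P a t : (t \in W' a) = (Phi t \in W a) by rewrite memv_preim.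
have WM a : (W a <= M)%VS by rewrite -W3; apply: sumv_sup (subvv _).
exists W', z; split.
- move=> a; have [z0 _ Ez Hz] := zP a; have [zW _ _] := W1 a.
  split=> [||i|i].
  + by rewrite W'P.
  + by apply: contra_neq z0 => ->; rewrite linear0.
  + by apply: Phi_inj; rewrite PhiE4 Ez linear0.
  + apply: Phi_inj; rewrite PhiE4 PhiL4 (chev_ef rel4) Ez eqxx Hz.
    by rewrite !linear0 add0r linearZ.
- move=> a i t; rewrite !W'P PhiE4 PhiL4; have [_ EW LW] := W1 a.
  by move=> tW; rewrite EW ?LW.
- move=> a U UW EU LU; have UW' : (Phi @: U <= W a)%VS.
    by apply/subvP=> _ /memv_imgP[t tU ->]; rewrite -W'P; apply: subvP tU.
  have EU' i t : t \in (Phi @: U)%VS -> tend s k (fold E i) t \in (Phi @: U)%VS.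
    by case/memv_imgP=> t' tU ->; rewrite -PhiE4 memv_img // EU.
  have LU' i t : t \in (Phi @: U)%VS -> tend s k (fold L i) t \in (Phi @: U)%VS.
    by case/memv_imgP=> t' tU ->; rewrite -PhiL4 memv_img // LU.
  case: (W2 a _ UW' EU' LU') => UE; [left|right].
    apply/eqP; rewrite -subv0; apply/subvP => t tU; rewrite memv0.
    have : Phi t \in (Phi @: U)%VS by rewrite memv_img.
    by rewrite UE memv0 -(linear0 Phi) (inj_eq Phi_inj).
  apply/eqP; rewrite eqEsubv UW; apply/subvP => t; rewrite W'P -UE.
  by case/memv_imgP => t' t'U /Phi_inj ->.
- apply/eqP; rewrite eqEsubv subvf; apply/subvP => t _.
  have := PhiM t; rewrite -W3 => /memv_sumP[b bW tE].
  have /fin_all_exists[b' b'E] : forall a, exists t', b a = Phi t'.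
    move=> a; have /memv_imgP[t' _ ->] : b a \in M by apply: subvP (WM a) _ (bW a isT).
    by exists t'.
  have -> : t = \sum_a b' a.
    by apply: Phi_inj; rewrite tE linear_sum; apply: eq_bigr => a _; rewrite b'E.
  apply: memv_sumr => a _; rewrite W'P -b'E; exact: bW.
- move=> t tW t0 a; apply: Phi_inj; rewrite linear0.
  apply: (W4 (Phi \o t)) => [b|]; first by rewrite -W'P.
  by rewrite -linear_sum t0 linear0.
Qed.

End Model.

(** * Sparse matrices and the minuscule representation of E6 *)

(* Sparse integer matrices, as lists of (row, column, entry); repeated
   positions add up. *)
Definition smx := seq (nat * nat * int).

Fixpoint sins (p : nat * nat * int) (l : smx) : smx :=
  if l is q :: l' then
    if q.1 == p.1 then (q.1, q.2 + p.2) :: l' else q :: sins p l'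
  else [:: p].

(** A normal form for zero tests: with positions merged and zero entries dropped, emptiness
    certifies the zero matrix. *)
Definition snorm (l : smx) : smx := [seq p <- foldr sins [::] l | p.2 != 0].
Definition sscale (c : int) (l : smx) : smx := [seq (p.1, c * p.2) | p <- l].
Definition strn (l : smx) : smx := [seq ((p.1.2, p.1.1), p.2) | p <- l].
(** The guard on the summation index agrees with [zm], which ignores entries outside the n x n
    square. *)
Definition smul (n : nat) (A B : smx) : smx :=
  flatten [seq [seq ((p.1.1, q.1.2), p.2 * q.2) |
    q <- B & (q.1.1 == p.1.2) && (p.1.2 < n)%N] | p <- A].
Definition ssub (A B : smx) : smx := snorm (A ++ sscale (-1) B).
Definition sbr (n : nat) (A B : smx) : smx := ssub (smul n A B) (smul n B A).
Definition seqm (A B : smx) : bool := nilp (ssub A B).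
Definition sdot (n : nat) (A B : smx) : int :=
  foldr +%R 0 [seq foldr +%R 0 [seq p.2 * q.2 |
    q <- B & (q.1 == p.1) && (p.1.1 < n)%N && (p.1.2 < n)%N] | p <- A].
Definition scomb (c : seq int) (l : seq smx) : smx :=
  flatten [seq sscale p.1 p.2 | p <- zip c l & p.1 != 0].

Section SparseMatrices.
Context {F : numClosedFieldType} {n : nat}.

Definition sent (p : nat * nat * int) (i j : nat) : F :=
  if (p.1.1 == i) && (p.1.2 == j) then p.2%:~R else 0.

Definition zm (l : smx) : 'M[F]_n := \matrix_(i, j) \sum_(p <- l) sent p i j.

Lemma zm_nil : zm [::] = 0.
Proof. by apply/matrixP => i j; rewrite !mxE big_nil. Qed.

Lemma zm_cat A B : zm (A ++ B) = zm A + zm B.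
Proof. by apply/matrixP => i j; rewrite !mxE big_cat. Qed.

Lemma zm_cons p A : zm (p :: A) = zm [:: p] + zm A.
Proof. exact: (zm_cat [:: p]). Qed.

Lemma zm_scale c A : zm (sscale c A) = c%:~R *: zm A.
Proof.
apply/matrixP => i j; rewrite !mxE big_map mulr_sumr; apply: eq_bigr => p _.
by rewrite /sent /=; case: ifP; rewrite ?mulr0 // intrM.
Qed.

Lemma zm_norm A : zm (snorm A) = zm A.
Proof.
have ins p l : zm (sins p l) = zm [:: p] + zm l.
  elim: l => [|q l IH] /=; first by rewrite zm_nil addr0.
  case: eqP => [qp|_]; last by rewrite (zm_cons q (sins p l)) IH (zm_cons q l) addrCA.
  rewrite (zm_cons _ l) (zm_cons q l) addrA; congr (_ + _).
  apply/matrixP => i j; rewrite !mxE !big_seq1 /sent /= qp.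
  by case: ifP; rewrite ?addr0 // intrD addrC.
have -> : zm A = zm (foldr sins [::] A).
  by elim: A => //= p A IH; rewrite ins zm_cons IH.
rewrite /snorm; elim: (foldr _ _ _) => //= p l IH.
case: ifP => [_|/negbFE/eqP p0]; first by rewrite zm_cons IH -zm_cons.
rewrite IH [RHS](zm_cons p l); suff -> : zm [:: p] = 0 by rewrite add0r.
by apply/matrixP => i j; rewrite !mxE big_seq1 /sent p0; case: ifP.
Qed.

Lemma zm_tr A : zm (strn A) = (zm A)^T.
Proof.
apply/matrixP => i j; rewrite !mxE big_map; apply: eq_bigr => p _.
by rewrite /sent /= andbC.
Qed.

Lemma zm_mul A B : zm (smul n A B) = zm A *m zm B.
Proof.
apply/matrixP => i k; rewrite !mxE big_flatten big_map.
under [RHS]eq_bigr do rewrite !mxE mulr_suml.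
rewrite exchange_big; apply: eq_bigr => p _; rewrite big_map big_filter.
under [RHS]eq_bigr do rewrite mulr_sumr.
rewrite exchange_big big_mkcond; apply: eq_bigr => q _ /=.
have [p27|p27] := ltnP p.1.2 n; last first.
  rewrite andbF big1 // => j _; rewrite /sent.
  by rewrite [p.1.2 == j]gtn_eqF ?andbF ?mul0r // (leq_trans _ p27).
rewrite (bigD1 (Ordinal p27)) //= big1 => [|j jp]; last first.
  rewrite /sent; case: (p.1.2 =P j) => [pj|_]; last by rewrite andbF mul0r.
  by case/eqP: jp; apply: val_inj.
rewrite addr0 /sent eqxx andbT; case: eqVneq => _ /=; last by rewrite mulr0.
by case: eqVneq => _ /=; rewrite ?mul0r //; case: eqVneq; rewrite ?mulr0 // intrM.
Qed.

Lemma zm_sub A B : zm (ssub A B) = zm A - zm B.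
Proof. by rewrite zm_norm zm_cat zm_scale rmorphN1 scaleN1r. Qed.

Lemma zm_br A B : zm (sbr n A B) = zm A *m zm B - zm B *m zm A.
Proof. by rewrite zm_sub !zm_mul. Qed.

Lemma seqm_zm A B : seqm A B -> zm A = zm B.
Proof. by move/nilP=> AB; apply/eqP; rewrite -subr_eq0 -zm_sub AB zm_nil. Qed.

Lemma zm_comb c l :
  zm (scomb c l) = \sum_(i < size l) (nth 0 c i)%:~R *: zm (nth [::] l i).
Proof.
elim: l c => [|A l IH] [|x c]; rewrite ?big_ord0 ?zm_nil // /scomb.
  by rewrite big1 ?zm_nil // => i _; rewrite nth_nil scale0r.
rewrite /= big_ord_recl -IH; case: eqP => [->|_] /=; last by rewrite zm_cat zm_scale.
by rewrite scale0r add0r.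
Qed.

Lemma zm_dot A B : mxip (zm A) (zm B) = (sdot n A B)%:~R.
Proof.
have fold_sum I (l : seq I) (g : I -> int) :
    (foldr +%R 0 [seq g p | p <- l])%:~R = \sum_(p <- l) (g p)%:~R :> F.
  by elim: l => [|p l IH]; rewrite ?big_nil //= big_cons intrD IH.
rewrite fold_sum /mxip.
under eq_bigr do rewrite !mxE rmorph_sum mulr_suml.
rewrite exchange_big; apply: eq_bigr => p _; rewrite fold_sum big_filter.
under eq_bigr do rewrite mulr_sumr.
rewrite exchange_big [RHS]big_mkcond; apply: eq_bigr => q _ /=.
have [p1|p1] := ltnP p.1.1 n; last first.
  rewrite andbF big1 // => j _; rewrite /sent.
  by rewrite [p.1.1 == _]gtn_eqF ?conjC0 ?mul0r // (leq_trans _ p1).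
have [p2|p2] := ltnP p.1.2 n; last first.
  rewrite andbF big1 // => j _; rewrite /sent.
  by rewrite [p.1.2 == _]gtn_eqF ?andbF ?conjC0 ?mul0r // (leq_trans _ p2).
rewrite (bigD1 (Ordinal p1, Ordinal p2)) //= big1 => [|[j j'] jp]; last first.
  rewrite /sent; case: ifP; last by rewrite conjC0 mul0r.
  case/andP => /eqP pj /eqP pj'; case/eqP: jp.
  by congr pair; apply: val_inj.
rewrite addr0 /sent !eqxx /= !andbT -[q.1 == p.1]/((q.1.1 == p.1.1) && (q.1.2 == p.1.2)).
case: ifP; rewrite ?mulr0 // => _.
by rewrite intrM rmorph_int.
Qed.

Lemma zm_conj A i j : (zm A i j)^* = zm A i j.
Proof.
rewrite !mxE rmorph_sum; apply: eq_bigr => p _; rewrite /sent.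
by case: ifP => _; [apply: rmorph_int | apply: conjC0].
Qed.

End SparseMatrices.

(* The minuscule representation of E6 on C^27: all the nonzero entries of the
   i-th lowering operator are 1, at the listed positions. *)
Definition lowering : seq (seq (nat * nat)) := [::
  [:: (1, 0); (12, 10); (15, 13); (17, 16); (19, 18); (21, 20)];
  [:: (4, 3); (6, 5); (9, 7); (20, 18); (21, 19); (23, 22)];
  [:: (2, 1); (10, 8); (13, 11); (16, 14); (22, 19); (23, 21)];
  [:: (3, 2); (8, 6); (11, 9); (18, 16); (19, 17); (24, 23)];
  [:: (5, 3); (6, 4); (14, 11); (16, 13); (17, 15); (25, 24)];
  [:: (7, 5); (9, 6); (11, 8); (13, 10); (15, 12); (26, 25)]]%N.

(* Iterated brackets of lowering operators giving all negative root vectors of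
   E6, respectively of the folded F4. *)
Definition words6 : seq (seq nat) := [::
     [:: 0]; [:: 1]; [:: 2]; [:: 3]; [:: 4]; [:: 5]; [:: 2; 0]; [:: 3; 1];
     [:: 3; 2]; [:: 4; 3]; [:: 5; 4]; [:: 3; 2; 0]; [:: 2; 3; 1]; [:: 4; 3;
     1]; [:: 4; 3; 2]; [:: 5; 4; 3]; [:: 1; 3; 2; 0]; [:: 4; 3; 2; 0]; [::
     4; 2; 3; 1]; [:: 5; 4; 3; 1]; [:: 5; 4; 3; 2]; [:: 4; 1; 3; 2; 0]; [::
     5; 4; 3; 2; 0]; [:: 3; 4; 2; 3; 1]; [:: 5; 4; 2; 3; 1]; [:: 3; 4; 1; 3;
     2; 0]; [:: 5; 4; 1; 3; 2; 0]; [:: 5; 3; 4; 2; 3; 1]; [:: 2; 3; 4; 1; 3;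
     2; 0]; [:: 5; 3; 4; 1; 3; 2; 0]; [:: 4; 5; 3; 4; 2; 3; 1]; [:: 5; 2; 3;
     4; 1; 3; 2; 0]; [:: 4; 5; 3; 4; 1; 3; 2; 0]; [:: 4; 5; 2; 3; 4; 1; 3;
     2; 0]; [:: 3; 4; 5; 2; 3; 4; 1; 3; 2; 0]; [:: 1; 3; 4; 5; 2; 3; 4; 1;
     3; 2; 0]]%N.

Definition words4 : seq (seq nat) := [::
     [:: 0]; [:: 1]; [:: 2]; [:: 3]; [:: 1; 0]; [:: 2; 1]; [:: 3; 2]; [:: 2;
     1; 0]; [:: 2; 2; 1]; [:: 3; 2; 1]; [:: 2; 2; 1; 0]; [:: 3; 2; 1; 0];
     [:: 3; 2; 2; 1]; [:: 1; 2; 2; 1; 0]; [:: 3; 2; 2; 1; 0]; [:: 3; 3; 2;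
     2; 1]; [:: 3; 1; 2; 2; 1; 0]; [:: 3; 3; 2; 2; 1; 0]; [:: 2; 3; 1; 2; 2;
     1; 0]; [:: 3; 3; 1; 2; 2; 1; 0]; [:: 3; 2; 3; 1; 2; 2; 1; 0]; [:: 2; 3;
     2; 3; 1; 2; 2; 1; 0]; [:: 1; 2; 3; 2; 3; 1; 2; 2; 1; 0]; [:: 0; 1; 2;
     3; 2; 3; 1; 2; 2; 1; 0]]%N.

Definition sL (i : nat) : smx := [seq (p, 1) | p <- nth [::] lowering i].
Definition sE (i : nat) : smx := strn (sL i).
Definition sH (i : nat) : smx := sbr 27 (sE i) (sL i).
Definition sfold (x : nat -> smx) (i : nat) : smx :=
  nth [::] [:: x 1; x 3; x 2 ++ x 4; x 0 ++ x 5]%N i.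
Definition sE4 := sfold sE.
Definition sL4 := sfold sL.
Definition sH4 (i : nat) : smx := sbr 27 (sE4 i) (sL4 i).
Fixpoint sword (x : nat -> smx) (i : nat) (w : seq nat) : smx :=
  if w is j :: w' then sbr 27 (x i) (sword x j w') else x i.
Definition swords (x : nat -> smx) (ws : seq (seq nat)) : seq smx :=
  [seq sword x (head 0%N w) (behead w) | w <- ws].

Definition gbasis : seq smx :=
  swords sL words6 ++ [seq strn A | A <- swords sL words6] ++ [seq sH i | i <- iota 0 6].
Definition bbasis : seq smx := [seq sH4 i | i <- iota 0 4] ++ swords sL4 words4.

(* Coordinates on the span of gbasis: root vectors have disjoint supports and
   entries +1 or -1, and the coroots are separated by diagonal entries. *)
Definition gdual : seq smx := [seq take 1 A | A <- take 72 gbasis] ++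
  [:: [:: (0, 0, 1)]; [:: (0, 0, 1); (20, 20, -1)]; [:: (0, 0, 1); (1, 1, 1)];
      [:: (0, 0, 1); (1, 1, 1); (2, 2, 1)]; [:: (25, 25, -1); (26, 26, -1)];
      [:: (26, 26, -1)]].
Definition in_gspan (gb gd : seq smx) (A : smx) : bool :=
  seqm A (scomb [seq sdot 27 D A | D <- gd] gb).

(** The rows of the Cartan matrices as plain lists, so that the checks run by [vm_compute] involve
    no matrices. *)
Definition rows_E6 : seq (seq int) :=
  [:: [::  2;  0; -1;  0;  0;  0];
      [::  0;  2;  0; -1;  0;  0];
      [:: -1;  0;  2; -1;  0;  0];
      [::  0; -1; -1;  2; -1;  0];
      [::  0;  0;  0; -1;  2; -1];
      [::  0;  0;  0;  0; -1;  2]].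
Definition rows_F4 : seq (seq int) :=
  [:: [::  2; -1;  0;  0];
      [:: -1;  2; -1;  0];
      [::  0; -2;  2; -1];
      [::  0;  0; -1;  2]].

Definition check_chevalley r (rows : seq (seq int)) (e l h : nat -> smx) : bool :=
  all (fun i => seqm (l i) (strn (e i)) && all (fun j =>
    [&& seqm (sbr 27 (e i) (l j)) (if i == j then h i else [::]),
        seqm (smul 27 (h i) (h j)) (smul 27 (h j) (h i)),
        seqm (sbr 27 (h i) (e j)) (sscale (nth 0 (nth [::] rows i) j) (e j)) &
        seqm (sbr 27 (h i) (l j)) (sscale (- nth 0 (nth [::] rows i) j) (l j))])
    (iota 0 r)) (iota 0 r).

Definition check_gspan : bool :=
  let gb := gbasis in let gd := gdual in
  all (fun i => in_gspan gb gd (sE i) && in_gspan gb gd (sL i)) (iota 0 6) &&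
  all (fun A => all (fun i =>
    in_gspan gb gd (sbr 27 A (sL4 i)) && in_gspan gb gd (sbr 27 A (sH4 i)))
    (iota 0 4)) gb.

Lemma check_E6 : check_chevalley 6 rows_E6 sE sL sH.
Proof. by vm_compute. Qed.

Lemma check_F4 : check_chevalley 4 rows_F4 sE4 sL4 sH4.
Proof. by vm_compute. Qed.

Lemma check_g : check_gspan.
Proof. by vm_compute. Qed.

(* The three models: columns (as 27 x 27 matrices), endomorphisms, and tensors
   in C^27 (x) C^27, according to the right action being 0, - A or A^T. *)
Inductive model := Columns | Endomorphisms | Tensors.

Definition smodel (m : model) (A X : smx) : smx := smul 27 A X ++
  match m with
  | Columns => [::]
  | Endomorphisms => sscale (-1) (smul 27 X A)
  | Tensors => smul 27 X (strn A)
  end.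

(* Data for the fundamental weight cd_weight: the highest weight vector u, the
   lowering steps u |-> u + Y u leading to w = y_1 + ... + y_r, the singular
   vectors x_i and the vectors y_i of F4-weights nu_i, and, for each element A
   of gbasis, the coefficients of 4 A w in terms of bbasis w (positions 0 to 27)
   and w (position 28). *)
Record case_data := CaseData {
  cd_model : model;
  cd_weight : nat;
  cd_u : smx;
  cd_steps : seq (seq nat);
  cd_x : seq smx;
  cd_y : seq smx;
  cd_nu : seq (seq int);
  cd_cert : seq (seq (nat * int))
}.

Section Case.
Variable d : case_data.
Let act := smodel (cd_model d).

Definition cd_step (u : smx) (st : seq nat) : smx :=
  snorm (u ++ act (sword sL (head 0%N st) (behead st)) u).

Definition cd_w : smx := foldl cd_step (cd_u d) (cd_steps d).

Fixpoint check_steps (u : smx) (steps : seq (seq nat)) : bool :=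
  if steps is st :: steps' then
    let Y := sword sL (head 0%N st) (behead st) in
    seqm (act Y (act Y u)) [::] && check_steps (cd_step u st) steps'
  else true.

Definition check_vectors : bool := let w := cd_w in
  [&& sdot 27 (cd_u d) (cd_u d) != 0,
      all (fun i => seqm (act (sE i) (cd_u d)) [::] &&
        seqm (act (sH i) (cd_u d)) (sscale (i.+1 == cd_weight d)%:R (cd_u d))) (iota 0 6),
      check_steps (cd_u d) (cd_steps d),
      seqm w (flatten (cd_y d)) &
      all (fun i => let x := nth [::] (cd_x d) i in let y := nth [::] (cd_y d) i in
        (sdot 27 x w != 0) && all (fun j => let n := nth 0 (nth [::] (cd_nu d) i) j in
          [&& seqm (act (sE4 j) x) [::], seqm (act (sH4 j) x) (sscale n x) &
              seqm (act (sH4 j) y) (sscale n y)]) (iota 0 4))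
        (iota 0 (size (cd_y d)))].

(** The factor 4 clears denominators: a word of [words4] in which a letter 2 or 3 is repeated can
    give 2 or 4 times a primitive integral root vector. *)
Definition check_cert : bool := let w := cd_w in
  let v := [seq act B w | B <- bbasis] ++ [:: w] in
  all (fun p => all (fun q => q.1 < 29)%N p.2 &&
    seqm (sscale 4 (act p.1 w)) (flatten [seq sscale q.2 (nth [::] v q.1) | q <- p.2]))
    (zip gbasis (cd_cert d)) && (size (cd_cert d) == 78)%N.

Definition check_case : bool := check_vectors && check_cert.
End Case.

(** 27 = 26 + 1. The lowering step sends e_0, of F4-weight lambda_4, to e_14, of weight 0; the
    second x_i spans the invariants of F4. *)
Definition case_omega1 : case_data := CaseData Columns 1
  [:: (0, 0, 1)]
  [:: [:: 4; 5; 3; 4; 1; 3; 2; 0]]%N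
  [:: [:: (0, 0, 1)];
      [:: (14, 0, 1); (13, 0, -1); (12, 0, 1)]]
  [:: [:: (0, 0, 1)];
      [:: (14, 0, 1)]]
  [:: [:: 0; 0; 0; 1]; [:: 0; 0; 0; 0]]
  [::
     [:: (7, 4)]; [::]; [:: (6, 4)]; [::]; [::]; [::]; [:: (10, -4)]; [::];
     [:: (9, -4)]; [::]; [::]; [:: (13, 4)]; [:: (11, 4)]; [::]; [::]; [::];
     [:: (15, -4)]; [:: (16, 2)]; [::]; [::]; [::]; [:: (18, -2)]; [:: (19,
     1)]; [::]; [::]; [:: (20, -2)]; [:: (21, -1)]; [::]; [:: (22, -2)]; [::
     (23, -1)]; [::]; [:: (3, 4); (24, -2); (28, -4)]; [:: (3, -4); (28,
     4)]; [:: (6, 4)]; [:: (9, -4)]; [:: (11, 4)]; [::]; [::]; [::]; [::];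
     [:: (23, -1)]; [::]; [::]; [::]; [::]; [:: (21, -1)]; [:: (20, 2)];
     [::]; [::]; [:: (19, 1)]; [::]; [:: (18, 2)]; [::]; [::]; [::]; [::
     (16, -2)]; [::]; [::]; [::]; [::]; [::]; [::]; [::]; [::]; [::]; [::];
     [:: (7, 4)]; [::]; [:: (3, 4)]; [::]; [::]; [::]; [:: (3, 4)]; [::];
     [:: (3, -4); (28, 4)]; [::]; [:: (3, 4); (28, -4)]; [::]].

Lemma check_omega1 : check_case case_omega1.
Proof. by vm_compute. Qed.

(** The adjoint module 78 = 52 + 26 inside the endomorphisms of C^27, with u a highest root vector.
    The second y_i is a root vector of E6 that is not singular for F4; adding a further root vector
    to it gives the singular x_i. *)
Definition case_omega2 : case_data := CaseData Endomorphisms 2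
  [:: (0, 20, 1); (1, 21, 1); (2, 23, 1); (3, 24, 1); (5, 25, 1); (7, 26, 1)]
  [:: [:: 4; 3; 1]]%N
  [:: [:: (0, 20, 1); (1, 21, 1); (2, 23, 1); (3, 24, 1); (5, 25, 1); (7, 26, 1)];
      [:: (0, 14, 1); (2, 17, -1); (10, 25, -1); (13, 26, -1); (3, 19, -1); (4, 21, -1);
          (0, 13, -1); (1, 15, -1); (14, 26, 1);
          (5, 22, -1); (6, 23, -1); (8, 24, -1)]]
  [:: [:: (0, 20, 1); (1, 21, 1); (2, 23, 1); (3, 24, 1); (5, 25, 1); (7, 26, 1)];
      [:: (0, 13, -1); (1, 15, -1); (5, 22, -1); (6, 23, -1); (8, 24, -1); (14, 26, 1)]]
  [:: [:: 1; 0; 0; 0]; [:: 0; 0; 0; 1]]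
  [::
     [::]; [:: (4, 4)]; [:: (6, 4)]; [::]; [::]; [:: (7, 4)]; [:: (10, -4)];
     [:: (8, 4)]; [:: (9, -4)]; [::]; [::]; [:: (13, 4)]; [:: (3, -4); (11,
     4)]; [:: (3, 4)]; [::]; [::]; [:: (7, 4); (15, -4)]; [::]; [:: (6, 4)];
     [:: (7, 4)]; [:: (16, -2)]; [:: (10, -4)]; [:: (19, 1)]; [:: (9, -4)];
     [:: (10, -4); (18, 2)]; [:: (13, 4)]; [:: (21, -1)]; [:: (13, 4); (20,
     2)]; [:: (16, 2); (22, -2)]; [:: (23, -1)]; [:: (16, 2)]; [:: (19, 1);
     (24, -2)]; [:: (19, -1)]; [:: (25, -1)]; [:: (26, -1)]; [:: (27, -1)];
     [::]; [::]; [::]; [::]; [:: (8, 4)]; [::]; [::]; [::]; [::]; [:: (4,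
     4)]; [::]; [::]; [::]; [:: (0, 4)]; [::]; [::]; [::]; [::]; [::]; [::];
     [::]; [::]; [::]; [::]; [::]; [::]; [::]; [::]; [::]; [::]; [::]; [::];
     [::]; [::]; [::]; [::]; [::]; [:: (0, 4)]; [:: (3, 4)]; [::]; [:: (3,
     -4)]; [:: (3, 4)]].

Lemma check_omega2 : check_case case_omega2.
Proof. by vm_compute. Qed.

(** The exterior square of C^27 as skew-symmetric tensors, 351 = 52 + 273 + 26. Here u = e_0 ^ e_1
    and w = e_0 ^ (e_1 + e_7 + e_14). *)
Definition case_omega3 : case_data := CaseData Tensors 3
  [:: (0, 1, 1); (1, 0, -1)]
  [:: [:: 5; 4; 3; 2]; [:: 4; 5; 3; 4; 2; 3; 1]]%N
  [:: [:: (7, 0, 1); (0, 7, -1); (5, 1, -1); (1, 5, 1); (3, 2, 1); (2, 3, -1)];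
      [:: (1, 0, 1); (0, 1, -1)];
      [:: (14, 0, 1); (0, 14, -1); (13, 0, -1); (0, 13, 1); (12, 0, 1); (0, 12, -1)]]
  [:: [:: (0, 7, 1); (7, 0, -1)];
      [:: (0, 1, 1); (1, 0, -1)];
      [:: (0, 14, 1); (14, 0, -1)]]
  [:: [:: 1; 0; 0; 0]; [:: 0; 0; 1; 0]; [:: 0; 0; 0; 1]]
  [::
     [:: (7, 4)]; [:: (4, 4)]; [:: (6, 4)]; [::]; [::]; [::]; [:: (10, -4)];
     [:: (8, 4)]; [:: (9, -4)]; [::]; [::]; [:: (13, 4)]; [:: (3, -4); (11,
     4)]; [:: (3, 4)]; [:: (12, -2)]; [::]; [:: (15, -4)]; [:: (0, 4); (16,
     2)]; [:: (14, 2)]; [::]; [:: (0, 4)]; [:: (4, 4); (18, -2)]; [:: (19,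
     1)]; [:: (17, 2)]; [:: (4, 4)]; [:: (8, 4); (20, -2)]; [:: (21, -1)];
     [:: (8, 4)]; [:: (3, 4); (22, -2)]; [:: (23, -1)]; [:: (3, 4)]; [:: (7,
     4); (19, 1); (24, -2)]; [:: (7, -4); (19, -1)]; [:: (25, -1)]; [:: (26,
     -1)]; [:: (27, -1)]; [::]; [::]; [::]; [::]; [:: (8, 4)]; [:: (12,
     -2)]; [::]; [::]; [::]; [:: (4, 4)]; [:: (9, -4); (17, -2)]; [::];
     [::]; [:: (0, 4)]; [::]; [:: (6, 4); (14, -2)]; [::]; [::]; [::]; [::
     (12, 2)]; [:: (2, 4)]; [::]; [::]; [::]; [::]; [::]; [::]; [::]; [::];
     [::]; [:: (2, 4)]; [::]; [::]; [::]; [::]; [::]; [:: (0, 4); (3, 4)];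
     [:: (0, 4)]; [:: (2, 4); (3, 4)]; [::]; [:: (3, -4)]; [:: (0, -4)]].

Lemma check_omega3 : check_case case_omega3.
Proof. by vm_compute. Qed.

(** * Soundness of the computations *)

Section Soundness.
Context {F : numClosedFieldType}.
Local Notation zm := (@zm F 27).

Definition ract (m : model) (A : 'M[F]_27) : 'M[F]_27 :=
  match m with Columns => 0 | Endomorphisms => - A | Tensors => A^T end.

Lemma ract_linear m : linear (ract m).
Proof.
case: m => a A B /=; first by rewrite scaler0 addr0.
  by rewrite opprD scalerN.
by rewrite linearP.
Qed.

Lemma ract_bracket m A B :
  ract m (A *m B - B *m A) = ract m B *m ract m A - ract m A *m ract m B.
Proof.
case: m => /=; first by rewrite !mul0mx subrr.
  by rewrite !mulNmx !mulmxN !opprK opprB.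
by rewrite linearB /= !trmx_mul.
Qed.

Lemma ract_adj m (A B : 'M[F]_27) : (forall i j, B i j = (A j i)^*) ->
  forall i j, ract m B i j = (ract m A j i)^*.
Proof. by case: m => AB i j /=; rewrite !mxE ?AB ?rmorph0 ?rmorphN. Qed.

Lemma zm_act m A X : zm (smodel m A X) = lract (ract m) (zm A) (zm X).
Proof.
rewrite zm_cat zm_mul /lract; congr (_ + _).
by case: m; rewrite ?zm_nil ?zm_scale ?zm_mul ?zm_tr /= ?mulmx0 // rmorphN1 scaleN1r mulmxN.
Qed.

Lemma zm_fold (x : nat -> smx) i :
  fold (fun j : 'I_6 => zm (x j)) i = zm (sfold x i).
Proof.
by case: i => [[|[|[|[|m]]]] mi] //; rewrite /fold /sfold /= ?zm_cat !inordK.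
Qed.

Lemma check_chevalley_sound r (A : 'M[int]_r) rows e l h :
  check_chevalley r rows e l h ->
  (forall i j, A i j = nth 0 (nth [::] rows i) j) ->
  chevalley_matrices A (fun i : 'I_r => zm (e i)) (fun i => zm (l i))
    (fun i => zm (h i)).
Proof.
move=> /allP chk Arows.
have mi (i : 'I_r) : (i : nat) \in iota 0 r by rewrite mem_iota /=.
have ij (i j : 'I_r) : [&& seqm (sbr 27 (e i) (l j)) (if i == j then h i else [::]),
        seqm (smul 27 (h i) (h j)) (smul 27 (h j) (h i)),
        seqm (sbr 27 (h i) (e j)) (sscale (A i j) (e j)) &
        seqm (sbr 27 (h i) (l j)) (sscale (- A i j) (l j))].
  have /andP[_ /allP/(_ j (mi j))] := chk i (mi i).
  by rewrite !Arows.
split=> i j.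
- have /and4P[/(@seqm_zm F 27) p _ _ _] := ij i j.
  by rewrite -zm_br p; case: eqP; rewrite ?zm_nil.
- have /and4P[_ /(@seqm_zm F 27) p _ _] := ij i j.
  by rewrite -!zm_mul.
- have /and4P[_ _ /(@seqm_zm F 27) p _] := ij i j.
  by rewrite -zm_br p zm_scale.
- have /and4P[_ _ _ /(@seqm_zm F 27) p] := ij i j.
  by rewrite -zm_br p zm_scale rmorphN.
- move=> b; have /andP[/(@seqm_zm F 27) p _] := chk i (mi i).
  by rewrite p zm_tr mxE zm_conj.
Qed.

Lemma chevalley_E6 : chevalley_matrices cartan_E6 (fun i : 'I_6 => zm (sE i))
  (fun i => zm (sL i)) (fun i => zm (sH i)).
Proof. by apply: (check_chevalley_sound check_E6) => i j; rewrite mxE. Qed.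

Lemma chevalley_F4 : chevalley_matrices cartan_F4 (fold (fun i : 'I_6 => zm (sE i)))
  (fold (fun i : 'I_6 => zm (sL i))) (fun i => zm (sH4 i)).
Proof.
have [] := check_chevalley_sound check_F4 (A := cartan_F4) (fun i j => mxE _ _ _ _).
by move=> *; split=> *; rewrite ?zm_fold.
Qed.

Definition gspan (A : 'M[F]_27) : Prop := exists c : 'I_78 -> F,
  A = \sum_i c i *: zm (nth [::] gbasis i).

Lemma gspan_linear a A B : gspan A -> gspan B -> gspan (a *: A + B).
Proof.
move=> [c ->] [c' ->]; exists (fun i => a * c i + c' i).
rewrite scaler_sumr -big_split; apply: eq_bigr => i _.
by rewrite scalerDl scalerA.
Qed.

Lemma size_gbasis : size gbasis = 78%N. Proof. by []. Qed.

Lemma in_gspan_sound A : in_gspan gbasis gdual A -> gspan (zm A).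
Proof.
move=> /(@seqm_zm F 27) ->; rewrite zm_comb size_gbasis.
by exists (fun i => (nth 0 [seq sdot 27 D A | D <- gdual] i)%:~R).
Qed.

Lemma gspan_EL (i : 'I_6) : gspan (zm (sE i)) /\ gspan (zm (sL i)).
Proof.
have /andP[/allP/(_ i) + _] := check_g; rewrite mem_iota ltn_ord => /(_ isT).
by case/andP => *; split; apply: in_gspan_sound.
Qed.

Lemma gspan_bracket A (i : 'I_4) : gspan A ->
  gspan (A *m fold (fun j : 'I_6 => zm (sL j)) i - fold (fun j : 'I_6 => zm (sL j)) i *m A) /\
  gspan (A *m zm (sH4 i) - zm (sH4 i) *m A).
Proof.
rewrite zm_fold.
have gsum (c : 'I_78 -> F) (M : 'I_78 -> 'M[F]_27) : (forall l, gspan (M l)) ->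
    gspan (\sum_l c l *: M l).
  move=> gM; apply: big_ind => [|B B' gB gB'|l _].
  - by exists (fun=> 0); rewrite big1 // => l _; rewrite scale0r.
  - by rewrite -[B]scale1r; apply: gspan_linear.
  - rewrite -[_ *: _]addr0; apply: gspan_linear => //.
    by exists (fun=> 0); rewrite big1 // => l' _; rewrite scale0r.
have brE (c : 'I_78 -> F) (M : 'I_78 -> 'M[F]_27) B :
    (\sum_l c l *: M l) *m B - B *m (\sum_l c l *: M l) =
    \sum_l c l *: (M l *m B - B *m M l).
  rewrite mulmx_suml mulmx_sumr -sumrB; apply: eq_bigr => l _.
  by rewrite -scalemxAl -scalemxAr scalerBr.
move=> [c ->]; rewrite !brE.
suff H (l : 'I_78) : gspan (zm (sbr 27 (nth [::] gbasis l) (sL4 i))) /\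
    gspan (zm (sbr 27 (nth [::] gbasis l) (sH4 i))).
  by split; apply: gsum => l; case: (H l); rewrite !zm_br.
have /andP[_ /allP/(_ (nth [::] gbasis l))] := check_g.
rewrite mem_nth ?size_gbasis // => /(_ isT) /allP/(_ i).
rewrite mem_iota ltn_ord => /(_ isT) /andP[*]; split; exact: in_gspan_sound.
Qed.

Lemma zm_sword_ind (P : 'M[F]_27 -> Prop) (x : nat -> smx) :
  (forall i, P (zm (x i))) -> (forall A B, P A -> P B -> P (A *m B - B *m A)) ->
  forall i w, P (zm (sword x i w)).
Proof.
move=> Px Pbr i w; elim: w i => [|j w IH] i; first exact: Px.
by rewrite [sword _ _ _]/= zm_br; apply: Pbr.
Qed.

(* The coordinates of the half-sums of the positive coroots. *)
Lemma grading_E6 j : \sum_(i < 6) (nth 0 [:: 8; 11; 15; 21; 15; 8] i : int)%:~R *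
  (cartan_E6 i j)%:~R = 1 :> F.
Proof.
under eq_bigr do rewrite mxE -intrM.
rewrite -rmorph_sum !big_ord_recl big_ord0 /=.
by case: j => [[|[|[|[|[|[|j]]]]]] //= _].
Qed.

Lemma grading_F4 j : \sum_(i < 4) (nth 0 [:: 11; 21; 15; 8] i : int)%:~R *
  (cartan_F4 i j)%:~R = 1 :> F.
Proof.
under eq_bigr do rewrite mxE -intrM.
rewrite -rmorph_sum !big_ord_recl big_ord0 /=.
by case: j => [[|[|[|[|j]]]] //= _].
Qed.

Section OneCase.
Context {d : case_data}.
Hypothesis chk : check_case d.
Local Notation s := (ract (cd_model d)).
Let w := zm (cd_w d).

Lemma case_reach k (M : {vspace @tpower F 27 k}) :
  (forall (i : 'I_6) t, t \in M -> tact s (zm (sL i)) t \in M) ->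
  tprod (fun=> zm (cd_u d)) k \in M -> tprod (fun=> w) k \in M.
Proof.
move=> LM; have /andP[/and5P[_ _ + _ _] _] := chk.
rewrite /w /cd_w; elim: (cd_steps d) (cd_u d) => //= st steps IH u /andP[Yu2 chk'] uM.
apply: IH => //; rewrite zm_norm zm_cat zm_act.
apply: tprod_shear => //.
  (* Words are over all natural numbers; a letter from 6 on denotes the zero matrix. *)
  have LM' i t : t \in M -> tact s (zm (sL i)) t \in M.
    have [i6|i6] := ltnP i 6; first exact: (LM (Ordinal i6)).
    rewrite /sL nth_default // zm_nil => _.
    have := tact_linearA (ract_linear (cd_model d)) (-1) 0 0 t.
    by rewrite scaler0 addr0 scaleN1r addNr => ->; apply: mem0v.
  apply: (zm_sword_ind (P := fun A => forall t, t \in M -> tact s A t \in M)).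
    by move=> i t; apply: LM'.
  move=> A B AM BM t tM; rewrite (tact_bracket (ract_bracket _)).
  by apply: memvB; [apply: AM; apply: BM | apply: BM; apply: AM].
by rewrite -!zm_act; have := @seqm_zm F 27 _ _ Yu2; rewrite zm_nil.
Qed.

Lemma case_cyclic A : gspan A -> exists B c,
  lie_generated (fun B => exists i, B = fold (fun j : 'I_6 => zm (sL j)) i \/
    B = zm (sH4 i)) B /\
  lract s A w = lract s B w + c *: w.
Proof.
set P := fun B : 'M[F]_27 => exists i : 'I_4, _ \/ B = zm (sH4 i).
have PH i : (i < 4)%N -> P (zm (sH4 i)).
  by move=> i4; exists (Ordinal i4); right.
(* For i out of range the matrix is 0, which [lie_generated] only yields as a combination of
   generators. *)
have PL i : lie_generated P (zm (sL4 i)).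
  have [i4|i4] := ltnP i 4; first by apply: LieGen; exists (Ordinal i4); left; rewrite zm_fold.
  rewrite /sL4 /sfold nth_default // zm_nil -[0](addNr (zm (sH4 0))) -scaleN1r.
  by apply: LieLin; apply: LieGen; apply: PH.
have Pb i : (i < 28)%N -> lie_generated P (zm (nth [::] bbasis i)).
  move=> i28; rewrite nth_cat size_map size_iota; case: ltnP => i4.
    by rewrite (nth_map 0%N) ?size_iota // nth_iota //; apply: LieGen; apply: PH.
  rewrite (nth_map [::]); last by rewrite ltn_subLR.
  by apply: zm_sword_ind => // B B' PB PB'; apply: LieBracket.
pose gw X := exists B c, lie_generated P B /\ X = lract s B w + c *: w.
have gw_lin a X Y : gw X -> gw Y -> gw (a *: X + Y).
  move=> [C [c [PC ->]]] [C' [c' [PC' ->]]].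
  exists (a *: C + C'), (a * c + c'); split; first exact: LieLin.
  rewrite lract_linearA; last exact: ract_linear.
  by rewrite scalerDr scalerDl scalerA addrACA.
have l0 : lie_generated P 0.
  rewrite -[0](addNr (zm (sH4 0))) -scaleN1r.
  by apply: LieLin; apply: LieGen; apply: PH.
have s0 : lract s 0 w = 0.
  have := lract_linearA (ract_linear (cd_model d)) (-1) 0 0 w.
  by rewrite scaler0 addr0 scaleN1r addNr.
have gw0 : gw 0 by exists 0, 0; rewrite s0 scale0r addr0.
pose vs := [seq smodel (cd_model d) B (cd_w d) | B <- bbasis] ++ [:: cd_w d].
have gw_vs q : (q < 29)%N -> gw (zm (nth [::] vs q)).
  move=> q29; rewrite nth_cat size_map; case: ltnP => q28.
    rewrite (nth_map [::]) // zm_act; exists (zm (nth [::] bbasis q)), 0.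
    by rewrite scale0r addr0; split=> //; apply: Pb.
  exists 0, 1; split=> //; rewrite s0 add0r scale1r.
  by have -> : q = 28%N by apply/eqP; rewrite eqn_leq -ltnS q29.
have gwb (l : 'I_78) : gw (lract s (zm (nth [::] gbasis l)) w).
  have /andP[_ /andP[/allP/(_ (nth [::] gbasis l, nth [::] (cd_cert d) l)) + /eqP sc]] := chk.
  rewrite -nth_zip ?size_gbasis ?sc // mem_nth ?size_zip ?size_gbasis ?sc // => /(_ isT).
  rewrite nth_zip ?size_gbasis ?sc // => /andP[/allP q29 /(@seqm_zm F 27)].
  rewrite zm_scale zm_act -/w -/vs => e4.
  have n4 : 4%:~R != 0 :> F by rewrite intr_eq0.
  rewrite -[lract _ _ _](scalerK n4) e4 -[_ *: _]addr0; apply: (gw_lin) => //.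
  move: vs gw_vs {e4} => vs gw_vs.
  elim: (nth _ (cd_cert d) l) q29 => [|q c IH] q29; first by rewrite zm_nil.
  rewrite /= zm_cat zm_scale; apply: (gw_lin); first by apply/gw_vs/q29/mem_head.
  by apply: IH => p pc; apply: q29; rewrite inE pc orbT.
move=> [c ->].
suff [B [c' [PB ->]]] : gw (lract s (\sum_i c i *: zm (nth [::] gbasis i)) w).
  by exists B, c'.
elim/big_rec: _ => [|i X _ gX]; first by rewrite s0.
by rewrite lract_linearA; [apply: (gw_lin) | apply: ract_linear].
Qed.

Let r := (size (cd_y d)).-1.

Lemma case_decomposition (k : nat) (I : finType) (nuI : I -> 'I_4 -> int)
    (V : vectType F) (e f h : 'I_6 -> 'End(V)) (v : V) :
  (forall a b, nuI a =1 nuI b -> a = b) ->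
  (forall a, exists us : nat -> 'I_r.+1,
    forall j : 'I_4, nuI a j = \sum_(i < k) nth 0 (nth [::] (cd_nu d) (us i)) j) ->
  (forall us : nat -> 'I_r.+1, exists a,
    forall j : 'I_4, nuI a j = \sum_(i < k) nth 0 (nth [::] (cd_nu d) (us i)) j) ->
  (0 < size (cd_y d))%N ->
  chevalley_action cartan_E6 e f h ->
  (forall U : {vspace V}, (forall i z, z \in U -> e i z \in U) ->
    (forall i z, z \in U -> f i z \in U) -> U = 0%VS \/ U = fullv) ->
  v != 0 -> (forall i, e i v = 0) ->
  (forall i : 'I_6, h i v = ((i.+1 == cd_weight d)%:R *+ k)%:~R *: v) ->
  exists (W : I -> {vspace V}) (z : I -> V),
  [/\ forall a, [/\ z a \in W a, z a != 0, forall i, fold e i (z a) = 0 &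
        forall i, fold e i (fold f i (z a)) = (nuI a i)%:~R *: z a],
      forall a i t, t \in W a -> fold e i t \in W a /\ fold f i t \in W a,
      forall a (U : {vspace V}), (U <= W a)%VS ->
        (forall i t, t \in U -> fold e i t \in U) ->
        (forall i t, t \in U -> fold f i t \in U) -> U = 0%VS \/ U = W a,
      (\sum_a W a)%VS = fullv &
      forall t : I -> V, (forall a, t a \in W a) -> \sum_a t a = 0 ->
        forall a, t a = 0].
Proof.
move=> nu_inj nu_low nu_up y0 rel irrV v0 ev hv.
have /andP[/and5P[uu /allP uh _ wy /allP xy] _] := chk.
have dot0 A B : sdot 27 A B != 0 -> mxip (zm A) (zm B) != 0.
  by rewrite zm_dot intr_eq0.
have yi (i : 'I_r.+1) : (i : nat) \in iota 0 (size (cd_y d)).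
  by rewrite mem_iota /= add0n -[size _]prednK.
have seq0 A : seqm A [::] -> zm A = 0 by move/(@seqm_zm F 27); rewrite zm_nil.
have mi m (i : 'I_m) : (i : nat) \in iota 0 m by rewrite mem_iota /=.
have rel4 := chevalley_F4; have rel6 := chevalley_E6.
have xyP (i : 'I_r.+1) := xy _ (yi i).
have xyP' (i : 'I_r.+1) (j : 'I_4) := allP (andP (xyP i)).2 j (mi 4 j).
apply: (model_decomposition (@ract_linear (cd_model d)) (@ract_bracket (cd_model d))
  (@ract_adj (cd_model d)) grading_E6 grading_F4 rel6 rel4 (g := gspan)
  (m6 := fun i => (i.+1 == cd_weight d)%:R) (u := zm (cd_u d)) (w := w)
  (x := fun i : 'I_r.+1 => zm (nth [::] (cd_x d) i))
  (y := fun i : 'I_r.+1 => zm (nth [::] (cd_y d) i))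
  (nu := fun (i : 'I_r.+1) (j : 'I_4) => nth 0 (nth [::] (cd_nu d) i) j)
  _ _ _ _ _ _ _ _ _ _ _ _ _ nu_inj nu_low nu_up rel irrV v0 ev hv).
- by move=> i; case: (gspan_EL i).
- by move=> i; case: (gspan_EL i).
- by move=> A i; apply: gspan_bracket.
- apply: contraNneq (dot0 _ _ uu) => ->; rewrite /mxip big1 // => p _.
  by rewrite mxE mulr0.
- by move=> i; have /andP[/seq0 + _] := uh i (mi 6 i); rewrite zm_act.
- move=> i; have /andP[_ /(@seqm_zm F 27)] := uh i (mi 6 i).
  by rewrite zm_act zm_scale.
- exact: case_reach.
- have /(@seqm_zm F 27) := wy; rewrite -/w => ->.
  rewrite -(big_mkord xpredT (fun i => zm (nth [::] (cd_y d) i))) prednK //.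
  elim: (cd_y d) => [|A l IH]; first by rewrite big_geq // zm_nil.
  by rewrite /= big_nat_recl // zm_cat IH.
- by move=> i j; have /and3P[_ _ /(@seqm_zm F 27)] := xyP' i j; rewrite zm_act zm_scale.
- by move=> i j; have /and3P[/seq0 + _ _] := xyP' i j; rewrite zm_act zm_fold.
- by move=> i j; have /and3P[_ /(@seqm_zm F 27) + _] := xyP' i j; rewrite zm_act zm_scale.
- by move=> i; apply: dot0; case/andP: (xyP i).
- exact: case_cyclic.
Qed.
End OneCase.
End Soundness.

(** * Hilbert's basis theorem and Krull's intersection theorem *)

Section Noetherian.

Inductive ideal_gen (R : comNzRingType) (P : R -> Prop) : R -> Prop :=
  | ideal_gen0 : ideal_gen P 0
  | ideal_genD a x y : P x -> ideal_gen P y -> ideal_gen P (a * x + y).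

Lemma ideal_gen_in (R : comNzRingType) (P : R -> Prop) x : P x -> ideal_gen P x.
Proof. by move=> Px; rewrite -[x]mul1r -[_ * _]addr0; apply: ideal_genD => //; left. Qed.

Lemma ideal_gen_linear (R : comNzRingType) (P : R -> Prop) a x y :
  ideal_gen P x -> ideal_gen P y -> ideal_gen P (a * x + y).
Proof.
move=> Px Py; elim: Px => [|b x' z Px' _ IH]; first by rewrite mulr0 add0r.
by rewrite mulrDr mulrA -addrA; apply: ideal_genD.
Qed.

Lemma ideal_gen_trans (R : comNzRingType) (P Q : R -> Prop) x :
  (forall y, P y -> ideal_gen Q y) -> ideal_gen P x -> ideal_gen Q x.
Proof.
move=> PQ; elim=> [|a y z /PQ Qy _ Qz]; first by left.
exact: ideal_gen_linear.
Qed.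

Definition before (R : Type) (a : nat -> R) n x := exists2 i, (i < n)%N & x = a i.

(** The ascending chain condition in sequential form, which speaks of elements rather than of
    ideals. *)
Definition noetherian (R : comNzRingType) : Prop :=
  forall a : nat -> R, exists n, ideal_gen (before a n) (a n).

Lemma noetherian_field (F : fieldType) : noetherian F.
Proof.
move=> a; have [a0|a0] := eqVneq (a 0%N) 0.
  by exists 0%N; rewrite a0; left.
exists 1%N; rewrite -[a 1%N](divfK a0) -[_ * _]addr0.
by apply: ideal_genD; [exists 0%N | left].
Qed.

Lemma noetherian_image (R S : comNzRingType) (phi : R -> S) :
  {morph phi : x y / x + y} -> {morph phi : x y / x * y} ->
  (forall y, exists x, phi x = y) -> noetherian R -> noetherian S.
Proof.
move=> phiD phiM surj noR b.
have [a aE] : exists a : nat -> R, forall n, phi (a n) = b n.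
  exact: functional_choice (fun n => surj (b n)).
have phi0 : phi 0 = 0 by apply: (addIr (phi 0)); rewrite -phiD !add0r.
have [n an] := noR a; exists n; rewrite -aE.
elim: an => [|c _ y [i i_n ->] _ IH]; first by rewrite phi0; left.
by rewrite phiD phiM; apply: ideal_genD => //; exists i; rewrite ?aE.
Qed.

(* Hilbert's basis theorem, choosing successively polynomials of minimal size
   outside of the ideal generated by the previous ones. *)
Lemma noetherian_poly (R : comNzRingType) : noetherian R -> noetherian {poly R}.
Proof.
move=> noR f; apply: NNPP => nf.
have fN n : ~ ideal_gen (before f n) (f n) by move=> fn; apply: nf; exists n.
(* The ideal of all terms of a sequence f violating the claim. A finite list s of its elements lies
   in the ideal of finitely many terms, so s does not generate I, and a polynomial of minimal size
   can be chosen outside of the ideal of s. *)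
pose I x := exists n, ideal_gen (before f n) x.
have before_le n m x : (n <= m)%N -> ideal_gen (before f n) x -> ideal_gen (before f m) x.
  move=> nm; apply: ideal_gen_trans => y [i i_n ->]; apply: ideal_gen_in.
  by exists i => //; apply: leq_trans nm.
have I_lin a x y : I x -> I y -> I (a * x + y).
  move=> [n xn] [m ym]; exists (maxn n m).
  by apply: ideal_gen_linear; [apply: before_le xn | apply: before_le ym];
    rewrite ?leq_maxl ?leq_maxr.
have out (s : seq {poly R}) : exists x, (forall y, y \in s -> I y) ->
    [/\ I x, ~ ideal_gen (fun y => y \in s) x &
        forall z, I z -> ~ ideal_gen (fun y => y \in s) z -> (size x <= size z)%N].
  case: (classic (forall y, y \in s -> I y)) => [sI|]; last by exists 0.
  have [m sm] : exists m, forall y, y \in s -> ideal_gen (before f m) y.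
    elim: s sI => [|y s IH] sI; first by exists 0%N.
    have [m sm] := IH (fun z zs => sI z (mem_behead (s := y :: s) zs)).
    have [n yn] := sI y (mem_head _ _).
    exists (maxn n m) => z; rewrite inE => /orP[/eqP ->|zs].
      by apply: before_le yn; apply: leq_maxl.
    by apply: before_le (sm z zs); apply: leq_maxr.
  have ex : exists x, I x /\ ~ ideal_gen (fun y => y \in s) x.
    exists (f m); split; last by move/(ideal_gen_trans sm); apply: fN.
    by exists m.+1; apply: ideal_gen_in; exists m.
  have [d [[x [Ix sx] dx] dmin]] : exists d, (exists2 x,
      I x /\ ~ ideal_gen (fun y => y \in s) x & size x = d) /\
      forall z, I z -> ~ ideal_gen (fun y => y \in s) z -> (d <= size z)%N.
    case: ex => x0 [Ix0 sx0]; move: {2}(size x0).+1 (ltnSn (size x0)) => N.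
    elim: N x0 Ix0 sx0 => // N IH x0 Ix0 sx0 xN.
    case: (classic (forall z, I z -> ~ ideal_gen (fun y => y \in s) z ->
             (size x0 <= size z)%N)) => [xmin|].
      by exists (size x0); split=> //; exists x0.
    move=> nmin; apply: NNPP => nd; apply: nmin => z Iz sz; rewrite leqNgt.
    by apply/negP => zx; apply: nd; apply: (IH z) => //; apply: leq_trans zx _.
  by exists x => _; split=> // z Iz sz; rewrite dx; apply: dmin.
have [next nextP] := functional_choice _ out.
pose s := fix s n := if n is m.+1 then rcons (s m) (next (s m)) else [::].
pose g n := next (s n).
have sI n : forall y, y \in s n -> I y.
  elim: n => [//|n IH] y /=; rewrite mem_rcons inE => /orP[/eqP ->|/IH//].
  by have [] := nextP _ IH.
have sE n y : y \in s n <-> before g n y.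
  elim: n y => [|n IH] y /=; first by split=> // -[].
  rewrite mem_rcons inE; split.
    by case/orP=> [/eqP ->|/IH[i i_n ->]]; [exists n | exists i => //; apply: ltnW].
  case=> i; rewrite ltnS leq_eqVlt => /orP[/eqP ->|i_n] ->; first by rewrite eqxx.
  by apply/orP; right; apply/IH; exists i.
have gI n : I (g n) by have [] := nextP _ (sI n).
have gN n : ~ ideal_gen (before g n) (g n).
  have [_ nin _] := nextP _ (sI n); move=> gn; apply: nin.
  by apply: ideal_gen_trans gn => y /sE ?; apply: ideal_gen_in.
have gmin n z : I z -> ~ ideal_gen (before g n) z -> (size (g n) <= size z)%N.
  have [_ _ mn] := nextP _ (sI n); move=> Iz nz; apply: mn => // zs; apply: nz.
  by apply: ideal_gen_trans zs => y /sE ?; apply: ideal_gen_in.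
have gsz n m : (n <= m)%N -> (size (g n) <= size (g m))%N.
  move=> nm; apply: gmin => // gm; apply: (gN m); apply: ideal_gen_trans gm.
  move=> y [i i_n ->]; apply: ideal_gen_in; exists i => //; exact: leq_trans nm.
(* As the sizes do not decrease, powers of X turn a relation between leading coefficients into an h
   in the ideal of the earlier g_i with the same leading term as g_N. Then g_N - h is too small for
   the minimality of g_N. *)
have [N aN] := noR (fun n => lead_coef (g n)).
have [h [hg hs hN]] : exists h, [/\ ideal_gen (before g N) h,
    (size h <= size (g N))%N & h`_(size (g N)).-1 = lead_coef (g N)].
  elim: aN => [|c _ y [i i_N ->] _ [h [hg hs hy]]].
    by exists 0; rewrite size_poly0 coef0; split=> //; left.
  have giN := gsz i N (ltnW i_N).
  have gi0 : (0 < size (g i))%N.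
    by rewrite lt0n size_poly_eq0; apply/eqP => gi0; apply: (gN i); rewrite gi0; left.
  exists (c%:P * 'X^(size (g N) - size (g i)) * g i + h); split.
  - by apply: ideal_genD => //; exists i.
  - rewrite (leq_trans (size_polyD _ _)) // geq_max hs andbT -mulrA mul_polyC.
    rewrite (leq_trans (size_scale_leq _ _)) // mulrC.
    rewrite (leq_trans (size_polyMleq _ _)) // size_polyXn addnS /=.
    by rewrite subnKC.
  - rewrite coefD hy -mulrA coefCM coefXnM; congr (_ * _ + _).
    have e : ((size (g N)).-1 - (size (g N) - size (g i)) = (size (g i)).-1)%N.
      by move: gi0 giN; lia.
    by rewrite e ifF //; apply/negbTE; move: gi0 giN; lia.
have gN0 : (0 < size (g N))%N.
  by rewrite lt0n size_poly_eq0; apply/eqP => gN0; apply: (gN N); rewrite gN0; left.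
have : (size (g N) <= size (g N - h)%R)%N.
  apply: gmin.
    have [m hm] : I h.
      elim: hg => [|a _ y [i _ ->] _ Iy]; last exact: I_lin.
      by exists 0%N; left.
    have -> : g N - h = (-1) * h + g N by rewrite mulN1r addrC.
    by apply: I_lin => //; exists m.
  move=> gh; apply: (gN N); rewrite -[g N](subrK h) -[g N - h]mul1r.
  exact: ideal_gen_linear.
rewrite leqNgt => /negP; apply; rewrite -[X in (_ < X)%N]prednK // ltnS.
apply/leq_sizeP => j; rewrite leq_eqVlt => /orP[/eqP <-|].
  by rewrite coefB hN subrr.
rewrite prednK // => jN; rewrite coefB !nth_default ?subrr //.
exact: leq_trans jN.
Qed.

End Noetherian.

Section MultivariatePolynomials.
Local Open Scope ring_scope.

Lemma mpoly_alg_ind n (R : comNzRingType) (P : {mpoly R[n]} -> Prop) :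
  (forall c, P c%:MP) -> (forall i, P 'X_i) ->
  (forall p q, P p -> P q -> P (p + q)) ->
  (forall p q, P p -> P q -> P (p * q)) -> forall p, P p.
Proof.
move=> PC PX PD PM; elim/mpolyind => [|c m p _ _ Pp]; first by rewrite -mpolyC0.
apply: (PD) => //; rewrite -mul_mpolyC; apply: (PM) => //.
have P1 : P 1 by rewrite -mpolyC1.
rewrite mpolyXE_id; apply: big_ind => [//|x y|i _]; first exact: (PM).
by elim: (m i) => [|k IH]; rewrite ?expr0 // exprS; apply: PM.
Qed.

(** Polynomials in n + 1 variables are the image of univariate polynomials over those in n
    variables, by evaluation at the last variable. *)
Lemma noetherian_mpoly n (R : comNzRingType) : noetherian R -> noetherian {mpoly R[n]}.
Proof.
move=> noR; elim: n => [|n IH].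
  apply: (noetherian_image (phi := fun c => c%:MP)) noR => [x y|x y|p].
  - exact: mpolyCD.
  - exact: mpolyCM.
  - by exists (p@_0%MM); rewrite -nvar0_mpolyC.
apply: (noetherian_image (phi := fun q => (map_poly (@mwiden n R) q).['X_ord_max]))
  (noetherian_poly IH) => [p q|p q|p].
- by rewrite rmorphD hornerD.
- by rewrite rmorphM hornerM.
- elim/mpoly_alg_ind: p => [c|i|p q [p' <-] [q' <-]|p q [p' <-] [q' <-]].
  + by exists (c%:MP)%:P; rewrite map_polyC hornerC /= mwidenC.
  + have [j ->|->] := unliftP ord_max i; last by exists 'X; rewrite map_polyX hornerX.
    exists ('X_j)%:P; rewrite map_polyC hornerC /= mwidenX mnmwiden1.
    by congr 'X_[U_(_)]; apply: val_inj; rewrite /= /bump leqNgt ltn_ord.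
  + by exists (p' + q'); rewrite rmorphD hornerD.
  + by exists (p' * q'); rewrite rmorphM hornerM.
Qed.

End MultivariatePolynomials.

Section Krull.
Context {R : comNzRingType} {m : nat} (I : R -> Prop) (y : 'I_m -> R).
Hypothesis I0 : I 0.
Hypothesis I_linear : forall a f g, I f -> I g -> I (a * f + g).

(* adic k f: f lies in I plus the k-th power of the ideal generated by y. *)
Inductive adic : nat -> R -> Prop :=
  | adic_I k f of I f : adic k f
  | adic_0 f : adic 0 f
  | adic_S k j f of adic k f : adic k.+1 (y j * f)
  | adic_linear k a f g of adic k f & adic k g : adic k (a * f + g).

Lemma adicD k f g : adic k f -> adic k g -> adic k (f + g).
Proof. by rewrite -[f in f + g]mul1r; apply: adic_linear. Qed.

Lemma adicMl k a f : adic k f -> adic k (a * f).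
Proof. by move=> kf; rewrite -[_ * _]addr0; apply: adic_linear => //; apply: adic_I. Qed.

Lemma adicB k f g : adic k f -> adic k g -> adic k (f - g).
Proof. by move=> kf kg; rewrite -mulN1r addrC; apply: adic_linear. Qed.

Lemma adicM j k a f : adic j a -> adic k f -> adic (j + k) (a * f).
Proof.
move=> ja kf; elim: ja => {j a} [j a Ia|a|j i a _ IH|j b a a' _ IH _ IH'].
- by apply: adic_I; rewrite mulrC -[_ * _]addr0; apply: I_linear.
- exact: adicMl.
- by rewrite addSn -mulrA; apply: adic_S.
- by rewrite mulrDl -mulrA; apply: adic_linear.
Qed.

Lemma adic_le k f : adic k.+1 f -> adic k f.
Proof.
suff gen k' h : adic k' h -> forall k, k' = k.+1 -> adic k h by move=> /gen; apply.
move=> kh; elim: kh => {k k' f h}.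
- by move=> _ f If k _; apply: adic_I.
- by [].
- by move=> k' j f kf _ k [<-]; apply: adicMl.
- by move=> k' a f g _ IHf _ IHg k kE; apply: adic_linear; [apply: IHf|apply: IHg].
Qed.

(** The coefficient of X^l in [eta g] is the value at y of the homogeneous part of g of degree l. *)
Let eta (g : {mpoly R[m]}) : {poly R} :=
  mmap (@polyC R) (fun j => (y j)%:P * 'X) g.

Let etaD g h : eta (g + h) = eta g + eta h. Proof. exact: rmorphD. Qed.
Let etaM g h : eta (g * h) = eta g * eta h. Proof. exact: rmorphM. Qed.
Let etaC c : eta c%:MP = c%:P. Proof. exact: mmapC. Qed.
Let etaX j : eta 'X_j = (y j)%:P * 'X. Proof. by rewrite /eta mmapX mmap1U. Qed.

Let combination x := exists c : 'I_m -> R, x = \sum_j c j * y j.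

Let combination_linear a x x' : combination x -> combination x' -> combination (a * x + x').
Proof.
move=> [c ->] [c' ->]; exists (fun j => a * c j + c' j).
rewrite mulr_sumr -big_split; apply: eq_bigr => j _.
by rewrite mulrDl mulrA.
Qed.

Let combination0 : combination 0.
Proof. by exists (fun=> 0); rewrite big1 // => j _; rewrite mul0r. Qed.

Let combinationM a x : combination x -> combination (a * x).
Proof. by move=> cx; rewrite -[_ * _]addr0; apply: combination_linear. Qed.

Let eta_coef g j : (0 < j)%N -> combination (eta g)`_j.
Proof.
elim/mpoly_alg_ind: g j => [c|i|p q IHp IHq|p q IHp IHq] j j0.
- by rewrite etaC coefC gtn_eqF.
- rewrite etaX coefCM coefX mulrC; apply: combinationM.
  exists (fun j => (j == i)%:R); rewrite (bigD1 i) //= eqxx mul1r big1 ?addr0 //.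
  by move=> k /negPf ->; rewrite mul0r.
- by rewrite etaD coefD -[X in X + _]mul1r; apply: combination_linear; [apply: IHp|apply: IHq].
- rewrite etaM coefM; apply: big_ind => [//|a b ca cb|k _].
    by rewrite -[a]mul1r; apply: combination_linear.
  case: (posnP k) => [k0|k0]; last by rewrite mulrC; apply: combinationM; apply: IHp.
  by apply: combinationM; apply: IHq; rewrite k0 subn0.
Qed.

(** For each k there is a g_k whose part of degree k takes at y the value f modulo I, all other
    parts giving 0. By Hilbert's theorem in m variables, some g_N is a combination of earlier g_i.
    In degree N the multiplier of g_i contributes its part of degree N - i > 0, whose value is a
    combination of the y_j. *)
Lemma krull_intersection f : noetherian R -> (forall k, adic k f) ->
  exists c : 'I_m -> R, I (f - (\sum_j c j * y j) * f).
Proof.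
move=> noR fk.
have lift k h : adic k h -> exists g, forall l, I ((eta g)`_l - (if l == k then h else 0)).
  move=> kh; elim: kh => {k h} [k h Ih|h|k j h _ [g gP]|k a h h' _ [g gP] _ [g' gP']].
  - exists 0 => l; rewrite -[eta 0]/(mmap _ _ _) rmorph0 coef0 sub0r -mulN1r.
    by rewrite -[_ * _]addr0; apply: I_linear => //; case: eqP.
  - by exists h%:MP => l; rewrite etaC coefC; case: eqP => _; rewrite subrr.
  - exists ('X_j * g) => -[|l]; rewrite etaM etaX -mulrA coefCM coefXM /=.
      by rewrite mulr0 subr0.
    have -> : y j * (eta g)`_l - (if l.+1 == k.+1 then y j * h else 0) =
      y j * ((eta g)`_l - (if l == k then h else 0)) + 0.
      by rewrite eqSS mulrBr addr0; case: eqP; rewrite ?mulr0.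
    exact: I_linear.
  - exists (a%:MP * g + g') => l; rewrite etaD etaM etaC coefD coefCM.
    have -> : a * (eta g)`_l + (eta g')`_l - (if l == k then a * h + h' else 0) =
      a * ((eta g)`_l - (if l == k then h else 0)) +
      ((eta g')`_l - (if l == k then h' else 0)).
      by case: eqP => _; rewrite ?subr0 // mulrBr opprD addrACA.
    exact: I_linear.
have [g gP] := functional_choice _ (fun k => lift k f (fk k)).
have [N gN] := @noetherian_mpoly m R noR g.
suff [x [[c cx] xf]] : exists x, combination x /\ I ((eta (g N))`_N - x * f).
  exists c; rewrite -cx.
  have -> : f - x * f = (-1) * ((eta (g N))`_N - f) + ((eta (g N))`_N - x * f).
    by rewrite mulN1r opprB addrA subrK.
  by apply: I_linear => //; have := gP N N; rewrite eqxx.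
elim: gN => [|a _ h [i i_N ->] _ [x [cx xf]]].
  by exists 0; rewrite -[eta 0]/(mmap _ _ _) rmorph0 coef0 mul0r subrr.
exists ((eta a)`_(N - i) + x); split.
  by rewrite -[X in X + _]mul1r; apply: combination_linear => //; apply: eta_coef; rewrite subn_gt0.
have iN : (N - i < N.+1)%N by rewrite ltnS leq_subr.
rewrite etaD etaM coefD mulrDl opprD addrACA -[X in I (X + _)]mul1r.
apply: I_linear => //; rewrite coefM.
have IS (J : finType) (P : pred J) (u : J -> R) : (forall j, P j -> I (u j)) ->
    I (\sum_(j | P j) u j).
  move=> Iu; apply: big_ind => // u1 u2 I1 I2.
  by rewrite -[u1]mul1r; apply: I_linear.
rewrite (bigD1 (Ordinal iN)) //= addrAC -mulrBr; apply: I_linear.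
  by have := gP i (N - (N - i))%N; rewrite subKn ?eqxx // ltnW.
apply: IS => l lNi; have := gP i (N - l)%N.
rewrite ifF; last first.
  apply/negbTE; apply: contraNneq lNi => lE; apply/eqP/val_inj => /=.
  by rewrite -lE subKn // -ltnS.
rewrite subr0 => Ig; rewrite -[_ * _]addr0; exact: I_linear.
Qed.

End Krull.

(** * Invariant derivations *)

Section PolynomialFunctions.
Context {F : numClosedFieldType}.

Lemma poly_fun_eq0 (p : {poly F}) : (forall t, p.[t] = 0) -> p = 0.
Proof.
move=> p0; apply/eqP; apply: contraT => pn0.
have := max_poly_roots (rs := [seq i%:R | i <- iota 0 (size p)]) pn0.
rewrite size_map size_iota ltnn => roots; suff: false by [].
apply: roots; first by apply/allP => x _; apply/rootP.
rewrite map_inj_uniq ?iota_uniq // => i j /eqP; rewrite eqr_nat; exact: eqP.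
Qed.

(** In characteristic 0 the coefficients are read off from iterated partial derivatives at 0, and
    partial derivatives of a zero function are zero by restriction to lines. *)
Lemma mpoly_fun_eq0 m (p : {mpoly F[m]}) : (forall a, p.@[a] = 0) -> p = 0.
Proof.
have der (q : {mpoly F[m]}) i : (forall a, q.@[a] = 0) -> forall a, (q^`M(i)).@[a] = 0.
  move=> q0 a; pose line := mmap (@polyC F) (fun j => (a j)%:P + (j == i)%:R *: 'X).
  have lineE (g : {mpoly F[m]}) t :
      (line g).[t] = g.@[fun j => a j + (j == i)%:R * t].
    elim/mpoly_alg_ind: g => [c|j|g h IHg IHh|g h IHg IHh].
    - by rewrite /line mmapC hornerC mevalC.
    - by rewrite /line mmapX mmap1U mevalXU !hornerE.
    - by rewrite /line rmorphD hornerD IHg IHh mevalD.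
    - by rewrite /line rmorphM hornerM IHg IHh mevalM.
  have dline (g : {mpoly F[m]}) : ((line g)^`()).[0] = (g^`M(i)).@[a].
    have l0 (h : {mpoly F[m]}) : (line h).[0] = h.@[a].
      by rewrite lineE; apply: meval_eq => j; rewrite mulr0 addr0.
    elim/mpoly_alg_ind: g => [c|j|g h IHg IHh|g h IHg IHh].
    - by rewrite /line mmapC derivC mderivC meval0 hornerC.
    - rewrite /line mmapX mmap1U derivD derivC derivZ derivX add0r hornerZ hornerC.
      rewrite mderivX mevalZ mulr1 mnm1E; case: eqP => [->|_]; last by rewrite mul0r.
      have -> : (U_(i) - U_(i) = 0)%MM by apply/mnmP => l; rewrite mnmBE mnm0E subnn.
      by rewrite mpolyX0 meval1 mulr1.
    - by rewrite mderivD mevalD -IHg -IHh /line rmorphD derivD hornerD.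
    - rewrite mderivM mevalD !mevalM -IHg -IHh -!l0 /line rmorphM derivM hornerD.
      by rewrite !hornerM.
  rewrite -dline (_ : line q = 0) ?deriv0 ?horner0 //.
  by apply: poly_fun_eq0 => t; rewrite lineE.
have coef0 k (q : {mpoly F[m]}) (mm : 'X_{1..m}) : mdeg mm = k ->
    (forall a, q.@[a] = 0) -> q@_mm = 0.
  elim: k q mm => [|k IH] q mm dm q0.
    move/eqP: dm; rewrite mdeg_eq0 => /eqP ->.
    rewrite -(q0 (fun=> 0)); elim/mpoly_alg_ind: q {q0} => [c|i|g h IHg IHh|g h IHg IHh].
    - by rewrite mcoeffC eqxx mulr1 mevalC.
    - by rewrite mevalXU mcoeffX; case: eqP => // /mnmP/(_ i); rewrite mnm1E eqxx mnm0E.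
    - by rewrite mcoeffD IHg IHh mevalD.
    - by rewrite rmorphM /= IHg IHh mevalM.
  have [i mi] : exists i, (0 < mm i)%N.
    apply: NNPP => ni; move: dm; rewrite mdegE big1 // => i _.
    by apply/eqP; apply: contraT; rewrite -lt0n => mi; case: ni; exists i.
  have mmE : (mm = (mm - U_(i)) + U_(i))%MM by rewrite submK // lep1mP -lt0n.
  have d' : mdeg (mm - U_(i))%MM = k.
    by move: dm; rewrite {1}mmE mdegD mdeg1 addn1 => -[].
  have := IH _ _ d' (der q i q0); rewrite mcoeff_mderiv -mmE => /eqP.
  by rewrite mulrn_eq0 => /eqP.
by move=> p0; apply/mpolyP => mm; rewrite mcoeff0; apply: coef0 p0.
Qed.

End PolynomialFunctions.

Section LieDerivative.
Context {F : numClosedFieldType} {n : nat}.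
Local Notation P := {mpoly F[n * n]}.

Lemma mxvec_index_ex (k : 'I_(n * n)) : exists i j, k = mxvec_index i j.
Proof. by case/mxvec_indexP: k => i j; exists i, j. Qed.

Definition generic_mx : 'M[P]_n := \matrix_(i, j) 'X_(mxvec_index i j).
Definition const_mpoly_mx (X : 'M[F]_n) : 'M[P]_n := map_mx (@mpolyC (n * n) F) X.

(* Derivative of p along the left invariant vector field of X. *)
Definition lder (X : 'M[F]_n) (p : P) : P :=
  \sum_(k < n * n) mxvec (generic_mx *m const_mpoly_mx X) 0 k * p^`M(k).

Definition dirder (a z : 'I_(n * n) -> F) (p : P) : F :=
  \sum_(k < n * n) z k * (p^`M(k)).@[a].

Definition ltrans (g : 'M[F]_n) (p : P) : P :=
  p \mPo [tuple mxvec (const_mpoly_mx g *m generic_mx) 0 k | k < n * n].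

Lemma meval_generic g : map_mx (meval (entry g)) generic_mx = g.
Proof. by apply/matrixP => i j; rewrite !mxE mevalXU /entry mxvecE. Qed.

Lemma meval_const a X : map_mx (meval a) (const_mpoly_mx X) = X.
Proof. by apply/matrixP => i j; rewrite !mxE mevalC. Qed.

Lemma meval_ltrans g p h : (ltrans g p).@[entry h] = p.@[entry (g *m h)].
Proof.
rewrite comp_mpoly_meval; apply: meval_eq => k; rewrite tnth_mktuple.
have -> : (mxvec (const_mpoly_mx g *m generic_mx) 0 k).@[entry h] =
  (map_mx (meval (entry h)) (mxvec (const_mpoly_mx g *m generic_mx))) 0 k.
  by rewrite [RHS]mxE.
by rewrite map_mxvec map_mxM meval_generic meval_const.
Qed.

Lemma meval_lder X p g : (lder X p).@[entry g] = dirder (entry g) (entry (g *m X)) p.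
Proof.
rewrite raddf_sum; apply: eq_bigr => k _ /=; rewrite mevalM; congr (_ * _).
have -> : (mxvec (generic_mx *m const_mpoly_mx X) 0 k).@[entry g] =
  (map_mx (meval (entry g)) (mxvec (generic_mx *m const_mpoly_mx X))) 0 k.
  by rewrite [RHS]mxE.
by rewrite map_mxvec map_mxM meval_generic meval_const.
Qed.

Lemma dpoly1E p X : dpoly1 p X = dirder (entry 1%:M) (entry X) p.
Proof. by []. Qed.

Lemma dirderD a z p q : dirder a z (p + q) = dirder a z p + dirder a z q.
Proof.
by rewrite -big_split; apply: eq_bigr => k _; rewrite mderivD mevalD mulrDr.
Qed.

Lemma dirderM a z p q : dirder a z (p * q) = dirder a z p * q.@[a] + p.@[a] * dirder a z q.
Proof.
rewrite mulr_suml mulr_sumr -big_split; apply: eq_bigr => k _ /=.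
by rewrite mderivM mevalD !mevalM mulrDr !mulrA [_ * p.@[a]]mulrC.
Qed.

Lemma dirderC a z c : dirder a z c%:MP = 0.
Proof. by rewrite /dirder big1 // => k _; rewrite mderivC meval0 mulr0. Qed.

Lemma mderivXU (i k : 'I_(n * n)) : ('X_i : P)^`M(k) = ((i == k)%:R)%:MP.
Proof.
rewrite mderivX mnm1E; case: eqP => [->|_]; last by rewrite scale0r mpolyC0.
have -> : (U_(k) - U_(k) = 0)%MM by apply/mnmP => l; rewrite mnmBE mnm0E subnn.
by rewrite mpolyX0 scale1r mpolyC1.
Qed.

Lemma dirderX a z i : dirder a z 'X_i = z i.
Proof.
rewrite /dirder (bigD1 i) //= mderivXU eqxx mevalC mulr1 big1 ?addr0 // => k ki.
by rewrite mderivXU eq_sym (negPf ki) mevalC mulr0.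
Qed.

Lemma lderD X p q : lder X (p + q) = lder X p + lder X q.
Proof. by rewrite -big_split; apply: eq_bigr => k _; rewrite mderivD mulrDr. Qed.

Lemma lderM X p q : lder X (p * q) = lder X p * q + p * lder X q.
Proof.
rewrite mulr_suml mulr_sumr -big_split; apply: eq_bigr => k _ /=.
by rewrite mderivM mulrDr !mulrA [_ * p]mulrC.
Qed.

Lemma lderC X c : lder X c%:MP = 0.
Proof. by rewrite /lder big1 // => k _; rewrite mderivC mulr0. Qed.

Lemma lder0 X : lder X 0 = 0. Proof. by rewrite -mpolyC0 lderC. Qed.

Lemma lderZ X c p : lder X (c *: p) = c *: lder X p.
Proof. by rewrite -!mul_mpolyC lderM lderC mul0r add0r. Qed.

Lemma lderB X p q : lder X (p - q) = lder X p - lder X q.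
Proof. by rewrite lderD -scaleN1r lderZ scaleN1r. Qed.

Lemma lder_sum X I (r : seq I) (p : I -> P) :
  lder X (\sum_(i <- r) p i) = \sum_(i <- r) lder X (p i).
Proof. exact: (big_morph (lder X) (lderD X) (lder0 X)). Qed.

Lemma lderXU X i : lder X 'X_i = mxvec (generic_mx *m const_mpoly_mx X) 0 i.
Proof.
rewrite /lder (bigD1 i) //= mderivXU eqxx mpolyC1 mulr1 big1 ?addr0 // => k ki.
by rewrite mderivXU eq_sym (negPf ki) mpolyC0 mulr0.
Qed.

Lemma lder_entry X i j : lder X 'X_(mxvec_index i j) =
  \sum_l 'X_(mxvec_index i l) * (X l j)%:MP.
Proof.
rewrite lderXU (mxvecE (generic_mx *m const_mpoly_mx X)) mxE.
by apply: eq_bigr => l _; rewrite [generic_mx _ _]mxE [const_mpoly_mx _ _ _]mxE.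
Qed.

Lemma ltrans_entry g i j : ltrans g 'X_(mxvec_index i j) =
  \sum_l (g i l)%:MP * 'X_(mxvec_index l j).
Proof.
rewrite /ltrans comp_mpolyXU -tnth_nth tnth_mktuple.
rewrite (mxvecE (const_mpoly_mx g *m generic_mx)) mxE.
by apply: eq_bigr => l _; rewrite [generic_mx _ _]mxE [const_mpoly_mx _ _ _]mxE.
Qed.

Lemma entryE (X : 'M[F]_n) i j : entry X (mxvec_index i j) = X i j.
Proof. by rewrite /entry mxvecE. Qed.

(** The chain rule for h |-> g h, which accounts for the left invariance of [lder X]. *)
Lemma dirder_ltrans g h X p :
  dirder (entry h) (entry X) (ltrans g p) =
  dirder (entry (g *m h)) (entry (g *m X)) p.
Proof.
elim/mpoly_alg_ind: p => [c|k|p q IHp IHq|p q IHp IHq].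
- by rewrite /ltrans comp_mpolyC !dirderC.
- have [i [j ->]] := mxvec_index_ex k; rewrite dirderX entryE ltrans_entry mxE.
  have dsum (u : 'I_n -> P) :
      dirder (entry h) (entry X) (\sum_l u l) = \sum_l dirder (entry h) (entry X) (u l).
    apply: (big_morph (dirder (entry h) (entry X))) => [u1 u2|]; first exact: dirderD.
    by rewrite -mpolyC0 dirderC.
  rewrite dsum; apply: eq_bigr => l _; rewrite dirderM dirderC mul0r add0r.
  by rewrite mevalC dirderX entryE.
- by rewrite /ltrans comp_mpolyD !dirderD -!/(ltrans _ _) IHp IHq.
- rewrite /ltrans rmorphM !dirderM -!/(ltrans _ _) IHp IHq.
  by rewrite !meval_ltrans.
Qed.

Lemma lder_linearX a X Y p : lder (a *: X + Y) p = a *: lder X p + lder Y p.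
Proof.
elim/mpoly_alg_ind: p => [c|k|p q IHp IHq|p q IHp IHq].
- by rewrite lderC [lder X _]lderC [lder Y c%:MP]lderC scaler0 addr0.
- have [i [j ->]] := mxvec_index_ex k; rewrite !lder_entry scaler_sumr -big_split.
  apply: eq_bigr => l _ /=; rewrite !mxE mpolyCD mpolyCM mulrDr -mul_mpolyC.
  by rewrite mulrCA.
- by rewrite !lderD IHp IHq scalerDr addrACA.
- rewrite !lderM IHp IHq mulrDl mulrDr scalerDr addrACA -scalerAl.
  by rewrite -[p * (a *: _)]scalerAr.
Qed.

Let leibniz_bracket (R : comNzRingType) (p q px py pxy pyx qx qy qxy qyx : R) :
  (pxy - pyx) * q + p * (qxy - qyx) =
  pxy * q + py * qx + (px * qy + p * qxy) - (pyx * q + px * qy + (py * qx + p * qyx)).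
Proof. ring. Qed.

(** Both sides are derivations in p, so it suffices to compare them on the matrix entries, where
    [lder X] is right multiplication of the generic matrix by X. *)
Lemma lder_bracket X Y p :
  lder (lie_bracket X Y) p = lder X (lder Y p) - lder Y (lder X p).
Proof.
elim/mpoly_alg_ind: p => [c|k|p q IHp IHq|p q IHp IHq].
- by rewrite lderC [lder Y c%:MP]lderC [lder X c%:MP]lderC !lder0 subrr.
- have [i [j ->]] := mxvec_index_ex k.
  have lder2 X' Y' : lder X' (lder Y' 'X_(mxvec_index i j)) =
      \sum_l 'X_(mxvec_index i l) * ((X' *m Y') l j)%:MP.
    rewrite lder_entry lder_sum.
    under eq_bigr do rewrite lderM lderC mulr0 addr0 lder_entry mulr_suml.
    rewrite exchange_big; apply: eq_bigr => l _ /=; rewrite mxE raddf_sum mulr_sumr.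
    by apply: eq_bigr => l' _ /=; rewrite mpolyCM mulrA.
  rewrite !lder2 lder_entry -sumrB; apply: eq_bigr => l _.
  by rewrite -mulrBr -mpolyCB; congr (_ * _%:MP); rewrite /lie_bracket mxE [X in _ + X]mxE.
- by rewrite !lderD IHp IHq opprD addrACA.
- by rewrite !lderM !lderD !lderM IHp IHq; apply: leibniz_bracket.
Qed.

Lemma dpoly1_lder p X : (lder X p).@[entry 1%:M] = dpoly1 p X.
Proof. by rewrite meval_lder mul1mx. Qed.

End LieDerivative.

(** * Taylor expansion of regular functions at the identity *)

Section Taylor.
Context {F : numClosedFieldType} {n : nat} (H : @linAlgGroup F n).
Local Notation P := {mpoly F[n * n]}.
Local Notation m := (n * n)%N.

Definition vanishes (p : P) : Prop := forall g, H g -> p.@[entry g] = 0.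
Definition local_coord (k : 'I_(n * n)) : P := 'X_k - (entry (1%:M : 'M[F]_n) k)%:MP.

Local Notation y := local_coord.
Local Notation val1 p := (p.@[entry (1%:M : 'M[F]_n)]).
Local Notation adicH := (adic vanishes y).

Lemma points_unit g : H g -> g \in unitmx.
Proof. by have [Z _ HZ] := points_closed H; case/HZ. Qed.

Lemma vanishes0 : vanishes 0.
Proof. by move=> g _; rewrite meval0. Qed.

Lemma vanishes_linear a p q : vanishes p -> vanishes q -> vanishes (a * p + q).
Proof. by move=> p0 q0 g Hg; rewrite mevalD mevalM p0 // q0 // mulr0 addr0. Qed.

Lemma vanishesD p q : vanishes p -> vanishes q -> vanishes (p + q).
Proof. by rewrite -[p in p + q]mul1r; apply: vanishes_linear. Qed.

(** The derivative at g is that at 1 of the left translate of p by g, which again vanishes on H. *)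
Lemma vanishes_lder X p : lie_alg H X -> vanishes p -> vanishes (lder X p).
Proof.
move=> HX p0 g Hg; rewrite meval_lder -[g in dirder (entry g)]mulmx1 -dirder_ltrans.
by rewrite -dpoly1E; apply: HX => h Hh; rewrite meval_ltrans p0 //; apply: pointsM.
Qed.

Let adicD := @adicD P m vanishes y.
Let adicB := @adicB P m vanishes y.
Let adicMl := @adicMl P m vanishes y vanishes0.
Let adicM := @adicM P m vanishes y vanishes0 vanishes_linear.
Let adic_le := @adic_le P m vanishes y vanishes0.

Let adic00 k : adicH k 0. Proof. by apply: adic_I; apply: vanishes0. Qed.

Let val1_y k : val1 (y k) = 0.
Proof. by rewrite mevalB mevalXU mevalC subrr. Qed.

Lemma adic_val1 k p : adicH k.+1 p -> val1 p = 0.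
Proof.
suff gen k' q : adicH k' q -> (0 < k')%N -> val1 q = 0 by move/gen; apply.
elim=> {k p k' q} [k p p0 _|//|k j p _ _ _|k a p q _ IHp _ IHq k0].
- by apply: p0; apply: points1.
- by rewrite mevalM val1_y mul0r.
- by rewrite mevalD mevalM IHp // IHq // mulr0 addr0.
Qed.

Lemma adic_lder X k p : lie_alg H X -> adicH k p -> adicH k.-1 (lder X p).
Proof.
move=> HX; elim=> {k p} [k p p0|p|k j p kp IH|k a p q kp IHp kq IHq].
- by apply: adic_I; apply: vanishes_lder.
- exact: adic_0.
- rewrite lderM; apply: adicD; first exact: adicMl.
  by case: k kp IH => [|k] _ IH; [apply: adic_0 | apply: adic_S].
- rewrite lderD lderM; apply: adicD => //; apply: adicD; last exact: adicMl.
  by case: k kp {IHp kq IHq} => [|k] kp /=; apply: adicMl; [|apply: adic_le].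
Qed.

Lemma adic_iter_lder X k j p : lie_alg H X -> adicH (k + j) p -> adicH j (iter k (lder X) p).
Proof.
move=> HX; elim: k p => [//|k IH] p kp.
by rewrite iterSr; apply: IH; rewrite -[(k + j)%N]/((k.+1 + j).-1)%N; apply: adic_lder.
Qed.

Lemma adic1 p : adicH 1 (p - (val1 p)%:MP).
Proof.
elim/mpoly_alg_ind: p => [c|k|p q IHp IHq|p q IHp IHq].
- by rewrite mevalC subrr.
- by rewrite mevalXU -[_ - _]mulr1; apply: adic_S; apply: adic_0.
- by rewrite mevalD mpolyCD opprD addrACA; apply: adicD.
- have idt (R : comNzRingType) (u v p1 q1 : R) :
      u * v - p1 * q1 = v * (u - p1) + p1 * (v - q1) by ring.
  rewrite mevalM mpolyCM idt; apply: adicD; apply: adicMl; [exact: IHp | exact: IHq].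
Qed.

Let lin p : P := \sum_k val1 (p^`M(k)) *: y k.

Let adic_lin c : adicH 1 (\sum_k c k *: y k).
Proof.
apply: big_ind => [|u v|k _]; [exact: adic00 | exact: adicD |].
rewrite -mul_mpolyC; apply: adicMl; rewrite -[y k]mulr1.
by apply: adic_S; apply: adic_0.
Qed.

Lemma adic2 p : adicH 2 (p - (val1 p)%:MP - lin p).
Proof.
elim/mpoly_alg_ind: p => [c|k|p q IHp IHq|p q IHp IHq].
- rewrite mevalC subrr sub0r /lin big1 ?oppr0 // => k _.
  by rewrite mderivC meval0 scale0r.
- rewrite /lin (bigD1 k) //= big1 => [|j jk]; last first.
    by rewrite mderivXU eq_sym (negPf jk) mevalC scale0r.
  by rewrite mderivXU eqxx mevalC scale1r addr0 mevalXU subrr.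
- have -> : lin (p + q) = lin p + lin q.
    rewrite -big_split; apply: eq_bigr => k _.
    by rewrite mderivD mevalD scalerDl.
  have idt (R : comNzRingType) (u v p1 q1 dp dq : R) :
      u + v - (p1 + q1) - (dp + dq) = (u - p1 - dp) + (v - q1 - dq) by ring.
  by rewrite mevalD mpolyCD idt; apply: adicD.
- have -> : lin (p * q) = (val1 p)%:MP * lin q + (val1 q)%:MP * lin p.
    rewrite !mul_mpolyC !scaler_sumr -big_split; apply: eq_bigr => k _.
    by rewrite mderivM mevalD !mevalM /= scalerDl !scalerA addrC [_ * val1 q]mulrC.
  have idt (R : comNzRingType) (u v p1 q1 dp dq : R) :
      u * v - p1 * q1 - (p1 * dq + q1 * dp) =
      v * (u - p1 - dp) + (dp * (v - q1) + p1 * (v - q1 - dq)) by ring.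
  rewrite mevalM mpolyCM idt; apply: adicD; first exact: adicMl.
  apply: adicD; last exact: adicMl.
  exact: (adicM (adic_lin _) (adic1 q)).
Qed.

(** u may be replaced by its value at 1: the error times v has order k + 1, too high for k
    derivatives. *)
Lemma val1_iter_lder_mul X k u v : lie_alg H X -> adicH k v ->
  val1 (iter k (lder X) (u * v)) = val1 u * val1 (iter k (lder X) v).
Proof.
move=> HX kv.
have iterB j p q : iter j (lder X) (p - q) = iter j (lder X) p - iter j (lder X) q.
  by elim: j => //= j ->; rewrite lderB.
have iterC j c p : iter j (lder X) (c%:MP * p) = c%:MP * iter j (lder X) p.
  by elim: j => //= j ->; rewrite lderM lderC mul0r add0r.
have := adic_val1 (@adic_iter_lder X k 1 ((u - (val1 u)%:MP) * v) HX _).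
rewrite mulrBl iterB iterC mevalB mevalM mevalC => e.
by apply/eqP; rewrite -subr_eq0; apply/eqP/e; rewrite -mulrBl addn1; apply: (adicM (adic1 u)).
Qed.

(** In the Leibniz expansion exactly one of the k + 1 derivatives must fall on u and the k others on
    v; the factor counts the choices. *)
Lemma val1_iter_lder_coord X k u v : lie_alg H X -> val1 u = 0 -> adicH k v ->
  val1 (iter k.+1 (lder X) (u * v)) =
  k.+1%:R * (val1 (lder X u) * val1 (iter k (lder X) v)).
Proof.
move=> HX u0; elim: k v => [|k IH] v kv.
  by rewrite /= lderM mevalD !mevalM u0 mul0r addr0 mul1r.
have iterD j p q : iter j (lder X) (p + q) = iter j (lder X) p + iter j (lder X) q.
  by elim: j => //= j ->; rewrite lderD.
rewrite iterSr lderM iterD mevalD val1_iter_lder_mul // IH; last exact: (adic_lder HX kv).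
by rewrite -iterSr -[k.+2%:R]nat1r mulrDl mul1r.
Qed.

Definition cword (s : seq 'I_(n * n)) : P := \prod_(j <- s) y j.

Lemma adic_cword s : adicH (size s) (cword s).
Proof.
elim: s => [|j s IH]; first exact: adic_0.
by rewrite /cword big_cons; apply: adic_S.
Qed.

Lemma val1_iter_lder_cword X s : lie_alg H X ->
  val1 (iter (size s) (lder X) (cword s)) = (size s)`!%:R * \prod_(j <- s) entry X j.
Proof.
move=> HX; elim: s => [|j s IH]; first by rewrite /= /cword !big_nil meval1 mulr1.
rewrite /cword !big_cons -/(cword s) val1_iter_lder_coord ?val1_y //; last exact: adic_cword.
rewrite IH lderB lderC subr0 meval_lder mul1mx dirderX factS natrM.
by rewrite !mulrA [_ * _ * entry X j]mulrAC.
Qed.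

Definition wsum (q : seq (F * seq 'I_(n * n))) : P := \sum_(t <- q) t.1 *: cword t.2.

Lemma adic_leading k p : adicH k p -> exists q : seq (F * seq 'I_(n * n)),
  (forall t, t \in q -> size t.2 = k) /\ adicH k.+1 (p - wsum q).
Proof.
elim=> {k p} [k p p0|p|k j p _ [q [qs qp]]|k a p p' kp [q [qs qp]] kp' [q' [qs' qp']]].
- exists [::]; split=> //; rewrite /wsum big_nil subr0; exact: adic_I.
- exists [:: (val1 p, [::])]; split; first by move=> t; rewrite inE => /eqP ->.
  by rewrite /wsum big_seq1 /cword big_nil alg_mpolyC; apply: adic1.
- exists [seq (t.1, j :: t.2) | t <- q]; split.
    by move=> _ /mapP[t /qs ts ->] /=; rewrite ts.
  have -> : wsum [seq (t.1, j :: t.2) | t <- q] = y j * wsum q.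
    rewrite /wsum big_map mulr_sumr; apply: eq_bigr => t _.
    by rewrite /cword big_cons scalerAr.
  by rewrite -mulrBr; apply: adic_S.
- exists ([seq (val1 a * t.1, t.2) | t <- q] ++ q'); split.
    by move=> t; rewrite mem_cat => /orP[/mapP[t' /qs ts ->]|/qs'].
  have -> : wsum ([seq (val1 a * t.1, t.2) | t <- q] ++ q') =
      (val1 a)%:MP * wsum q + wsum q'.
    rewrite /wsum big_cat big_map mulr_sumr /=; congr (_ + _).
    by apply: eq_bigr => t _; rewrite mul_mpolyC scalerA.
  have -> : a * p + p' - ((val1 a)%:MP * wsum q + wsum q') =
      (a - (val1 a)%:MP) * p + ((val1 a)%:MP * (p - wsum q) + (p' - wsum q')).
    have idt (R : comNzRingType) (a' p1 p2 b q1 q2 : R) :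
      a' * p1 + p2 - (b * q1 + q2) = (a' - b) * p1 + (b * (p1 - q1) + (p2 - q2)) by ring.
    exact: idt.
  by apply: adicD; [apply: (adicM (adic1 a) kp) | apply: adicD => //; apply: adicMl].
Qed.

Let grad (p : P) : 'rV[F]_(n * n) := \row_k val1 (p^`M(k)).

(** The Lie algebra is the common kernel of the gradients at 1 of functions vanishing on H, and Pi
    projects onto it. The gradient of y_j - sum_l Pi l j y_l is zero on the Lie algebra, so by
    duality it is the gradient of a vanishing p, and p equals its linear part up to second order. *)
Lemma lie_projection : exists Pi : 'M[F]_(n * n),
  (forall a : 'rV_(n * n), lie_alg H (vec_mx (a *m Pi))) /\
  forall j, adicH 2 (y j - \sum_l Pi l j *: y l).
Proof.
have [| |U UP] := @vspace_of_pred F 'rV[F]_(n * n)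
  (fun a => exists2 p, vanishes p & grad p = a).
- exists 0; first exact: vanishes0.
  by apply/rowP => k; rewrite !mxE linear0 meval0.
- move=> c _ _ [p p0 <-] [q q0 <-]; exists (c%:MP * p + q).
    exact: vanishes_linear.
  by apply/rowP => k; rewrite !mxE mderivD mevalD mderiv_mulC mevalM mevalC.
pose B : 'M[F]_(\dim U, n * n) := \matrix_i (vbasis U)`_i.
have UB a : a \in U -> exists c : 'rV_(\dim U), a = c *m B.
  move=> aU; exists (\row_i coord (vbasis U) i a); rewrite {1}(coord_vbasis aU).
  by rewrite mulmx_sum_row; apply: eq_bigr => i _; rewrite mxE rowK.
have BU (a : 'rV_(n * n)) : (a <= B)%MS -> a \in U.
  case/submxP => c ->; rewrite mulmx_sum_row; apply: memv_suml => i _.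
  by rewrite memvZ // rowK vbasis_mem // mem_nth ?size_tuple.
pose K := kermx B^T; pose Pi := proj_mx K K^C%MS; exists Pi; split.
  move=> a p p0; have : (a *m Pi <= K)%MS by apply: proj_mx_sub.
  have /UB[c cB] : grad p \in U by apply/UP; exists p.
  move/sub_kermxP => aB.
  have -> : dpoly1 p (vec_mx (a *m Pi)) = (a *m Pi *m (grad p)^T) 0 0.
    rewrite [RHS]mxE; apply: eq_bigr => k _; rewrite /entry vec_mxK.
    by congr (_ * _); rewrite !mxE.
  by rewrite cB trmx_mul mulmxA aB mul0mx mxE.
move=> j.
have KPi : K *m Pi = K by apply: proj_mx_id (submx_refl _); apply: capmx_compl.
have wB : ((1%:M - Pi)^T <= B)%MS.
  rewrite submxE -[cokermx B]trmxK -trmx_mul -[X in _ == X]trmx0.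
  rewrite (inj_eq trmx_inj); have /submxP[C ->] : ((cokermx B)^T <= K)%MS.
    by apply/sub_kermxP; rewrite -trmx_mul mulmx_coker trmx0.
  by rewrite mulmxBr mulmx1 -mulmxA KPi subrr.
have /BU/UP[p p0 pE] := submx_trans (row_sub j _) wB.
have -> : y j - \sum_l Pi l j *: y l = lin p.
  have -> : y j = \sum_l (l == j)%:R *: y l.
    rewrite (bigD1 j) //= eqxx scale1r big1 ?addr0 // => l /negPf ->.
    by rewrite scale0r.
  rewrite -sumrB; apply: eq_bigr => l _; rewrite -scalerBl; congr (_ *: _).
  by have /rowP/(_ l) := pE; rewrite !mxE => ->.
have -> : lin p = p - (p - (val1 p)%:MP - lin p).
  by rewrite p0 ?mpolyC0 ?subr0 ?opprB 1?addrC ?subrK //; apply: points1.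
by apply: adicB; [apply: adic_I | apply: adic2].
Qed.

(** Let q be the leading form of p, of degree k. The k-th derivative along X is k! q(X), so q
    vanishes on the Lie algebra. Up to higher order each y_j may be replaced by z_j, its composite
    with the projection to the Lie algebra, and this turns q into the zero polynomial. *)
Lemma adic_all p : (forall X, lie_alg H X -> forall k, val1 (iter k (lder X) p) = 0) ->
  forall k, adicH k p.
Proof.
move=> Xp; have [Pi [PiL Piy]] := lie_projection.
elim=> [|k kp]; first exact: adic_0.
have [q [qs qp]] := adic_leading kp.
have iterD X j u v : iter j (lder X) (u + v) = iter j (lder X) u + iter j (lder X) v.
  by elim: j => //= j ->; rewrite lderD.
have iterZ X j c u : iter j (lder X) (c *: u) = c *: iter j (lder X) u.
  by elim: j => //= j ->; rewrite lderZ.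
have iter0 X j : iter j (lder X) 0 = 0 by elim: j => //= j ->; rewrite lder0.
have qX X : lie_alg H X -> \sum_(t <- q) t.1 * \prod_(j <- t.2) entry X j = 0.
  move=> HX; have k0 : k`!%:R != 0 :> F by rewrite pnatr_eq0 -lt0n fact_gt0.
  apply: (mulfI k0); rewrite mulr0 -[RHS](Xp X HX k) -[in RHS](subrK (wsum q) p).
  rewrite iterD mevalD (@adic_val1 0) ?add0r; last first.
    by apply: adic_iter_lder; rewrite ?addn1.
  have -> : val1 (iter k (lder X) (wsum q)) =
      \sum_(t <- q) t.1 * val1 (iter k (lder X) (cword t.2)).
    rewrite /wsum; elim: (q) => [|t q' IH]; first by rewrite !big_nil iter0 meval0.
    by rewrite !big_cons iterD mevalD iterZ mevalZ IH.
  rewrite mulr_sumr; apply: eq_big_seq => t tq.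
  by rewrite -{2}(qs t tq) val1_iter_lder_cword // qs // mulrCA.
pose z j := \sum_l Pi l j *: y l.
have zs s : adicH (size s).+1 (cword s - \prod_(j <- s) z j).
  elim: s => [|j s IH]; first by rewrite /cword !big_nil subrr.
  rewrite /cword !big_cons -/(cword s).
  have idt (R : comNzRingType) (a b c d : R) : a * c - b * d = (a - b) * c + b * (c - d) by ring.
  rewrite idt; apply: adicD; first exact: (adicM (Piy j) (adic_cword s)).
  exact: (adicM (adic_lin _) IH).
have q0 : \sum_(t <- q) t.1 *: \prod_(j <- t.2) z j = 0.
  apply: mpoly_fun_eq0 => a; rewrite -[RHS](qX _ (PiL (\row_l (a l - entry 1%:M l)))).
  rewrite raddf_sum; apply: eq_bigr => t _ /=; rewrite mevalZ rmorph_prod.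
  congr (_ * _); apply: eq_bigr => j _ /=; rewrite /entry vec_mxK mxE raddf_sum.
  by apply: eq_bigr => l _ /=; rewrite mevalZ mevalB mevalXU mevalC mulrC mxE.
rewrite -(subrK (wsum q) p); apply: adicD => //.
rewrite -[wsum q]subr0 -[X in _ - X]q0 /wsum -sumrB big_seq.
apply: big_ind => [|u v|t tq]; [exact: adic00 | exact: adicD |].
by rewrite -scalerBr -mul_mpolyC; apply: adicMl; rewrite -(qs t tq); apply: zs.
Qed.

(* A function whose derivatives at 1 all vanish is zero around 1. *)
Lemma vanishes_locally p :
  (forall X, lie_alg H X -> forall k, val1 (iter k (lder X) p) = 0) ->
  exists2 q : P, val1 q = 1 & vanishes (q * p).
Proof.
move=> /adic_all kp; have noP := @noetherian_mpoly (n * n) F (@noetherian_field F).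
have [c cp] := krull_intersection vanishes0 vanishes_linear noP kp.
exists (1 - \sum_j c j * y j); last by rewrite mulrBl mul1r.
have -> : val1 (1 - \sum_j c j * y j) = 1 - val1 (\sum_j c j * y j).
  by rewrite mevalB meval1.
rewrite [X in _ - X]raddf_sum big1 ?subr0 // => j _ /=.
by rewrite mevalM val1_y mulr0.
Qed.

(** The set K of common zeros of ps in H is closed under products and contains the neighbourhood of
    1 given by q != 0. The translates of this neighbourhood by elements of K stay in K and cover it,
    so the complement of K in H is closed too. *)
Lemma connected_subgroup (ps : seq P) : zariski_connected H ->
  (forall p, p \in ps -> forall X, lie_alg H X -> forall k, val1 (iter k (lder X) p) = 0) ->
  (forall g h, H g -> H h -> (forall p, p \in ps -> p.@[entry g] = 0) ->
     (forall p, p \in ps -> p.@[entry h] = 0) -> forall p, p \in ps -> p.@[entry (g *m h)] = 0) ->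
  forall p, p \in ps -> vanishes p.
Proof.
move=> Hconn ps1 psM.
have [q q1 qps] : exists2 q : P, val1 q = 1 & forall p, p \in ps -> vanishes (q * p).
  elim: (ps) ps1 => [|p s IH] ps1; first by exists 1; rewrite ?meval1.
  have [q q1 qs] := IH (fun p' p's => ps1 p' (mem_behead (s := p :: s) p's)).
  have [q' q'1 qp] := vanishes_locally (ps1 p (mem_head _ _)).
  exists (q' * q) => [|p']; first by rewrite mevalM q1 q'1 mulr1.
  rewrite inE => /orP[/eqP ->|/qs qp'] g Hg.
    by have := qp g Hg; rewrite !mevalM mulrAC => ->; rewrite mul0r.
  by have := qp' g Hg; rewrite -mulrA !mevalM => ->; rewrite mulr0.
(* Vanishing at 1 is the hypothesis for X = 0 and no derivative. *)
have ps0 p : p \in ps -> val1 p = 0.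
  move=> pps; apply: (ps1 p pps 0 _ 0%N) => p' _.
  by rewrite /dpoly1 big1 // => k _; rewrite /entry raddf0 mxE mul0r.
pose K g := H g /\ forall p, p \in ps -> p.@[entry g] = 0.
have K1 : K 1%:M by split; [apply: points1 | apply: ps0].
have qK g : H g -> q.@[entry g] != 0 -> K g.
  move=> Hg qg; split=> // p /qps/(_ g Hg)/eqP.
  by rewrite mevalM mulf_eq0 (negPf qg) => /eqP.
have [||||KH|NKH] := Hconn (fun g => forall p, p \in ps -> p.@[entry g] = 0)
    (fun g => forall h, K h -> q.@[entry (invmx h *m g)] = 0).
- by exists (fun p => p \in ps).
- exists (fun p => exists2 h, K h & p = ltrans (invmx h) q) => g; split.
    by move=> qg _ [h Kh ->]; rewrite meval_ltrans; apply: qg.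
  by move=> qg h Kh; rewrite -meval_ltrans; apply: qg; exists h.
- move=> g Hg; case: (classic (forall h, K h -> q.@[entry (invmx h *m g)] = 0)); first by right.
  move=> nqg; left => p pps; apply: NNPP => pg; apply: nqg => h Kh.
  have Hh := Kh.1; have uh := points_unit Hh.
  apply/eqP; apply: contraT => /(qK _ (pointsM (pointsV Hh) Hg))[_ Kg].
  case: pg; rewrite -[g](mulKVmx uh); apply: psM pps => //; last by case: Kh.
  by apply: pointsM => //; apply: pointsV.
- move=> g Hg Kg NKg; have := NKg g (conj Hg Kg).
  by rewrite mulVmx ?(points_unit Hg) // q1 => /eqP; rewrite oner_eq0.
- by move=> p pps g Hg; apply: KH.
- have := NKH 1%:M (points1 H) _ K1; rewrite invmx1 mul1mx q1 => /eqP.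
  by rewrite oner_eq0.
Qed.

End Taylor.

(** * Differentiation of modules *)

Section Functionals.
Context {F : fieldType} {V : vectType F}.

Lemma functional_ext (x z : V) : (forall phi : 'Hom(V, F^o), phi x = phi z) -> x = z.
Proof.
move=> xz; rewrite (coord_vbasis (memvf x)) (coord_vbasis (memvf z)).
apply: eq_bigr => i _; congr (_ *: _).
have [phi phiE] := @lfun_of_linear F V F^o (coord (vbasis {: V}) i) (fun a u v => linearP _ a u v).
by rewrite -!phiE.
Qed.

Lemma functionals_cut (U : {vspace V}) : exists phi : 'I_(\dim {: V}) -> 'Hom(V, F^o),
  forall x, (x \in U) <-> (forall a, phi a x = 0).
Proof.
pose q : 'End(V) := \1%VF - projv U.
have qU x : (x \in U) = (q x == 0).
  rewrite /q add_lfunE opp_lfunE id_lfunE subr_eq0.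
  apply/idP/eqP => [/projv_id->//|->]; exact: memv_proj.
have /fin_all_exists[phi phiE] : forall a : 'I_(\dim {: V}), exists phi : 'Hom(V, F^o),
    forall x, phi x = coord (vbasis {: V}) a (q x).
  by move=> a; apply: lfun_of_linear => c u v; rewrite !linearP.
exists phi => x; rewrite qU; split.
  by move=> /eqP qx a; rewrite phiE qx linear0.
move=> phi0; apply/eqP; rewrite (coord_vbasis (memvf (q x))) big1 // => a _.
by rewrite -phiE phi0 scale0r.
Qed.

End Functionals.

Section Differential.
Context {F : numClosedFieldType} {n : nat} (G : @linAlgGroup F n).
Local Notation P := {mpoly F[n * n]}.
Hypothesis G_connected : zariski_connected G.
Context {r : nat} {A : 'M[int]_r} {e f : 'I_r -> 'M[F]_n}.
Hypothesis A2 : forall i, A i i = 2.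
Hypothesis G_chev : chevalley_generators A (lie_alg G) e f.

Lemma lie_alg_ind (M : 'M[F]_n -> Prop) : lie_subalgebra M ->
  (forall i, M (e i) /\ M (f i)) -> forall X, lie_alg G X -> M X.
Proof. by move=> Msub Mef X; have [_ LP _ _ _] := G_chev; move/LP; apply. Qed.

Lemma lie_alg_gen i : lie_alg G (e i) /\ lie_alg G (f i).
Proof. by have [_ LP _ _ _] := G_chev; split; apply/LP => M _ Mef; case: (Mef i). Qed.

Lemma lie_alg_sub : lie_subalgebra (lie_alg G).
Proof.
have [_ LP _ _ _] := G_chev; split.
- by apply/LP => M [].
- move=> a X Y /LP LX /LP LY; apply/LP => M Msub Mef; have [_ lin _] := Msub.
  by apply: lin; [apply: LX | apply: LY].
- move=> X Y /LP LX /LP LY; apply/LP => M Msub Mef; have [_ _ br] := Msub.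
  by apply: br; [apply: LX | apply: LY].
Qed.

(* As e_i and f_i are commutators, so is all of the Lie algebra. *)
Lemma lie_alg_perfect (M : 'M[F]_n -> Prop) : M 0 ->
  (forall a X Y, M X -> M Y -> M (a *: X + Y)) -> (forall X Y, M (lie_bracket X Y)) ->
  forall X, lie_alg G X -> M X.
Proof.
move=> M0 Ml Mb; apply: lie_alg_ind => [|i]; first by split.
have [_ _ _ /(_ i i)[he hf] _] := G_chev.
have a2 : 2%:~R != 0 :> F by rewrite intr_eq0.
rewrite A2 in he hf; split.
  by rewrite -[e i](scalerK a2) -he -[_ *: _]addr0; apply: Ml.
rewrite -[f i](scalerK a2) -[_ *: f i]opprK -scaleNr -hf -[- _]scaleN1r scalerA.
by rewrite -[_ *: _]addr0; apply: Ml.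
Qed.

Lemma lie_alg_tr0 X : lie_alg G X -> \tr X = 0.
Proof.
apply: (lie_alg_perfect (M := fun X => \tr X = 0)) => [|a Y Z Y0 Z0|Y Z].
- exact: mxtrace0.
- by rewrite linearP /= Y0 Z0 mulr0 addr0.
- by rewrite linearB /= mxtrace_mulC subrr.
Qed.

Let detP : P := \det generic_mx.

Let detPE g : detP.@[entry g] = \det g.
Proof. by rewrite -[in RHS](meval_generic g) det_map_mx. Qed.

Let mpoly_ext (p q : P) : (forall g, p.@[entry g] = q.@[entry g]) -> p = q.
Proof.
move=> pq; apply/eqP; rewrite -subr_eq0; apply/eqP/mpoly_fun_eq0 => a.
have aE : entry (vec_mx (\row_k a k)) =1 a by move=> k; rewrite /entry vec_mxK mxE.
by rewrite -(meval_eq _ aE) mevalB pq subrr.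
Qed.

(** The determinant is an eigenfunction of all invariant derivations, hence killed by commutators,
    and the Lie algebra is perfect. This removes the denominators from regular functions on G. *)
Lemma det_group g : G g -> \det g = 1.
Proof.
have lder_det X : lder X detP = (dpoly1 detP X)%:MP * detP.
  apply: mpoly_ext => h; rewrite meval_lder -[h in dirder (entry h)]mulmx1 -dirder_ltrans.
  have -> : ltrans h detP = (\det h)%:MP * detP.
    by apply: mpoly_ext => h'; rewrite meval_ltrans mevalM mevalC !detPE det_mulmx.
  rewrite dirderM dirderC mul0r add0r mevalM !mevalC detPE mulrC.
  by rewrite -dpoly1E.
have det_lin a X Y : dpoly1 detP (a *: X + Y) = a * dpoly1 detP X + dpoly1 detP Y.
  by rewrite -!dpoly1_lder lder_linearX mevalD mevalZ.
have dX X : lie_alg G X -> dpoly1 detP X = 0.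
  apply: (lie_alg_perfect (M := fun X => dpoly1 detP X = 0)) => [|a Y Z Y0 Z0|Y Z].
  - by have := det_lin (-1) 0 0; rewrite scaler0 addr0 mulN1r addNr.
  - by rewrite det_lin Y0 Z0 mulr0 addr0.
  - have ll Y' Z' : lder Y' (lder Z' detP) =
        (dpoly1 detP Z')%:MP * ((dpoly1 detP Y')%:MP * detP).
      by rewrite [lder Z' _]lder_det lderM [lder Y' _%:MP]lderC mul0r add0r lder_det.
    by rewrite -dpoly1_lder lder_bracket (ll Y Z) (ll Z Y) mulrCA subrr meval0.
move=> Gg; have := @connected_subgroup _ _ G [:: detP - 1] G_connected.
move=> /(_ _ _ (detP - 1) (mem_head _ _) g Gg); rewrite mevalB meval1 detPE => d1.
apply/eqP; rewrite -subr_eq0; apply/eqP/d1.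
- move=> p; rewrite inE => /eqP -> X GX k; elim: k => [|k _].
    by rewrite /= mevalB meval1 detPE det1 subrr.
  rewrite iterSr lderB lder_det dX // mpolyC0 mul0r -mpolyC1 lderC subr0.
  by elim: k => [|k IH] /=; rewrite ?meval0 // (_ : iter k _ _ = 0) ?lder0 ?meval0 //;
     elim: (k) => //= j ->; rewrite lder0.
- move=> h h' _ _ hh hh' p; rewrite inE => /eqP ->.
  have := hh _ (mem_head _ _); have := hh' _ (mem_head _ _).
  rewrite !mevalB !meval1 !detPE det_mulmx => /eqP; rewrite subr_eq0 => /eqP ->.
  by rewrite mulr1.
Qed.

Section Module.
Context (V : gmodule G).

Definition mcoef (phi : 'Hom(V, F^o)) (v : V) (p : P) : Prop :=
  forall g, G g -> phi (gact V g v) = p.@[entry g].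

Lemma mcoef_represents (phi : 'Hom(V, F^o)) v p k : represents G p k (fun g => phi (gact V g v)) ->
  mcoef phi v p.
Proof. by move=> pk g Gg; rewrite pk // det_group // expr1n divr1. Qed.

Lemma mcoef_exists (phi : 'Hom(V, F^o)) v : exists p, mcoef phi v p.
Proof.
by have [p [k pk]] := gact_regular phi v; exists p; apply: mcoef_represents pk.
Qed.

(** The value does not depend on the polynomial p, since elements of the Lie algebra annihilate
    functions vanishing on G. *)
Definition is_differential (D : 'M[F]_n -> 'End(V)) : Prop :=
  forall X, lie_alg G X -> forall phi v p, mcoef phi v p -> phi (D X v) = dpoly1 p X.

Lemma differential_exists : exists D, is_differential D.
Proof.
pose d : nat := \dim {: V}; pose b : d.-tuple V := vbasis {: V}.
have /fin_all_exists[phi phiE] : forall a : 'I_d, exists phi : 'Hom(V, F^o),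
    forall x, phi x = coord b a x.
  by move=> a; apply: lfun_of_linear => c u v; rewrite linearP.
have /fin_all_exists[p pP] : forall a : 'I_d, exists p : 'I_d -> P,
    forall j : 'I_d, mcoef (phi a) b`_j (p j).
  by move=> a; exact (fin_all_exists (fun j : ordinal _ => mcoef_exists (phi a) b`_j)).
suff /functional_choice[D DP] : forall X, exists D : 'End(V), lie_alg G X ->
    forall phi v p, mcoef phi v p -> phi (D v) = dpoly1 p X.
  by exists D => X LX; exact (DP X LX).
move=> X.
have [D DE] : exists D : 'End(V), forall v,
    D v = \sum_(a < d) (\sum_(j < d) coord b j v * dpoly1 (p a j) X) *: b`_a.
  apply: lfun_of_linear => c u v; rewrite scaler_sumr -big_split; apply: eq_bigr => a _ /=.
  rewrite scalerA -scalerDl; congr (_ *: _).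
  rewrite mulr_sumr -big_split; apply: eq_bigr => j _ /=.
  by rewrite linearP /= mulrDl mulrA.
exists D => LX psi v q qP.
have bE x : x = \sum_(a < d) phi a x *: b`_a.
  by rewrite {1}(coord_vbasis (memvf x)); apply: eq_bigr => a _; rewrite phiE.
pose q' : P := \sum_(a < d) psi b`_a *: \sum_(j < d) coord b j v *: p a j.
have qq' : vanishes G (q - q').
  move=> g Gg; rewrite mevalB -qP //.
  have -> : q'.@[entry g] =
      \sum_(a < d) psi b`_a * \sum_(j < d) coord b j v * (p a j).@[entry g].
    rewrite /q' raddf_sum; apply: eq_bigr => a _ /=; rewrite mevalZ raddf_sum.
    by congr (_ * _); apply: eq_bigr => j _ /=; rewrite mevalZ.
  rewrite {1}(bE (gact V g v)) linear_sum; apply/eqP; rewrite subr_eq0; apply/eqP.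
  apply: eq_bigr => a _ /=; rewrite linearZ /= mulrC; congr (_ * _).
  rewrite {1}(coord_vbasis (memvf v)) !linear_sum; apply: eq_bigr => j _ /=.
  by rewrite !linearZ /= pP.
have dsum I (s : seq I) (u : I -> P) : dpoly1 (\sum_(i <- s) u i) X = \sum_(i <- s) dpoly1 (u i) X.
  apply: (big_morph (fun p => dpoly1 p X)) => [u1 u2|]; first exact: dirderD.
  by rewrite -mpolyC0 dpoly1E dirderC.
have dZ c u : dpoly1 (c *: u) X = c * dpoly1 u X.
  by rewrite -mul_mpolyC !dpoly1E dirderM dirderC mul0r add0r mevalC.
have -> : dpoly1 q X = dpoly1 q' X.
  by rewrite -[q](subrK q') dpoly1E dirderD -!dpoly1E (LX _ qq') add0r.
rewrite DE linear_sum dsum; apply: eq_bigr => a _ /=; rewrite linearZ dZ dsum mulrC.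
by congr (_ * _); apply: eq_bigr => j _; rewrite dZ.
Qed.

Context {D : 'M[F]_n -> 'End(V)}.
Hypothesis DP : is_differential D.

Lemma differential_linear a X Y v : lie_alg G X -> lie_alg G Y ->
  D (a *: X + Y) v = a *: D X v + D Y v.
Proof.
move=> LX LY; have LXY : lie_alg G (a *: X + Y) by have [_ lin _] := lie_alg_sub; apply: lin.
apply: functional_ext => phi; have [p pP] := mcoef_exists phi v.
rewrite linearP /= (DP LXY pP) (DP LX pP) (DP LY pP).
by rewrite -!dpoly1_lder lder_linearX mevalD mevalZ.
Qed.

(** Translating by g moves the derivative to 1, where it is computed with the functional phi o g. *)
Lemma lder_mcoef X phi v p q : lie_alg G X -> mcoef phi v p -> mcoef phi (D X v) q ->
  vanishes G (lder X p - q).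
Proof.
move=> LX pP qP g Gg; rewrite mevalB -qP // meval_lder -[g in dirder (entry g)]mulmx1.
rewrite -dirder_ltrans -dpoly1E.
have -> : phi (gact V g (D X v)) = (phi \o gact V g)%VF (D X v) by rewrite comp_lfunE.
rewrite (DP LX (p := ltrans g p)) ?subrr // => h Gh.
by rewrite meval_ltrans comp_lfunE -pP ?gactM ?comp_lfunE //; apply: pointsM.
Qed.

Lemma differential_bracket X Y v : lie_alg G X -> lie_alg G Y ->
  D (lie_bracket X Y) v = D X (D Y v) - D Y (D X v).
Proof.
move=> LX LY; have LXY : lie_alg G (lie_bracket X Y) by have [_ _ br] := lie_alg_sub; apply: br.
apply: functional_ext => phi; have [p pP] := mcoef_exists phi v.
have [q qP] := mcoef_exists phi (D X v); have [q' qP'] := mcoef_exists phi (D Y v).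
rewrite linearB /= (DP LXY pP) (DP LX qP') (DP LY qP) -!dpoly1_lder lder_bracket mevalB.
have key Z u w : lie_alg G Z -> vanishes G (u - w) ->
    (lder Z u).@[entry 1%:M] = (lder Z w).@[entry 1%:M].
  move=> LZ uw; apply/eqP; rewrite -subr_eq0 -mevalB -lderB; apply/eqP.
  by apply: (vanishes_lder LZ uw); apply: points1.
have e1 := key X (lder Y p) q' LX (lder_mcoef LY pP qP').
have e2 := key Y (lder X p) q LY (lder_mcoef LX pP qP).
exact (f_equal2 (fun a b => a - b) e1 e2).
Qed.

Lemma lie_actsP X v w : lie_alg G X -> lie_acts X v w <-> w = D X v.
Proof.
move=> LX; split=> [Xvw|->].
  apply: functional_ext => phi; have [p [k [pk ->]]] := Xvw phi.
  by rewrite (DP LX (mcoef_represents pk)) lie_alg_tr0 // mul0rn mulr0 subr0.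
move=> phi; have [p pP] := mcoef_exists phi v; exists p, 0%N; split.
  by move=> g Gg; rewrite pP // expr0 divr1.
by rewrite (DP LX pP) mulr0n mulr0 subr0.
Qed.

Section Subgroup.
Context (H : @linAlgGroup F n) (sHG : forall g, H g -> G g).

Lemma lie_alg_subgroup X : lie_alg H X -> lie_alg G X.
Proof. by move=> HX p pG; apply: HX => g /sHG; apply: pG. Qed.

Lemma group_stable_lie (U : {vspace V}) :
  (forall g, H g -> forall u, u \in U -> gact V g u \in U) ->
  forall X, lie_alg H X -> forall u, u \in U -> D X u \in U.
Proof.
move=> HU X HX u uU; have [phi phiU] := functionals_cut U.
apply/phiU => a; have [p pP] := mcoef_exists (phi a) u.
rewrite (DP (lie_alg_subgroup HX) pP); apply: HX => g Hg.
by rewrite -pP; [apply/(phiU _).1/HU | apply: sHG].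
Qed.

(** U is stable under g when the coefficients phi_a (g b_j) vanish, for functionals phi_a cutting
    out U and a basis b_j of U. Their iterated derivatives at 1 are phi_a (X^k b_j) = 0, and
    stability is preserved under products. *)
Lemma lie_stable_group (U : {vspace V}) : zariski_connected H ->
  (forall X, lie_alg H X -> forall u, u \in U -> D X u \in U) ->
  forall g, H g -> forall u, u \in U -> gact V g u \in U.
Proof.
move=> Hconn LU; have [phi phiU] := functionals_cut U; set b := vbasis U.
have bU j : b`_j \in U.
  have [jb|jb] := ltnP j (size b); last by rewrite nth_default ?mem0v.
  by apply: vbasis_mem; apply: mem_nth.
have /fin_all_exists[p pP] : forall a, exists p : 'I_(\dim U) -> P,
    forall j : 'I_(\dim U), mcoef (phi a) b`_j (p j).
  by move=> a; exact (fin_all_exists (fun j : ordinal _ => mcoef_exists (phi a) b`_j)).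
pose ps := [seq p x.1 x.2 | x <- enum [set: 'I_(\dim {: V}) * 'I_(\dim U)]].
have psP a j : p a j \in ps.
  by apply/mapP; exists (a, j) => //; rewrite mem_enum inE.
have psU g : H g -> (forall q, q \in ps -> q.@[entry g] = 0) ->
    forall u, u \in U -> gact V g u \in U.
  move=> Hg psg u uU; rewrite (coord_vbasis uU) linear_sum; apply: memv_suml => j _ /=.
  rewrite linearZ memvZ //; apply/phiU => a; rewrite pP; last exact: sHG.
  exact: psg.
have Ups g : H g -> (forall u, u \in U -> gact V g u \in U) ->
    forall q, q \in ps -> q.@[entry g] = 0.
  move=> Hg gU _ /mapP[[a j] _ ->] /=; rewrite -pP; last exact: sHG.
  by apply/(phiU _).1/gU.
suff ps0 : forall q, q \in ps -> vanishes H q.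
  by move=> g Hg; apply: psU => // q qps; apply: ps0.
apply: connected_subgroup => //.
  move=> _ /mapP[[a j] _ ->] X HX k /=.
  have iterP i v q q' : mcoef (phi a) v q -> mcoef (phi a) (iter i (D X) v) q' ->
      vanishes H (iter i (lder X) q - q').
    elim: i q' => [|i IH] q' vq vq' /=.
      by move=> g /sHG Gg; rewrite mevalB -vq // vq' // subrr.
    have [q'' vq''] := mcoef_exists (phi a) (iter i (D X) v).
    have -> : lder X (iter i (lder X) q) - q' =
        lder X (iter i (lder X) q - q'') + (lder X q'' - q').
      by rewrite lderB addrA subrK.
    apply: vanishesD; first by apply: vanishes_lder => //; apply: IH.
    by move=> g /sHG; apply: (lder_mcoef (lie_alg_subgroup HX) vq'' vq').
  have [q vq] := mcoef_exists (phi a) (iter k (D X) b`_j).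
  have := iterP k _ _ _ (pP a j) vq 1%:M (points1 H).
  rewrite mevalB -vq ?gact1 ?id_lfunE; last exact: points1.
  rewrite (_ : phi a _ = 0) ?subr0 //; apply/(phiU _).1.
  by elim: (k) => //= i IH; apply: LU.
move=> g h Hg Hh psg psh; apply: Ups; first exact: pointsM.
move=> u uU; rewrite gactM ?comp_lfunE; [|exact: sHG|exact: sHG].
by apply: (psU _ Hg psg); apply: (psU _ Hh psh).
Qed.

End Subgroup.
End Module.
End Differential.

(** * The branching rules *)

Section Submodule.
Context {F : numClosedFieldType} {n : nat} {H : @linAlgGroup F n} (V : gmodule H).
Context (U : {vspace V}).
Hypothesis HU : forall g, H g -> forall u, u \in U -> gact V g u \in U.

Definition sub_act (g : 'M[F]_n) : 'End(subvs_of U) :=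
  (linfun (vsproj U) \o (gact V g \o linfun (@vsval _ _ U)))%VF.

Lemma sub_actE g w : sub_act g w = vsproj U (gact V g (vsval w)).
Proof. by rewrite !comp_lfunE !lfunE. Qed.

Fact sub_act1 : sub_act 1%:M = \1%VF.
Proof. by apply/lfunP => w; rewrite sub_actE gact1 !id_lfunE vsvalK. Qed.

Fact sub_actM g h : H g -> H h -> sub_act (g *m h) = (sub_act g \o sub_act h)%VF.
Proof.
move=> Hg Hh; apply/lfunP => w; rewrite comp_lfunE !sub_actE gactM // comp_lfunE.
by rewrite vsprojK // HU // subvsP.
Qed.

Fact sub_act_regular (phi : 'Hom(subvs_of U, F^o)) (w : subvs_of U) :
  regular_on H (fun g => phi (sub_act g w)).
Proof.
have [p [k pk]] := gact_regular (phi \o linfun (vsproj U))%VF (vsval w).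
by exists p, k => g Hg; rewrite sub_actE -pk // comp_lfunE lfunE.
Qed.

Definition submodule : gmodule H := GModule sub_act1 sub_actM sub_act_regular.

Lemma vsval_act g (w : submodule) : H g -> vsval (gact submodule g w) = gact V g (vsval w).
Proof.
by move=> Hg; rewrite -[gact submodule g]/(sub_act g) sub_actE vsprojK ?HU ?subvsP.
Qed.

End Submodule.

Lemma injective_surjective_bijective (S T : Type) (g : S -> T) :
  injective g -> (forall y, exists x, g x = y) -> bijective g.
Proof.
move=> ginj /functional_choice[g' g'K].
by exists g' => // x; apply: ginj; rewrite g'K.
Qed.

Section Branching.
Context {F : numClosedFieldType} {n : nat} {G H : @linAlgGroup F n}.
Context {e f : 'I_6 -> 'M[F]_n} {eh fh : 'I_4 -> 'M[F]_n} {a b : 'I_4 -> F}.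
Hypothesis G_connected : zariski_connected G.
Hypothesis G_chev : chevalley_generators cartan_E6 (lie_alg G) e f.
Hypothesis sHG : forall g, H g -> G g.
Hypothesis H_connected : zariski_connected H.
Hypothesis H_chev : chevalley_generators cartan_F4 (lie_alg H) eh fh.
Hypothesis ab1 : forall i, a i * b i = 1.
Hypothesis ehE : forall i, eh i = a i *: fold e i.
Hypothesis fhE : forall i, fh i = b i *: fold f i.

Let A2 i : cartan_E6 i i = 2.
Proof. by rewrite mxE; case: i => [[|[|[|[|[|[|i]]]]]] //=]. Qed.

(** The summands of the differentiated module are stable under the connected group H. They are
    irreducible under H because an H-stable subspace is stable under the Lie algebra of H. *)
Lemma branching (d : case_data) (k : nat) (I : finType) (nu : I -> 'rV[int]_4)
    (V : gmodule G) (mu : 'rV[int]_6) :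
  check_case d -> (0 < size (cd_y d))%N ->
  (forall c c', nu c = nu c' -> c = c') ->
  (forall c, exists us : nat -> 'I_(size (cd_y d)).-1.+1,
    forall j, nu c 0 j = \sum_(i < k) nth 0 (nth [::] (cd_nu d) (us i)) j) ->
  (forall us : nat -> 'I_(size (cd_y d)).-1.+1, exists c,
    forall j, nu c 0 j = \sum_(i < k) nth 0 (nth [::] (cd_nu d) (us i)) j) ->
  (forall i, mu 0 i = (i.+1 == cd_weight d)%:R *+ k) ->
  irreducible_of_highest_weight e f mu V ->
  decomposes_as eh fh (res sHG V) nu.
Proof.
move=> chk y0 nu_inj nu_low nu_up muE [irrV [v v0 hwv]].
have [D DP] := differential_exists G_connected A2 G_chev V.
have Dlin := differential_linear G_connected A2 G_chev DP.
have Dbr := differential_bracket G_connected A2 G_chev DP.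
have [L0 Llin Lbr] := lie_alg_sub G_chev.
have Le i := (lie_alg_gen G_chev i).1; have Lf i := (lie_alg_gen G_chev i).2.
pose h i := lie_bracket (e i) (f i); have Lh i : lie_alg G (h i) by apply: Lbr.
have D0 w : D 0 w = 0.
  by have := Dlin (-1) 0 0 w L0 L0; rewrite scaler0 addr0 scaleN1r addNr.
have DZ c X w : lie_alg G X -> D (c *: X) w = c *: D X w.
  by move=> LX; have := Dlin c X 0 w LX L0; rewrite D0 !addr0.
have DD X Y w : lie_alg G X -> lie_alg G Y -> D (X + Y) w = D X w + D Y w.
  by move=> LX LY; have := Dlin 1 X Y w LX LY; rewrite !scale1r.
have [_ _ hhef hef _] := G_chev.
have rel : chevalley_action cartan_E6 (D \o e) (D \o f) (D \o h).
  split=> i j w /=.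
  - have := Dbr (e i) (f j) w (Le i) (Lf j); case: eqVneq => [<-|ij] /=.
      by rewrite -/(h i) => ->; rewrite addrC subrK.
    have [_ ->] := hhef i j; rewrite // D0 => /eqP.
    by rewrite eq_sym subr_eq0 addr0 => /eqP.
  - have := Dbr (h i) (h j) w (Lh i) (Lh j); have [-> _] := hhef i j.
    by rewrite D0 => /eqP; rewrite eq_sym subr_eq0 => /eqP.
  - have := Dbr (h i) (e j) w (Lh i) (Le j); have [-> _] := hef i j.
    by rewrite DZ // => ->; rewrite addrC subrK.
  - have := Dbr (h i) (f j) w (Lh i) (Lf j); have [_ ->] := hef i j.
    by rewrite DZ // scaleNr => ->; rewrite addrC subrK.
(* The elements of L preserving U form a subalgebra, so stability can be tested on generators. *)
have stab (L : 'M[F]_n -> Prop) (U : {vspace V}) : lie_subalgebra L ->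
    (forall X, L X -> lie_alg G X) ->
    lie_subalgebra (fun X => L X /\ forall u, u \in U -> D X u \in U).
  move=> [L'0 L'lin L'br] LG; split.
  - by split=> // u _; rewrite D0 mem0v.
  - move=> c X Y [LX XU] [LY YU]; split=> [|u uU]; first exact: L'lin.
    by rewrite Dlin ?memvD ?memvZ ?XU ?YU //; apply: LG.
  - move=> X Y [LX XU] [LY YU]; split=> [|u uU]; first exact: L'br.
    rewrite Dbr; [|exact: LG|exact: LG].
    by apply: memvB; [apply/XU/YU | apply/YU/XU].
have irr (U : {vspace V}) : (forall i z, z \in U -> (D \o e) i z \in U) ->
    (forall i z, z \in U -> (D \o f) i z \in U) -> U = 0%VS \/ U = fullv.
  move=> eU fU; apply: irrV.2 => g Gg; apply/subvP => _ /memv_imgP[u uU ->].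
  apply: (lie_stable_group G_connected A2 G_chev DP (H := G)) => // X LX.
  apply: (lie_alg_ind G_chev (stab _ U (lie_alg_sub G_chev) _) _ LX).2 => // i.
  by split; split=> // u'; [apply: eU | apply: fU].
have actsP X u w : lie_alg G X -> lie_acts X u w <-> w = D X u.
  exact: (lie_actsP G_connected A2 G_chev DP).
have ev i : (D \o e) i v = 0.
  by have [/(actsP _ _ _ (Le i)) + _] := hwv i.
have hv i : (D \o h) i v = ((i.+1 == cd_weight d)%:R *+ k)%:~R *: v.
  by have [_ /(actsP _ _ _ (Lh i))] := hwv i; rewrite muE.
have [|W [z [zP Wst Wirr Wfull Wdir]]] := case_decomposition chk
  (nuI := fun c j => nu c 0 j) _ nu_low nu_up y0 rel irr v0 ev hv.
  by move=> c c' cc'; apply: nu_inj; apply/rowP.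
have Lfold (x : 'I_6 -> 'M[F]_n) i : (forall j, lie_alg G (x j)) -> lie_alg G (fold x i).
  move=> Lx; apply: fold_ind => // j j'.
  by rewrite -[x j]scale1r; apply: Llin.
have Dfold (x : 'I_6 -> 'M[F]_n) i w : (forall j, lie_alg G (x j)) ->
    fold (D \o x) i w = D (fold x i) w.
  by move=> Lx; case: i => [[|[|[|[|i]]]] ii] //; rewrite /fold /= ?add_lfunE ?DD.
have LHG X : lie_alg H X -> lie_alg G X by apply: lie_alg_subgroup.
have a0 i : a i != 0 by have := oner_neq0 F; rewrite -(ab1 i) mulf_eq0 negb_or => /andP[].
have b0 i : b i != 0 by have := oner_neq0 F; rewrite -(ab1 i) mulf_eq0 negb_or => /andP[].
have Deh i w : D (eh i) w = a i *: fold (D \o e) i w.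
  by rewrite ehE DZ ?Dfold //; apply: Lfold.
have Dfh i w : D (fh i) w = b i *: fold (D \o f) i w.
  by rewrite fhE DZ ?Dfold //; apply: Lfold.
have LeH i := (lie_alg_gen H_chev i).1; have LfH i := (lie_alg_gen H_chev i).2.
have [_ _ LHbr] := lie_alg_sub H_chev.
have HW c g : H g -> forall u, u \in W c -> gact V g u \in W c.
  apply: (lie_stable_group G_connected A2 G_chev DP sHG H_connected) => X LX.
  apply: (lie_alg_ind H_chev (stab _ (W c) (lie_alg_sub H_chev) LHG) _ LX).2 => i.
  by split; split=> // u uW; rewrite ?Deh ?Dfh memvZ //; case: (Wst c i u uW).
pose M c : gmodule H := @submodule _ _ _ (res sHG V) (W c) (HW c).
have M_acts c X (u w : M c) : lie_alg H X -> vsval w = D X (vsval u) -> lie_acts X u w.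
  move=> LX wE phi; pose psi := (phi \o linfun (vsproj (W c)))%VF.
  have [p pP] := mcoef_exists G_connected A2 G_chev psi (vsval u); exists p, 0%N; split.
    move=> g Hg; rewrite expr0 divr1 -pP; last exact: sHG.
    by rewrite -[gact (M c) g]/(@sub_act _ _ _ (res sHG V) (W c) g) sub_actE comp_lfunE lfunE.
  rewrite mulr0n mulr0 subr0 -(DP X (LHG _ LX) psi _ _ pP) -wE.
  by rewrite comp_lfunE lfunE /= vsvalK.
exists M; split.
- move=> c; have [zW z0 ez hz] := zP c; split.
    split.
      move=> M0; have : vsproj (W c) (z c) \in {: M c}%VS by rewrite memvf.
      rewrite M0 memv0 => /eqP/(congr1 vsval); rewrite vsprojK // linear0.
      by move/eqP; rewrite (negPf z0).
    move=> U UM; pose U' : {vspace V} := (linfun (@vsval _ _ (W c)) @: U)%VS.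
    have U'P (u : M c) : (vsval u \in U') = (u \in U).
      apply/memv_imgP/idP => [[u' u'U]|uU]; last by exists u; rewrite ?lfunE.
      by rewrite lfunE => /val_inj ->.
    have HU' g : H g -> forall u, u \in U' -> gact V g u \in U'.
      move=> Hg _ /memv_imgP[u uU ->]; rewrite lfunE /= -[gact V g]/(gact (res sHG V) g).
      rewrite -(vsval_act (V := res sHG V) (HU := HW c)) // U'P; apply: (subvP (UM g Hg)).
      exact: memv_img.
    have LU' := group_stable_lie G_connected A2 G_chev DP sHG HU'.
    have [||| U'0|U'W] := Wirr c U'.
    + by apply/subvP => _ /memv_imgP[u _ ->]; rewrite lfunE; apply: subvsP.
    + move=> i t tU; rewrite -[X in X \in _](scalerK (a0 i)) -Deh memvZ //.
      by apply: LU'.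
    + move=> i t tU; rewrite -[X in X \in _](scalerK (b0 i)) -Dfh memvZ //.
      by apply: LU'.
    + left; apply/eqP; rewrite -subv0; apply/subvP => u; rewrite -U'P U'0 !memv0.
      by move=> /eqP u0; apply/eqP/val_inj/(etrans u0)/esym; apply: (linear0 (@vsval _ _ (W c))).
    + right; apply/eqP; rewrite eqEsubv subvf; apply/subvP => u _.
      by rewrite -U'P U'W subvsP.
  exists (vsproj (W c) (z c)).
    apply: contraNneq z0 => /(congr1 vsval); rewrite vsprojK // linear0 => ->.
    by [].
  move=> i; split; apply: M_acts => //; rewrite ?vsprojK // ?linear0.
  + by rewrite Deh ez scaler0.
  + exact: LHbr.
  + rewrite linearZ /= vsprojK // Dbr; [|exact: LHG|exact: LHG].
    rewrite !Deh !Dfh ez scaler0 linear0 scaler0 subr0.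
    by rewrite linearZ /= scalerA ab1 scale1r hz.
exists (fun c => linfun (@vsval _ _ (W c))); split.
  move=> c g w Hg; rewrite [LHS]lfunE [in RHS]lfunE.
  exact: (vsval_act (V := res sHG V) (HU := HW c)).
apply: injective_surjective_bijective => [w w' ww'|x].
  apply/ffunP => c; apply/val_inj/eqP; rewrite -subr_eq0; apply/eqP.
  apply: (Wdir (fun c => vsval (w c) - vsval (w' c))) => [c'|].
    by rewrite memvB ?subvsP.
  rewrite sumrB; apply/eqP; rewrite subr_eq0; apply/eqP.
  have := ww'; under eq_bigr do rewrite lfunE /=.
  by under [in RHS]eq_bigr do rewrite lfunE /=.
have : x \in (\sum_c W c)%VS by rewrite Wfull memvf.
case/memv_sumP => t tW xE.
exists (finfun (fun c => vsproj (W c) (t c)) : {dffun forall c, M c}).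
rewrite [RHS]xE; apply: eq_bigr => c _; rewrite lfunE /= ffunE vsprojK //.
exact: tW.
Qed.

End Branching.

(** * Sums of k weights in terms of multiplicities, and the diagram automorphism *)

Lemma sum_by_counts r k (us : nat -> 'I_r.+1) : exists2 c : 'I_r.+1 -> nat,
  (\sum_q c q)%N = k &
  forall g : 'I_r.+1 -> int, \sum_(i < k) g (us i) = \sum_q g q *+ c q.
Proof.
exists (fun q => #|[set i : 'I_k | us i == q]|) => [|g].
  rewrite -[RHS]card_ord -sum1_card (partition_big (fun i : 'I_k => us i) xpredT) //=.
  by apply: eq_bigr => q _; rewrite -sum1_card; apply: eq_bigl => i; rewrite inE.
rewrite (partition_big (fun i : 'I_k => us i) xpredT) //=; apply: eq_bigr => q _.
rewrite (eq_bigr (fun=> g q)) => [|i /eqP -> //]; rewrite big_const iter_addr_0.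
by congr (_ *+ _); apply: eq_card => i; rewrite inE.
Qed.

Lemma counts_by_sum r (c : 'I_r.+1 -> nat) : exists us : nat -> 'I_r.+1,
  forall g : 'I_r.+1 -> int, \sum_(i < \sum_q c q) g (us i) = \sum_q g q *+ c q.
Proof.
pose s := flatten [seq nseq (c q) q | q <- enum 'I_r.+1].
have ss : size s = (\sum_q c q)%N.
  rewrite size_flatten /shape -map_comp sumnE big_map big_enum.
  by apply: eq_bigr => q _; rewrite /= size_nseq.
exists (nth ord0 s) => g; rewrite -ss -(big_mkord xpredT (fun i => g (nth ord0 s i))).
rewrite -(big_nth ord0 xpredT g) big_flatten big_map big_enum.
by apply: eq_bigr => q _; rewrite big_nseq iter_addr_0.
Qed.

Definition diagram (i : 'I_6) : 'I_6 :=
  nth ord0 [:: @Ordinal 6 5 isT; @Ordinal 6 1 isT; @Ordinal 6 4 isT;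
    @Ordinal 6 3 isT; @Ordinal 6 2 isT; @Ordinal 6 0 isT] i.

Lemma diagramK : involutive diagram.
Proof. by case=> [[|[|[|[|[|[|i]]]]]] //= i6]; apply: val_inj. Qed.

Lemma cartan_diagram i j : cartan_E6 (diagram i) (diagram j) = cartan_E6 i j.
Proof.
by rewrite !mxE; case: i j => [[|[|[|[|[|[|i]]]]]] i6] // [[|[|[|[|[|[|j]]]]]] j6].
Qed.

(** The automorphism exchanges the terms within each folded generator, so relabelling E6 leaves F4
    in place. *)
Lemma fold_diagram (Z : zmodType) (x : 'I_6 -> Z) i : fold (x \o diagram) i = fold x i.
Proof.
have D m (m6 : (m < 6)%N) : diagram (inord m) = nth ord0 [:: inord 5; inord 1; inord 4;
    inord 3; inord 2; inord 0] m.
  apply: val_inj; rewrite /diagram inordK //.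
  by move: m m6 => [|[|[|[|[|[|m]]]]]] //=; rewrite inordK.
by case: i => [[|[|[|[|i]]]] i4] //; rewrite /fold /= !D //= addrC.
Qed.

Section Diagram.
Context {F : numClosedFieldType} {n : nat} {G : @linAlgGroup F n}.
Context {e f : 'I_6 -> 'M[F]_n}.

Lemma chevalley_diagram (L : 'M[F]_n -> Prop) :
  chevalley_generators cartan_E6 L e f ->
  chevalley_generators cartan_E6 L (e \o diagram) (f \o diagram).
Proof.
move=> [e0 LP hhef hef serre].
have inj i j : i != j -> diagram i != diagram j by rewrite (inv_eq diagramK) diagramK.
split=> [i|X|i j|i j|i j ij].
- exact: e0.
- rewrite LP; split=> XM M Ms Mef; apply: XM => // i; last exact: Mef.
  by rewrite -(diagramK i); apply: Mef.
- by have [hh ef] := hhef (diagram i) (diagram j); split=> // /inj.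
- by rewrite -cartan_diagram; apply: hef.
- by rewrite -cartan_diagram; apply: serre; apply: inj.
Qed.

Lemma highest_weight_diagram mu (V : gmodule G) :
  irreducible_of_highest_weight e f mu V ->
  irreducible_of_highest_weight (e \o diagram) (f \o diagram)
    (\row_i mu 0 (diagram i)) V.
Proof.
by move=> [irrV [v v0 hwv]]; split=> //; exists v => // i; rewrite mxE; apply: hwv.
Qed.

End Diagram.

Section Restriction.
Context {F : numClosedFieldType} {n : nat} {G H : @linAlgGroup F n}.
Context {e f : 'I_6 -> 'M[F]_n}.
Hypothesis G_connected : zariski_connected G.
Hypothesis sHG : forall g, H g -> G g.
Hypothesis H_connected : zariski_connected H.
Hypothesis H_chev : chevalley_generators cartan_F4 (lie_alg H) (fold_e e) (fold_f f).

(** A sum of k weights depends only on the multiplicities [cnt] of the weights, which become the a_i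
    of the theorem. The generators e', f' may be a relabelling of e, f. *)
Lemma branching_counts (e' f' : 'I_6 -> 'M[F]_n) (d : case_data) (r k : nat)
    (I : finType) (cnt : I -> 'I_r.+1 -> nat) (nu : I -> 'rV[int]_4)
    (mu : 'rV[int]_6) (V : gmodule G) :
  chevalley_generators cartan_E6 (lie_alg G) e' f' ->
  fold e' =1 fold e -> fold f' =1 fold f ->
  check_case d -> size (cd_y d) = r.+1 ->
  (forall a, (\sum_q cnt a q)%N = k) ->
  (forall c : 'I_r.+1 -> nat, (\sum_q c q)%N = k -> exists a, cnt a =1 c) ->
  (forall a b, nu a = nu b -> a = b) ->
  (forall a j, nu a 0 j = \sum_(q < r.+1) nth 0 (nth [::] (cd_nu d) q) j *+ cnt a q) ->
  (forall i, mu 0 i = (i.+1 == cd_weight d)%:R *+ k) ->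
  irreducible_of_highest_weight e' f' mu V ->
  decomposes_as (fold_e e) (fold_f f) (res sHG V) nu.
Proof.
move=> G_chev ee' ff' chk sy; have {sy} [er y0] : r = (size (cd_y d)).-1 /\ (0 < size (cd_y d))%N.
  by rewrite sy.
rewrite {}er in cnt * => cntk cntP nu_inj nuE muE irrV.
have s2 : sqrtC 2 != 0 :> F by rewrite sqrtC_eq0 pnatr_eq0.
(* The nodes 0 and 1 are the long simple roots of F4, whose generators carry no scalar. *)
apply: (branching G_connected G_chev sHG H_connected H_chev
  (a := fun i => if (i < 2)%N then 1 else (sqrtC 2)^-1)
  (b := fun i => if (i < 2)%N then 1 else sqrtC 2) _ _ _ chk y0 nu_inj _ _ muE irrV).
- by move=> i; case: ifP => _; rewrite ?mulr1 ?mulVf.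
- move=> i; rewrite ee'; case: i => [[|[|[|[|i]]]] i4] //;
    by rewrite /fold_e /fold_gen /= ?scale1r.
- move=> i; rewrite ff'; case: i => [[|[|[|[|i]]]] i4] //;
    by rewrite /fold_f /fold_gen /fold /= ?scale1r.
- move=> a; have [us usP] := counts_by_sum (cnt a); exists us => j.
  by rewrite nuE -(usP (fun q : 'I_(_.+1) => nth 0 (nth [::] (cd_nu d) q) j)) cntk.
- move=> us; have [c ck cP] := sum_by_counts k us; have [a ac] := cntP c ck.
  exists a => j; rewrite nuE (cP (fun q : 'I_(_.+1) => nth 0 (nth [::] (cd_nu d) q) j)).
  by apply: eq_bigr => q _; rewrite ac.
Qed.

End Restriction.

Theorem theorem17 (R : realType) (n : nat) (G H : @linAlgGroup R[i] n)
    (e f : 'I_6 -> 'M[R[i]]_n)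
    (G_connected : zariski_connected G)
    (G_simply_connected : simply_connected G)
    (G_E6 : chevalley_generators cartan_E6 (lie_alg G) e f)
    (sHG : forall g, H g -> G g)
    (H_connected : zariski_connected H)
    (H_F4 : chevalley_generators cartan_F4 (lie_alg H) (fold_e e) (fold_f f))
    (k : nat) :
  [/\ forall V : gmodule G,
        irreducible_of_highest_weight e f ('omega_1 *+ k) V ->
        decomposes_as (fold_e e) (fold_f f) (res sHG V)
          (fun a : 'I_k.+1 => 'lambda_4 *+ a),
      forall V : gmodule G,
        irreducible_of_highest_weight e f ('omega_2 *+ k) V ->
        decomposes_as (fold_e e) (fold_f f) (res sHG V)
          (fun a : sum2 k => 'lambda_1 *+ (val a).1 + 'lambda_4 *+ (val a).2),
      forall V : gmodule G,
        irreducible_of_highest_weight e f ('omega_3 *+ k) V ->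
        decomposes_as (fold_e e) (fold_f f) (res sHG V)
          (fun a : sum3 k => 'lambda_1 *+ (val a).1.1 +
                             'lambda_3 *+ (val a).1.2 + 'lambda_4 *+ (val a).2),
      forall V : gmodule G,
        irreducible_of_highest_weight e f ('omega_5 *+ k) V ->
        decomposes_as (fold_e e) (fold_f f) (res sHG V)
          (fun a : sum3 k => 'lambda_1 *+ (val a).1.1 +
                             'lambda_3 *+ (val a).1.2 + 'lambda_4 *+ (val a).2) &
      forall V : gmodule G,
        irreducible_of_highest_weight e f ('omega_6 *+ k) V ->
        decomposes_as (fold_e e) (fold_f f) (res sHG V)
          (fun a : 'I_k.+1 => 'lambda_4 *+ a)].
Proof.
have rowE (x : 'rV[int]_4) (y : 'rV[int]_4) : x = y -> x 0 =1 y 0 by move->.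
have lamE i m (j : 'I_4) : ('lambda_i *+ m) 0 j = (j.+1 == i)%:R *+ m.
  by rewrite mulmxnE mxE.
have omE i (j : 'I_6) : ('omega_i *+ k) 0 j = (j.+1 == i)%:R *+ k.
  by rewrite mulmxnE mxE.
have addE (x y : 'rV[int]_4) j : (x + y) 0 j = x 0 j + y 0 j by rewrite mxE.
have natI : injective (fun m : nat => m%:R : int) by move=> a b /eqP; rewrite eqr_nat => /eqP.
(* General generators make this apply to omega_6 as well, after relabelling by the diagram
   automorphism. *)
have case1 e' f' (mu : 'rV[int]_6) (V : gmodule G) :
    chevalley_generators cartan_E6 (lie_alg G) e' f' ->
    fold e' =1 fold e -> fold f' =1 fold f ->
    (forall i, mu 0 i = (i.+1 == 1)%:R *+ k) ->
    irreducible_of_highest_weight e' f' mu V ->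
    decomposes_as (fold_e e) (fold_f f) (res sHG V) (fun a : 'I_k.+1 => 'lambda_4 *+ a).
  move=> chev ee' ff' muE irrV.
  (* The weight 0 takes up the remaining k - a factors, which is why the sum runs over all a up to
     k. *)
  apply: (branching_counts G_connected sHG H_connected H_F4 (d := case_omega1) (r := 1)
    (cnt := fun (a : 'I_k.+1) q => nth 0%N [:: val a; k - a]%N q) chev ee' ff'
    check_omega1 _ _ _ _ _ muE irrV); first by vm_compute.
  - by move=> a; rewrite !big_ord_recl big_ord0 /= addn0 subnKC // -ltnS.
  - move=> c; rewrite !big_ord_recl big_ord0 addn0 => ck.
    have c0 : (c ord0 < k.+1)%N by rewrite ltnS -ck leq_addr.
    exists (Ordinal c0) => -[[|[|q]] q2] //=; last rewrite -ck addKn.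
      by congr c; apply: val_inj.
    by congr c; apply: val_inj.
  - move=> a b /rowE/(_ (@Ordinal 4 3 isT)); rewrite !lamE.
    by move=> /natI/val_inj.
  - by move=> a [[|[|[|[|j]]]] j4] //; rewrite lamE !big_ord_recl big_ord0 /= ?mul0rn ?addr0.
have case3 e' f' (mu : 'rV[int]_6) (V : gmodule G) :
    chevalley_generators cartan_E6 (lie_alg G) e' f' ->
    fold e' =1 fold e -> fold f' =1 fold f ->
    (forall i, mu 0 i = (i.+1 == 3)%:R *+ k) ->
    irreducible_of_highest_weight e' f' mu V ->
    decomposes_as (fold_e e) (fold_f f) (res sHG V)
      (fun a : sum3 k => 'lambda_1 *+ (val a).1.1 +
         'lambda_3 *+ (val a).1.2 + 'lambda_4 *+ (val a).2).
  move=> chev ee' ff' muE irrV.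
  apply: (branching_counts G_connected sHG H_connected H_F4 (d := case_omega3) (r := 2)
    (cnt := fun (a : sum3 k) q => nth 0%N [:: val (val a).1.1; val (val a).1.2; val (val a).2] q)
    chev ee' ff' check_omega3 _ _ _ _ _ muE irrV); first by vm_compute.
  - by move=> a; rewrite !big_ord_recl big_ord0 /= addn0 addnA; apply/eqP/(valP a).
  - move=> c; rewrite !big_ord_recl big_ord0 addn0 addnA => ck.
    pose a : 'I_k.+1 * 'I_k.+1 * 'I_k.+1 :=
      (inord (c ord0), inord (c (lift ord0 ord0)), inord (c (lift ord0 (lift ord0 ord0)))).
    have ak : (a.1.1 + a.1.2 + a.2 == k)%N by rewrite /a /= !inordK ?ck //; lia.
    by exists (Sub a ak) => -[[|[|[|q]]] q3] //=; rewrite inordK; try lia; congr c; apply: val_inj.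
  - move=> [[[a1 a2] a3] ak] [[[b1 b2] b3] bk] /rowE ab.
    move: (ab ord0) (ab (@Ordinal 4 2 isT)) (ab (@Ordinal 4 3 isT)).
    rewrite !addE !lamE /= !mul0rn !addr0 !add0r => /natI/val_inj e1.
    by move=> /natI/val_inj e2 /natI/val_inj e3; apply: val_inj; rewrite /= e1 e2 e3.
  - move=> a [[|[|[|[|j]]]] j4] //;
    by rewrite !addE !lamE !big_ord_recl big_ord0 /= ?mul0rn ?addr0 ?add0r.
split=> V irrV.
- exact: (case1 e f _ V G_E6 _ _ (omE 1%N) irrV).
- apply: (branching_counts G_connected sHG H_connected H_F4 (d := case_omega2) (r := 1)
    (cnt := fun (a : sum2 k) q => nth 0%N [:: val (val a).1; val (val a).2] q)
    G_E6 _ _ check_omega2 _ _ _ _ _ (omE 2%N) irrV) => //.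
  - by move=> a; rewrite !big_ord_recl big_ord0 /= addn0; apply/eqP/(valP a).
  - move=> c; rewrite !big_ord_recl big_ord0 addn0 => ck.
    pose a : 'I_k.+1 * 'I_k.+1 := (inord (c ord0), inord (c (lift ord0 ord0))).
    have ak : (a.1 + a.2 == k)%N by rewrite /a /= !inordK ?ck //; lia.
    by exists (Sub a ak) => -[[|[|q]] q2] //=; rewrite inordK; try lia; congr c; apply: val_inj.
  - move=> [[a1 a2] ak] [[b1 b2] bk] /rowE ab.
    move: (ab ord0) (ab (@Ordinal 4 3 isT)).
    rewrite !addE !lamE /= !mul0rn !addr0 !add0r => /natI/val_inj e1.
    by move=> /natI/val_inj e2; apply: val_inj; rewrite /= e1 e2.
  - move=> a [[|[|[|[|j]]]] j4] //;
    by rewrite !addE !lamE !big_ord_recl big_ord0 /= ?mul0rn ?addr0 ?add0r.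
- exact: (case3 e f _ V G_E6 _ _ (omE 3%N) irrV).
- apply: (case3 _ _ _ V (chevalley_diagram G_E6) (fold_diagram e) (fold_diagram f) _
    (highest_weight_diagram irrV)) => i.
  by rewrite mxE omE; case: i => [[|[|[|[|[|[|i]]]]]] i6].
- apply: (case1 _ _ _ V (chevalley_diagram G_E6) (fold_diagram e) (fold_diagram f) _
    (highest_weight_diagram irrV)) => i.
  by rewrite mxE omE; case: i => [[|[|[|[|[|[|i]]]]]] i6].
Qed.
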